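(* Let $r>1$ be a real number that is not an even integer, $r\le p<\infty$, $s>0$, $L>0$, $\sigma>0$. There is a constant $C'>0$ depending on $s,p,r,L,\sigma$ such that, for all sufficiently large $n$, $$\left(\inf_{\hat T}\sup_{f\in\mathcal{B}_{p,\infty}^s(L)}\mathbb{E}_f\left(\hat T-\|f\|_r\right)^2\right)^{1/2}\ge C'(n\ln n)^{-\frac{s}{2s+1}},$$ where the infimum is over all real-valued measurable maps $\hat T$ of the observation $\{Y(t)\}_{t\in[0,1]}$ in the Gaussian white noise model $dY(t)=f(t)\,dt+\frac{\sigma}{\sqrt n}\,dB(t)$, $t\in[0,1]$.
   Context: $B$ is a standard Brownian motion on $[0,1]$, $\sigma$ is known, and $\mathbb{E}_f$ is expectation when the mean function is $f$. $\|f\|_q=(\int_0^1|f(x)|^q\,dx)^{1/q}$. Besov ball: for $f$ on $[0,1]$ and $m\in\mathbb{N}$, let $\Delta_u^m f(x)=\sum_{k=0}^m(-1)^{m-k}\binom mk f(x+(k-\frac m2)u)$, set to $0$ if $x+\frac m2u$ or $x-\frac m2u$ is not in $[0,1]$; $\omega^m(f,t)_p=\sup_{0<u\le t}\|\Delta_u^mf\|_p$; $\|f\|_{\mathcal{B}^s_{p,\infty}}=\|f\|_p+\sup_{t>0}t^{-s}\omega^m(f,t)_p$ with $m=\lfloor s\rfloor+1$; $\mathcal{B}^s_{p,\infty}(L)=\{f\in L_p[0,1]:\|f\|_{\mathcal{B}^s_{p,\infty}}\le L\}$. *)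

(* Defs.v *)
From HB Require Import structures.
From mathcomp Require Import all_boot all_order all_algebra.
From mathcomp Require Import all_classical all_reals all_analysis.

Set Implicit Arguments.
Unset Strict Implicit.
Unset Printing Implicit Defensive.

Import Order.TTheory GRing.Theory Num.Theory.
Import numFieldNormedType.Exports.

Local Open Scope classical_set_scope.
Local Open Scope ring_scope.

(* Functions on [0, 1] are represented by functions [R -> R] of which only the
   values on [0, 1] are ever used; likewise for processes indexed by [0, 1]. *)

Section function_spaces.
Context {R : realType}.
Implicit Types (f g : R -> R) (p s t u : R) (m : nat).

Definition unit_itv : set R := `[0, 1].

Definition norm01 (p : R) (g : R -> R) : \bar R :=
  ('N[lebesgue_measure]_(p%:E)[EFin \o (g \_ unit_itv)])%E.

Definition L01 (p : R) : set (R -> R) :=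
  [set g | g \_ unit_itv \in Lfun lebesgue_measure p%:E].

Definition sym_diff (m : nat) (u : R) (f : R -> R) (x : R) : R :=
  if (0 <= x + m%:R / 2 * u <= 1) && (0 <= x - m%:R / 2 * u <= 1)
  then \sum_(k < m.+1)
         (-1) ^+ (m - k) * 'C(m, k)%:R * f (x + (k%:R - m%:R / 2) * u)
  else 0.

Definition modulus (m : nat) (p : R) (f : R -> R) (t : R) : \bar R :=
  ereal_sup [set norm01 p (sym_diff m u f) | u in [set u | 0 < u <= t]].

(* [Num.truncn s] is the integer part of [s] for [s >= 0]. *)
Definition besov_norm (s p : R) (f : R -> R) : \bar R :=
  (norm01 p f +
   ereal_sup [set (t `^ (- s))%:E * modulus (Num.truncn s).+1 p f t
             | t in [set t | (0 < t)%R]])%E.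

Definition besov_ball (s p L : R) : set (R -> R) :=
  [set f | L01 p f /\ (besov_norm s p f <= L%:E)%E].

End function_spaces.

Section brownian_motion.
Context {d : measure_display} {Omega : measurableType d} {R : realType}.
Variable P : probability Omega R.

(* The product rule for the full family of increments yields that of every
   subfamily, on taking the remaining [A i] to be [setT]. *)
Definition independent_increments (B : R -> {RV P >-> R}) : Prop :=
  forall (k : nat) (t : nat -> R) (A : nat -> set R),
    0 <= t 0%N -> t k <= 1 -> (forall i, (i < k)%N -> t i <= t i.+1) ->
    (forall i, measurable (A i)) ->
    P (\bigcap_(i < k) ((B (t i.+1) \- B (t i)) @^-1` A i)) =
    (\prod_(i < k) P ((B (t i.+1) \- B (t i))%R @^-1` A i))%E.

Definition gaussian_increments (B : R -> {RV P >-> R}) : Prop :=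
  forall (s t : R) (A : set R), 0 <= s -> s < t -> t <= 1 -> measurable A ->
    P ((B t \- B s) @^-1` A) = normal_prob 0 (Num.sqrt (t - s)) A.

Definition brownian01 (B : R -> {RV P >-> R}) : Prop :=
  [/\ {ae P, forall w, B 0 w = 0},
      independent_increments B,
      gaussian_increments B &
      {ae P, forall w, {within unit_itv, continuous (fun t => B t w)}}].

End brownian_motion.

Section white_noise.
Context {R : realType}.

(* The sigma-algebra on paths generated by the evaluations at the points of
   [0, 1]; a map measurable for it depends only on the path on [0, 1]. *)
Definition cylinders : set (set (R -> R)) :=
  [set (fun y : R -> R => y t) @^-1` U
     | t in unit_itv & U in (measurable : set (set R))].

Definition estimators : set ((R -> R) -> R) :=
  [set T | measurable_fun [set: g_sigma_algebraType cylinders]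
             (T : g_sigma_algebraType cylinders -> R)].

Context {d : measure_display} {Omega : measurableType d}.
Variables (P : probability Omega R) (B : R -> {RV P >-> R}).

Definition observation (sigma : R) (n : nat) (f : R -> R) (w : Omega) : R -> R :=
  fun t => \int[lebesgue_measure]_(x in `[0, t]) f x
           + sigma / Num.sqrt n%:R * B t w.

Definition sq_risk (sigma : R) (n : nat) (r : R) (T : (R -> R) -> R)
    (f : R -> R) : \bar R :=
  ('E_P[(fun w => (T (observation sigma n f w) - fine (norm01 r f)) ^+ 2)%R])%E.

Definition minimax_risk (sigma : R) (n : nat) (r : R) (F : set (R -> R)) :
    \bar R :=
  ereal_inf [set ereal_sup [set sq_risk sigma n r T f | f in F]
            | T in estimators].

End white_noise.

(* Main.v *)
Require Import Defs.
From mathcomp Require Import all_boot all_order all_algebra.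
From mathcomp Require Import all_classical all_reals all_analysis.
From mathcomp Require Import measurable_realfun.
From mathcomp Require Import ring lra zify.
Import Order.TTheory GRing.Theory Num.Theory.
Import numFieldNormedType.Exports.
Import HBNNSimple.
Local Open Scope classical_set_scope.
Local Open Scope ring_scope.
Set Implicit Arguments.
Unset Strict Implicit.
Unset Printing Implicit Defensive.

(** The estimation of [norm01 r f] is hard for the following reason. Let [f] be
    a sum of [m] bumps on disjoint cells, with independent random amplitudes.
    Its norm is governed by the absolute moment of order [r] of the amplitude
    law, whereas an observation that is noisy enough only gives access to the
    first moments of that law; and [x |-> `|x| `^ r] is far from polynomials,
    because [r] is not an even integer.

    The amplitudes ([moment_matching], [prior_pair]). There are, for each [N],
    two laws on [-N, N] with the same moments of order less than [2 * N], with
    absolute moments of a fixed order bounded independently of [N], and with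
    absolute moments of order [r] that differ by at least a constant. Their
    difference is read off the error of Lagrange extrapolation to zero from
    the nodes [1, 4, ..., N ^ 2] and a few nodes near zero, carried to the line by
    [y = x ^ 2]. The weights at the squares are essentially the coefficients of
    a central difference divided by the largest one, hence bounded, and the nodes
    near zero make them decay as fast as wished. The extrapolation error of
    [y `^ (r / 2)] does not vanish in the limit: this power is an integral of
    functions [y ^ k.+1 / (y + v)], on which the error is explicit, of a sign that
    does not depend on [v], and bounded below because the inverses of the nodes
    have a bounded sum ([extrap_resolvent], [extrap_powR_ge]).

    Indistinguishability ([cylinder_mixture_le], [moment_exp_le],
    [swap_cell_le]). As far as one cell is concerned, the observation is a Brownian
    path shifted by a random multiple [x] of a fixed drift of energy [l]. By the
    Cameron-Martin formula and Cauchy-Schwarz, a signed mixture of such laws with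
    weights [w] gives every event a mass at most the square root of the double
    sum of [w a * w b * expR (l * (x a * x b))]; when the moments of [w]
    of order less than [2 * N] vanish, the Taylor expansion of the exponential
    starts at the order [2 * N] and the sum is of order [expR (- 2 * N)] provided
    that [l * N ^ 2] is at most a small multiple of [N]. The cells are then
    exchanged one at a time ([iid_mean_swap]), for a total error of
    [2 * m * expR (- N)].

    The rate ([scale_lower_bound], [resolution_exists]). With amplitudes scaled by
    [m `^ (- s)] the sum of bumps lies in the Besov ball ([besov_bump_sum]) and the
    energy is of order [n / m `^ (2 * s + 1)]. With [N] of order [ln n] the error is
    negligible, and the condition on the energy reads
    [n * ln n <= m `^ (2 * s + 1)] up to a constant; the two norms differ by a
    multiple of [m `^ (- s)], which is the announced rate. Laws of large numbers
    under the priors ([iid_mean_atypical]) and a two-point argument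
    ([two_prior_risk]) turn this gap into a bound on the risk. *)

(** * Extrapolation to zero *)
Section extrapolation.
Context {F : fieldType} {n : nat}.
Variable y : 'I_n -> F.

(** The value at [0] of the Lagrange basis polynomial of the node [y i]. *)
Definition extrap (i : 'I_n) : F := \prod_(j < n | j != i) (y j / (y j - y i)).

Hypothesis y_inj : injective y.

Lemma extrapE (P : {poly F}) : (size P <= n)%N ->
  P.[0] = \sum_i extrap i * P.[y i].
Proof.
move=> sP.
pose l i := \prod_(j < n | j != i) ((y i - y j)^-1 *: ('X - (y j)%:P)).
have li i k : (l i).[y k] = (i == k)%:R.
  rewrite /l horner_prod; have [<-|ik] := eqVneq i k.
    rewrite big1// => j ji; rewrite !hornerE mulVf// subr_eq0.
    by apply: contraNneq ji => /y_inj ->.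
  by rewrite (bigD1 k) 1?eq_sym//= !hornerE subrr mulr0 mul0r.
have sl i : (size (l i) <= n)%N.
  have -> : l i = (\prod_(j < n | j != i) (y i - y j)^-1) *:
      \prod_(j < n | j != i) ('X - (y j)%:P).
    rewrite /l; elim/big_rec3: _ => [|j a b c _ ->]; first by rewrite scale1r.
    by rewrite -scalerAl -scalerAr scalerA.
  rewrite (leq_trans (size_scale_leq _ _))// -big_filter size_prod_XsubC.
  rewrite size_filter -sum1_count.
  have nE : (\sum_(j < n) 1 = n)%N by rewrite sum_nat_const card_ord muln1.
  by rewrite -[X in (_ < X)%N]nE [X in (_ < X)%N](bigD1 i).
have PE : P = \sum_i P.[y i] *: l i.
  apply/eqP; rewrite -subr_eq0; apply/eqP.
  apply: (@roots_geq_poly_eq0 _ _ [seq y i | i <- enum 'I_n]).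
  - apply/allP => _ /mapP[k _ ->]; apply/rootP.
    rewrite !hornerE horner_sum (bigD1 k)//= big1 ?addr0.
      by rewrite !hornerE li eqxx mulr1 subrr.
    by move=> i ik; rewrite !hornerE li (negbTE ik) mulr0.
  - by rewrite map_inj_uniq ?enum_uniq.
  - rewrite size_map size_enum_ord (leq_trans (size_polyD _ _))// geq_max sP/=.
    rewrite size_polyN; apply: (leq_trans (size_sum _ _ _)).
    apply/bigmax_leqP => i _.
    by rewrite (leq_trans (size_scale_leq _ _)).
rewrite [in LHS]PE horner_sum; apply: eq_bigr => i _.
rewrite !hornerE mulrC; congr (_ * _).
rewrite /l horner_prod /extrap; apply: eq_bigr => j ji.
by rewrite !hornerE mulrC -[y i - _]opprB invrN mulrNN.
Qed.

(** The polynomial with the same values as [z ^ k.+1 / (z + v)] at the nodes is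
    [(z ^ k.+1 - c * \prod_i (z - y i)) / (z + v)], with [c] making the
    numerator vanish at [- v]; only the product contributes at [0]. *)
Lemma extrap_resolvent (k : nat) (v : F) : (k < n)%N -> v != 0 ->
  (forall i, y i + v != 0) ->
  \sum_i extrap i * (y i ^+ k.+1 / (y i + v)) =
  (-1) ^+ k * v ^+ k * \prod_i (y i / (y i + v)).
Proof.
move=> kn v0 yv0.
pose D := \prod_(i < n) ('X - (y i)%:P).
pose c := (- v) ^+ k.+1 / D.[- v].
have DvE : D.[- v] = \prod_i (- (y i + v)).
  rewrite horner_prod; apply: eq_bigr => i _.
  by rewrite !hornerE opprD addrC.
have Dv0 : D.[- v] != 0.
  by rewrite DvE; apply/prodf_neq0 => i _; rewrite oppr_eq0.
pose S : {poly F} := 'X^(k.+1) - c *: D.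
have /factor_theorem[Q SQ] : root S (- v).
  by apply/rootP; rewrite !hornerE /c divfK// subrr.
have sD : size D = n.+1.
  by rewrite size_prod_XsubC -[index_enum _]enumT size_enum_ord.
have sQ : (size Q <= n)%N.
  have [->|Q0] := eqVneq Q 0; first by rewrite size_poly0.
  have : (size S <= n.+1)%N.
    rewrite (leq_trans (size_polyD _ _))// geq_max size_polyXn size_polyN.
    by rewrite ltnS kn/= -sD size_scale_leq.
  by rewrite SQ size_mul ?polyXsubC_eq0// size_XsubC addn2.
have Qy i : Q.[y i] = y i ^+ k.+1 / (y i + v).
  apply: (mulIf (yv0 i)); rewrite divfK//.
  have := congr1 (fun p => p.[y i]) SQ; rewrite /= !hornerE opprK => <-.
  have -> : D.[y i] = 0.
    by rewrite horner_prod (bigD1 i)//= !hornerE subrr mul0r.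
  by rewrite mulr0 subr0.
rewrite -(eq_bigr _ (fun i _ => congr1 (fun z => extrap i * z) (Qy i))).
rewrite -extrapE//.
apply: (mulIf v0).
have := congr1 (fun p => p.[0]) SQ; rewrite /= !hornerE opprK ?add0r => <-.
have -> : D.[0] = \prod_i (- y i).
  by rewrite horner_prod; apply: eq_bigr => i _; rewrite !hornerE.
have -> : \prod_i (y i / (y i + v)) = (\prod_i (- y i)) / D.[- v].
  rewrite DvE -prodf_div; apply: eq_bigr => i _.
  by rewrite invrN mulrNN.
rewrite /c !exprS mul0r sub0r (exprNn v).
by ring.
Qed.

End extrapolation.

(** * Nodes whose extrapolation weights stay bounded *)
Section nodes.
Context {R : realType}.
Implicit Types (N q j : nat).

(** The factors that the [q] nodes close to zero contribute to the weights of
    the perfect squares make these weights decay, and with them the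
    contribution of the squares to the moments. *)
Definition node (q N : nat) (i : 'I_(q + N)) : R :=
  match fintype.split i with
  | inl a => (2 * a.+1%:R)^-1
  | inr b => b.+1%:R ^+ 2
  end.

Lemma node_lshift q N (a : 'I_q) : node (lshift N a) = (2 * a.+1%:R)^-1.
Proof. by rewrite /node (unsplitK (inl a)). Qed.

Lemma node_rshift q N (b : 'I_N) : node (rshift q b) = b.+1%:R ^+ 2.
Proof. by rewrite /node (unsplitK (inr b)). Qed.

Lemma node_gt0 q N (i : 'I_(q + N)) : 0 < node i.
Proof.
rewrite -(splitK i); case: (fintype.split i) => k /=.
  by rewrite node_lshift invr_gt0 mulr_gt0.
by rewrite node_rshift exprn_gt0.
Qed.

Lemma node_lshift_le q N (a : 'I_q) : node (lshift N a) <= 2^-1.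
Proof.
by rewrite node_lshift lef_pV2 ?posrE ?mulr_gt0// ler_peMr// ler1n.
Qed.

Lemma node_rshift_ge q N (b : 'I_N) : 1 <= node (rshift q b).
Proof. by rewrite node_rshift expr_ge1// ler1n. Qed.

Lemma node_le q N (i : 'I_(q + N)) : (0 < N)%N -> node i <= N%:R ^+ 2.
Proof.
move=> N0; rewrite -(splitK i); case: (fintype.split i) => k /=.
  rewrite (le_trans (node_lshift_le N k))// (@le_trans _ _ 1)//; first lra.
  by rewrite expr_ge1// ler1n.
by rewrite node_rshift ler_pXn2r ?nnegrE// ler_nat.
Qed.

Lemma node_inj q N : injective (@node q N).
Proof.
move=> i i'; rewrite -(splitK i) -(splitK i').
case: (fintype.split i) => k; case: (fintype.split i') => k' /=.
- rewrite !node_lshift => /invr_inj/(mulfI _) h.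
  have /eqP : (k.+1%:R : R) = k'.+1%:R by apply: h.
  by rewrite eqr_nat eqSS => /eqP/val_inj ->.
- move=> e; have h1 := node_lshift_le N k; have h2 := node_rshift_ge q k'.
  by exfalso; rewrite -e in h2; lra.
- move=> e; have h1 := node_lshift_le N k'; have h2 := node_rshift_ge q k.
  by exfalso; rewrite e in h2; lra.
- rewrite !node_rshift => /eqP; rewrite eqrXn2// eqr_nat eqSS.
  by move=> /eqP/val_inj ->.
Qed.

Lemma sum_inv_sqr N : \sum_(b < N) (b.+1%:R ^+ 2)^-1 <= 2 :> R.
Proof.
suff h : \sum_(b < N.+1) (b.+1%:R ^+ 2)^-1 <= 2 - (N.+1%:R)^-1 :> R.
  case: N h => [|N] h; first by rewrite big_ord0.
  apply: (le_trans _ (le_trans h _)); first by rewrite [leRHS]big_ord_recr/= lerDl invr_ge0 exprn_ge0.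
  by rewrite gerBl invr_ge0.
elim: N => [|N IH]; first by rewrite big_ord_recr big_ord0/= expr1n add0r invr1; lra.
rewrite big_ord_recr/=.
apply: (le_trans (lerD IH (lexx _))).
have h1 : (0 : R) < N.+1%:R by [].
rewrite -[N.+2%:R]natr1; set x : R := N.+1%:R in h1 *.
rewrite -subr_ge0.
have -> : 2 - (x + 1)^-1 - (2 - x^-1 + ((x + 1) ^+ 2)^-1) =
   (x * (x + 1) ^+ 2)^-1 by field; apply/andP; split; lra.
by rewrite invr_ge0 mulr_ge0// ?exprn_ge0//; lra.
Qed.

Lemma prod_addn_fact a k : (\prod_(b < k) (a + b.+1) * a`! = (a + k)`!)%N.
Proof.
elim: k => [|k IH]; first by rewrite big_ord0 mul1n addn0.
by rewrite big_ord_recr/= -mulnA [((a + _) * _)%N]mulnC mulnA IH addnS factS mulnC.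
Qed.

Lemma central_le N d : ((N + d)`! ^ 2 <= N`! * (N + d + d)`!)%N.
Proof.
elim: d N => [|d IH] N; first by rewrite !addn0 mulnn.
rewrite !addnS !addSn -addnS.
have := IH N.+1; rewrite !addSn => h.
rewrite addnS (leq_trans h)// !factS; lia.
Qed.

(** The right-hand side over the second factor of the left-hand side is twice a
    coefficient of the central finite difference of order [2 * (j.+1 + d)],
    divided by the largest one: the weights at the perfect squares stay
    bounded, although the range of the nodes grows. *)
Lemma square_weightE j d :
  \prod_(b < j.+1 + d | b != j :> nat)
    (b.+1%:R ^+ 2 / `|b.+1%:R ^+ 2 - j.+1%:R ^+ 2|)
  * (d`! * (j.+1 + d + j.+1)`!)%:R = 2 * ((j.+1 + d)`! ^ 2)%:R :> R.
Proof.
elim: d => [|d IH].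
  rewrite addn0 big_mkcond big_ord_recr/= eqxx mulr1 fact0 mul1n.
  have -> : \prod_(i < j) (if i != j :> nat then
      i.+1%:R ^+ 2 / `|i.+1%:R ^+ 2 - j.+1%:R ^+ 2| else 1) =
     (\prod_(i < j) i.+1%:R) ^+ 2 / (\prod_(i < j) (j - i)%:R *
       \prod_(i < j) (j.+1 + i.+1)%:R) :> R.
    rewrite -prodrXl -big_split/= -prodf_div; apply: eq_bigr => i _.
    rewrite ltn_eqF//=; congr (_ / _).
    rewrite distrC subr_sqr normrM natrB 1?ltnW// natrD -!natr1.
    have : (i%:R : R) < j%:R by rewrite ltr_nat.
    by move=> ij; rewrite !gtr0_norm//; lra.
  rewrite -!natr_prod.
  have -> : (\prod_(i < j) i.+1 = j`!)%N.
    by have := prod_addn_fact 0 j; rewrite fact0 muln1 add0n => <-.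
  have -> : (\prod_(i < j) (j - i) = j`!)%N by rewrite -ffact_prod ffactnn.
  have := prod_addn_fact j.+1 j; set pp := (\prod_(i < j) _)%N => ppE.
  have -> : (j.+1 + j.+1)`! = ((j.+1 + j).+1 * (pp * j.+1`!))%N.
    by rewrite ppE addnS factS.
  have pp0 : (pp%:R : R) != 0.
    rewrite pnatr_eq0; apply/eqP => p0; move: ppE; rewrite p0 mul0n => /esym/eqP.
    by rewrite -leqn0 leqNgt fact_gt0.
  have j0 : (j`!%:R : R) != 0 by rewrite pnatr_eq0 -lt0n fact_gt0.
  rewrite factS !natrM.
by field; rewrite pp0 j0.
rewrite addnS [((_ + _).+1 + _)%N]addSn big_mkcond big_ord_recr/= -big_mkcond/=.
have -> : (j.+1 + d == j) = false by lia.
rewrite /= (factS d) (factS (j.+1 + d)) (factS (j.+1 + d + j.+1)).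
rewrite ger0_norm; last first.
  by rewrite subr_ge0 ler_pXn2r ?nnegrE// ler_nat; lia.
have nz : ((j.+1 + d).+1%:R ^+ 2 - j.+1%:R ^+ 2 : R) != 0.
  by rewrite gt_eqF// subr_gt0 ltr_pXn2r ?nnegrE// ltr_nat; lia.
have -> : ((d.+1 * d`! * ((j.+1 + d + j.+1).+1 * (j.+1 + d + j.+1)`!))%:R =
   ((j.+1 + d).+1%:R ^+ 2 - j.+1%:R ^+ 2) * (d`! * (j.+1 + d + j.+1)`!)%:R :> R).
  by rewrite !natrM -!natr1 !natrD -!natr1; ring.
have -> : (((j.+1 + d).+1 * (j.+1 + d)`!) ^ 2)%:R =
  (j.+1 + d).+1%:R ^+ 2 * ((j.+1 + d)`! ^ 2)%:R :> R.
  by rewrite expnMn natrM !natrX.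
rewrite [RHS]mulrCA -IH; move: nz.
by set u : R := (_ - j.+1%:R ^+ 2) => nz; field.
Qed.

Lemma square_weight_le N (j : 'I_N) :
  \prod_(b < N | b != j)
    (b.+1%:R ^+ 2 / `|b.+1%:R ^+ 2 - j.+1%:R ^+ 2|) <= 2 :> R.
Proof.
have [d NE] : exists d, N = (j.+1 + d)%N.
  by exists (N - j.+1)%N; rewrite subnKC.
move: (square_weightE j d) (central_le d j.+1).
rewrite ![(d + _)%N]addnC -NE => wE cl.
have f0 : 0 < (d`! * (N + j.+1)`!)%:R :> R by rewrite ltr0n muln_gt0 !fact_gt0.
rewrite -(ler_pM2r f0) wE ler_pM2l// ler_nat.
exact: cl.
Qed.

End nodes.

Section weights.
Context {R : realType}.
Implicit Types (N q : nat).

Lemma normr_extrap n (y : 'I_n -> R) i : (forall j, 0 < y j) ->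
  `|extrap y i| = \prod_(j < n | j != i) (y j / `|y j - y i|).
Proof.
move=> y0; rewrite normr_prod; apply: eq_bigr => j _.
by rewrite normrM normfV (gtr0_norm (y0 j)).
Qed.

Lemma extrap_square_le q N (b : 'I_N) :
  `|extrap (@node R q N) (rshift q b)| <= 2 * ((b.+1%:R ^+ 2) ^+ q)^-1.
Proof.
have B1 : 1 <= b.+1%:R ^+ 2 :> R by rewrite expr_ge1// ler1n.
rewrite normr_extrap; last exact: node_gt0.
rewrite big_split_ord/= mulrC ler_pM//.
- by apply: prodr_ge0 => i _; rewrite divr_ge0// ltW// node_gt0.
- by apply: prodr_ge0 => i _; rewrite divr_ge0// ltW// node_gt0.
- under eq_bigl do rewrite (inj_eq (@rshift_inj _ _)).
  under eq_bigr do rewrite !node_rshift.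
  exact: square_weight_le.
- under eq_bigl do rewrite eq_lrshift/=.
  rewrite -exprVn -[X in _ ^+ X](card_ord q) -prodr_const.
  apply: ler_prod => a _.
  have s0 : (0 : R) < node (lshift N a) by exact: node_gt0.
  have s1 := @node_lshift_le R _ N a.
  rewrite !node_rshift divr_ge0//=; last exact: ltW.
  rewrite distrC gtr0_norm; last lra.
  rewrite ler_pdivrMr; last lra.
  rewrite mulrC ler_pdivlMr; last lra.
  by nra.
Qed.

(** The squares contribute factors [1 + O(b ^- 2)], whose product is bounded. *)
Lemma extrap_extra_le q N (a : 'I_q) :
  `|extrap (@node R q N) (lshift N a)| <=
  expR 2 * \prod_(a' < q | a' != a)
    ((2 * a'.+1%:R)^-1 / `|(2 * a'.+1%:R)^-1 - (2 * a.+1%:R)^-1|).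
Proof.
rewrite normr_extrap; last exact: node_gt0.
rewrite big_split_ord/= mulrC ler_pM//.
- by apply: prodr_ge0 => i _; rewrite divr_ge0// ltW// node_gt0.
- by apply: prodr_ge0 => i _; rewrite divr_ge0// ltW// node_gt0.
- under eq_bigl do rewrite eq_rlshift/=.
  apply: (@le_trans _ _ (\prod_(b < N) expR ((b.+1%:R ^+ 2)^-1))).
    apply: ler_prod => b _.
    have s0 : (0 : R) < node (lshift N a) by exact: node_gt0.
    have s1 := @node_lshift_le R _ N a.
    have B1 : 1 <= b.+1%:R ^+ 2 :> R by rewrite expr_ge1// ler1n.
    rewrite node_rshift divr_ge0//=.
    apply: le_trans (expR_ge1Dx _).
    rewrite gtr0_norm; last lra.
    rewrite ler_pdivrMr; last lra.
    set x := b.+1%:R ^+ 2 in B1 *.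
    have -> : (1 + x^-1) * (x - node (lshift N a)) =
      x + (x - node (lshift N a) - x * node (lshift N a)) / x by field; lra.
    by rewrite lerDl divr_ge0//; [nra|lra].
  rewrite -(big_morph _ (@expRD R) (@expR0 R)) ler_expR.
  exact: sum_inv_sqr.
- under eq_bigl do rewrite (inj_eq (@lshift_inj _ _)).
  under eq_bigr do rewrite !node_lshift.
  by [].
Qed.

Lemma extrap_moment_le q : exists2 C : R, 0 < C & forall N k, (k <= q)%N ->
  \sum_i `|extrap (@node R q.+1 N) i| * node i ^+ k <= C.
Proof.
pose E (a : 'I_q.+1) : R := \prod_(a' < q.+1 | a' != a)
    ((2 * a'.+1%:R)^-1 / `|(2 * a'.+1%:R)^-1 - (2 * a.+1%:R)^-1|).
have E0 a : 0 <= E a.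
  by apply: prodr_ge0 => i _; rewrite divr_ge0// invr_ge0 mulr_ge0.
exists (expR 2 * \sum_a E a + 4).
  by rewrite ltr_wpDl// mulr_ge0 ?expR_ge0// sumr_ge0.
move=> N k kq; rewrite big_split_ord/= lerD//.
  rewrite mulr_sumr ler_sum// => a _.
  rewrite -[leRHS]mulr1 ler_pM ?exprn_ge0//.
  - exact/ltW/node_gt0.
  - exact: extrap_extra_le.
  - rewrite exprn_ile1//; first exact/ltW/node_gt0.
    by have := @node_lshift_le R _ N a; lra.
apply: (@le_trans _ _ (2 * \sum_(b < N) (b.+1%:R ^+ 2)^-1)); last first.
  by have := @sum_inv_sqr R N; lra.
rewrite mulr_sumr ler_sum// => b _; rewrite node_rshift.
have B1 : 1 <= b.+1%:R ^+ 2 :> R by rewrite expr_ge1// ler1n.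
have Bk : (b.+1%:R ^+ 2) ^+ k <= (b.+1%:R ^+ 2) ^+ q :> R by rewrite ler_weXn2l.
apply: (@le_trans _ _ (2 * ((b.+1%:R ^+ 2) ^+ q.+1)^-1 * (b.+1%:R ^+ 2) ^+ q)).
  by rewrite ler_pM// ?extrap_square_le// exprn_ge0//; lra.
rewrite exprS invfM -!mulrA mulVf ?mulr1//.
Qed.

Lemma sum_inv_node_le q : exists2 C : R, 0 < C & forall N,
  \sum_i (@node R q N i)^-1 <= C.
Proof.
exists (\sum_(a < q) (2 * a.+1%:R) + 2).
  by rewrite ltr_wpDl// sumr_ge0// => a _; rewrite mulr_ge0.
move=> N; rewrite big_split_ord/= lerD//.
  by apply: ler_sum => a _; rewrite node_lshift invrK.
under eq_bigr do rewrite node_rshift.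
exact: sum_inv_sqr.
Qed.

End weights.

(** * Powers as superpositions of rational functions *)
Notation image_measure :=
  measure_function_pushforward__canonical__measure_function_Measure.

Section lebesgue_affine.
Context {R : realType}.
Local Notation mu := (@lebesgue_measure R).

Let affine (a b : R) : R -> measurableTypeR R := fun x => a + b * x.

Let measurable_affine a b : measurable_fun [set: R] (affine a b).
Proof. by apply: measurable_funD => //; exact: measurable_funM. Qed.

Lemma lebesgue_measure_affine (a b : R) (A : set R) : 0 < b -> measurable A ->
  (mu ((fun x => a + b * x)%R @^-1` A) = b^-1%:E * mu A)%E.
Proof.
move=> b0 mA; have b0' : 0 <= b by exact: ltW.
pose nu := mscale (NngNum b0') (image_measure mu (measurable_affine a b)).
have : nu A = mu A.
  apply/esym/lebesgue_measure_unique => //= _ [[u v]] _ <-.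
  rewrite /mscale/= /pushforward.
  have -> : affine a b @^-1` `]u, v] = `](u - a) / b, (v - a) / b]%classic.
    apply/seteqP; split=> x/=; rewrite /affine !in_itv/=.
      by rewrite ltr_pdivrMr// ler_pdivlMr// mulrC => /andP[? ?]; apply/andP; split; lra.
    by rewrite ltr_pdivrMr// ler_pdivlMr// mulrC => /andP[? ?]; apply/andP; split; lra.
  rewrite !lebesgue_measure_itv/= !lte_fin ltr_pM2r ?invr_gt0// ltrD2r.
  case: ifPn => _; last by rewrite mule0.
  by rewrite -!EFinB -EFinM; congr EFin; field; lra.
rewrite /nu /mscale/= /pushforward => <-.
by rewrite muleA -EFinM mulVf ?mul1e//; lra.
Qed.

Lemma ge0_integral_affine (a b : R) (f : R -> \bar R) : 0 < b ->
  measurable_fun [set: R] f -> (forall x, 0 <= f x)%E ->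
  (\int[mu]_x f (a + b * x)%R = b^-1%:E * \int[mu]_x f x)%E.
Proof.
move=> b0 mf f0; have b0' : 0 <= b^-1 by rewrite invr_ge0 ltW.
have -> : (\int[mu]_x f (a + b * x)%R =
           \int[image_measure mu (measurable_affine a b)]_x f x)%E.
  by rewrite ge0_integral_pushforward//; exact: measurable_affine.
transitivity (\int[mscale (NngNum b0') mu]_x f x)%E.
  apply: eq_measure_integral => // A mA _.
  by rewrite /mscale/=; exact: lebesgue_measure_affine.
by rewrite ge0_integral_mscale.
Qed.

End lebesgue_affine.

Section power_integral.
Context {R : realType}.
Local Notation mu := (@lebesgue_measure R).

Let is_derive_powR1D (g x : R) : 0 <= x ->
  is_derive x 1 (fun t : R => (1 + t) `^ g) (g * (1 + x) `^ (g - 1)).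
Proof.
move=> x0.
have h : is_derive (1 + x) 1 (@powR R ^~ g) (g * (1 + x) `^ (g - 1)).
  by apply: is_derive1_powR; lra.
have h2 : is_derive x 1 (fun x : R => 1 + x) 1.
  have := is_deriveD (is_derive_cst (1 : R^o) (x : R^o) 1) (is_derive_id (x : R^o) 1).
  by rewrite add0r.
have := @is_derive1_comp R (@powR R ^~ g) (fun x => 1 + x) x _ _ h h2.
by rewrite mulr1.
Qed.

Lemma integral_powR_tail (g : R) : 1 < g ->
  (\int[mu]_(x in `[0%R, +oo[) ((1 + x) `^ (- g))%:E = ((g - 1)^-1)%:E)%E.
Proof.
move=> g1; pose F (x : R) := (1 - g)^-1 * (1 + x) `^ (1 - g).
have dF (x : R) : 0 <= x -> is_derive x 1 F ((1 + x) `^ (- g)).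
  move=> x0; have := is_deriveZ (1 - g)^-1 (is_derive_powR1D (1 - g) x0).
  move=> h; apply: (is_derive_eq h).
  rewrite /GRing.scale/= mulrA mulVf ?mul1r; last lra.
  by congr (_ `^ _); lra.
have -> : ((g - 1)^-1)%:E = (0%:E - (F 0)%:E)%E.
  rewrite /F addr0 powR1 mulr1 -EFinB; congr EFin.
  by rewrite sub0r -invrN opprB.
apply: ge0_continuous_FTC2y.
- by move=> x _; exact: powR_ge0.
- apply: continuous_in_subspaceT => x; rewrite inE/= in_itv/= andbT => x0.
  have h : derivable (fun x : R => (1 + x) `^ (- g)) x 1.
    by apply: ex_derive; exact: is_derive_powR1D.
  by move/derivable1_diffP/differentiable_continuous: h.
- rewrite -[0](mulr0 (1 - g)^-1); apply: cvgMl_tmp.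
  apply/cvgr0Pnorm_le => e e0.
  near=> x.
  have x0 : 0 < x by near: x; exact: nbhs_pinfty_gt.
  rewrite ger0_norm ?powR_ge0//.
  have -> : e = (e `^ (1 - g)^-1) `^ (1 - g).
    by rewrite -powRrM mulVf ?powRr1//; [exact: ltW|lra].
  rewrite -[1 - g]opprB !powRN lef_pV2 ?posrE ?powR_gt0//; last lra.
  rewrite ge0_ler_powR ?nnegrE ?powR_ge0//; [lra|lra|].
  rewrite opprB; have : e `^ (1 - g)^-1 < x by near: x; exact: nbhs_pinfty_gt.
  lra.
- by move=> x x0; apply: ex_derive; apply: dF; exact: ltW.
- apply: cvg_at_right_filter.
  have h : derivable F 0 1 by apply: ex_derive; exact: dF.
  by move/derivable1_diffP/differentiable_continuous: h.
- move=> x; rewrite in_itv/= andbT => x0.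
  by rewrite derive1E; apply: derive_val; apply: dF; exact: ltW.
Unshelve. all: by end_near. Qed.

End power_integral.

Section power_kernel.
Context {R : realType}.
Local Notation mu := (@lebesgue_measure R).
Implicit Types (b y t : R).

Definition pow_kernel b y t : R :=
  if 0 < t then y / (y + t `^ b^-1) else 0.

Lemma pow_kernel_ge0 b y t : 0 <= y -> 0 <= pow_kernel b y t.
Proof.
by move=> y0; rewrite /pow_kernel; case: ifPn => // t0; rewrite divr_ge0// addr_ge0// powR_ge0.
Qed.

Lemma measurable_pow_kernel b y : 0 <= y -> measurable_fun [set: R] (pow_kernel b y).
Proof.
move=> y0.
have -> : pow_kernel b y =
    fun t => if 0 < t then y * (y + t `^ b^-1) `^ (-1) else 0.
  apply/funext => t; rewrite /pow_kernel; case: ifPn => // t0.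
  by rewrite powR_inv1// addr_ge0// powR_ge0.
apply: measurable_fun_ifT => //=.
  by apply: measurable_fun_ltr.
apply: measurable_funM => //.
apply: (measurableT_comp (measurable_powR _)) => //.
by apply: measurable_funD => //; exact: measurable_powR.
Qed.

Lemma integrable_pow_kernel1 b : 0 < b < 1 ->
  mu.-integrable [set: R] (EFin \o pow_kernel b 1).
Proof.
move=> /andP[b0 b1]; apply/integrableP; split.
  by apply/measurable_EFinP; apply: measurable_pow_kernel.
pose h := fun t : R => 2 `^ b^-1 * (1 + t) `^ (- b^-1).
have b1' : 1 < b^-1 by rewrite invf_gt1.
have mh : measurable_fun [set: R] (fun t : R => (1 + t) `^ (- b^-1)).
  apply: (measurableT_comp (measurable_powR _)) => //.
  exact: measurable_funD.
apply: (@le_lt_trans _ _ (\int[mu]_(t in `[0%R, +oo[) (h t)%:E)%E); last first.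
  under eq_integral do rewrite EFinM.
  rewrite ge0_integralZl//; last 2 first.
  - by apply/measurable_EFinP; exact: measurable_funS mh.
  - by move=> x _; rewrite lee_fin powR_ge0.
  by rewrite integral_powR_tail// -EFinM ltry.
rewrite [leRHS]integral_mkcond; apply: ge0_le_integral => //.
- apply/measurable_EFinP/measurableT_comp => //.
  exact: measurable_pow_kernel.
- apply/(measurable_restrict _ _ _) => //; apply: measurable_funTS.
  by apply/measurable_EFinP; exact: measurable_funM.
move=> t _; rewrite /= patchE; case: ifPn => [|tn].
  rewrite inE/= in_itv/= andbT => t0.
  rewrite lee_fin ger0_norm ?pow_kernel_ge0// /pow_kernel.
  case: ifPn => [{}t0|_]; last by rewrite mulr_ge0 ?powR_ge0.
  have p0 := powR_ge0 t b^-1.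
  rewrite /h powRN ler_pdivrMr; last lra.
  rewrite mulrAC ler_pdivlMr; last by rewrite powR_gt0; lra.
  rewrite mul1r.
  have [t1|t1] := leP t 1.
    apply: (@le_trans _ _ (2 `^ b^-1)).
      by rewrite ge0_ler_powR ?nnegrE//; lra.
    by rewrite ler_peMr ?powR_ge0// lerDl powR_ge0.
  apply: (@le_trans _ _ (2 `^ b^-1 * t `^ b^-1)).
    by rewrite -powRM; [|lra|lra]; rewrite ge0_ler_powR ?nnegrE//; lra.
  by rewrite ler_pM2l ?powR_gt0// lerDr.
suff -> : pow_kernel b 1 t = 0 by rewrite normr0.
rewrite /pow_kernel; case: ifPn => // t0.
by move: tn; rewrite notin_setE/= in_itv/= andbT => /negP; rewrite ltW.
Qed.

Lemma pow_kernel_scale b y t : 0 < b -> 0 < y ->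
  pow_kernel b y t = pow_kernel b 1 (0 + y `^ (- b) * t).
Proof.
move=> b0 y0; rewrite /pow_kernel add0r pmulr_rgt0 ?powR_gt0//.
case: ifPn => // t0.
rewrite powRM ?powR_ge0//; last exact: ltW.
rewrite -powRrM mulNr mulfV ?gt_eqF// powRN powRr1; last exact: ltW.
have := powR_ge0 t b^-1 => tb.
field.
by apply/andP; split; lra.
Qed.

(** Scaling turns one integrable kernel into an integral formula for every
    power: this is where [z ^ b] becomes a superposition of the rational
    functions [z / (z + v)]. *)
Lemma integral_pow_kernel b y : 0 < b < 1 -> 0 < y ->
  mu.-integrable [set: R] (EFin \o pow_kernel b y) /\
  \int[mu]_t pow_kernel b y t = y `^ b * \int[mu]_t pow_kernel b 1 t.
Proof.
move=> b01 y0; have /andP[b0 b1] := b01.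
have E : (\int[mu]_t (pow_kernel b y t)%:E =
          (y `^ b)%:E * \int[mu]_t (pow_kernel b 1 t)%:E)%E.
  under eq_integral do rewrite pow_kernel_scale//.
  rewrite (@ge0_integral_affine _ 0 _ (EFin \o pow_kernel b 1)) ?powR_gt0//.
  - by rewrite powRN invrK.
  - by apply/measurable_EFinP; apply: measurable_pow_kernel => //; exact: ltW.
  - by move=> x; rewrite lee_fin pow_kernel_ge0.
have I1 := integrable_pow_kernel1 b01.
split; last first.
  rewrite /Rintegral E fineM//; exact: integrable_fin_num.
apply/integrableP; split; first by apply/measurable_EFinP; apply: measurable_pow_kernel => //; exact: ltW.
under eq_integral.
  by move=> t _; rewrite /= ger0_norm ?pow_kernel_ge0 ?(ltW y0)//; over.
have /fineK := integrable_fin_num measurableT I1; rewrite E => <-.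
by rewrite -EFinM ltry.
Qed.

End power_kernel.

Section extrapolation_of_powers.
Context {R : realType}.
Local Notation mu := (@lebesgue_measure R).

(** The power [y `^ a], with [k] the integer part of [a], is an integral of
    functions [y ^ k.+1 / (y + v)]. By [extrap_resolvent] its extrapolation is the
    integral of a function of constant sign, and the factors [y / (y + v)] are at
    least [expR (- y^-1)] for [v <= 1], so that the bound on the sum of the
    inverses of the nodes keeps that function away from zero. *)
Lemma extrap_powR_ge (a S : R) : 0 < a -> (forall k : nat, a != k%:R) ->
  exists2 c : R, 0 < c & forall n (y : 'I_n -> R), injective y ->
    (forall i, 0 < y i) -> \sum_i (y i)^-1 <= S -> (Num.truncn a < n)%N ->
    c <= `|\sum_i extrap y i * y i `^ a|.
Proof.
move=> a0 ak; pose k := Num.truncn a; pose b := a - k%:R.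
have b01 : 0 < b < 1.
  have /andP[h1 h2] := truncn_itv (ltW a0).
  rewrite /b subr_gt0 lt_neqAle h1 eq_sym ak/=.
  by move: h2; rewrite -natr1 -/k; lra.
have /andP[b0 b1] := b01.
pose J := \int[mu]_t pow_kernel b 1 t.
have J0 : 0 <= J by apply: Rintegral_ge0 => x _; exact: pow_kernel_ge0.
pose h0 := (2^-1 `^ b^-1) ^+ k * expR (- S).
have h00 : 0 < h0 by rewrite mulr_gt0 ?expR_gt0// exprn_gt0// powR_gt0.
(* [h0] is a lower bound of the integrand on an interval of length [1 / 2];
   [J + 1] replaces [J], which is only known to be nonnegative here. *)
exists ((h0 / 2) / (J + 1)); first by rewrite !divr_gt0//; lra.
move=> n y yI y0 yS kn.
pose H t := \sum_i (extrap y i * y i ^+ k) * pow_kernel b (y i) t.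
have iH i : mu.-integrable [set: R]
    (fun t => ((extrap y i * y i ^+ k) * pow_kernel b (y i) t)%:E).
  under eq_fun do rewrite EFinM.
  by apply: integrableZl => //; have [] := integral_pow_kernel b01 (y0 i).
have intH : mu.-integrable [set: R] (EFin \o H).
  have := @integrable_sum _ _ _ mu _ measurableT _ (index_enum 'I_n) xpredT
    (fun i t => ((extrap y i * y i ^+ k) * pow_kernel b (y i) t)%:E)
    (fun i _ => iH i).
  by apply: eq_integrable => // t _; rewrite /= /H -sumEFin.
have HE : \int[mu]_t H t = (\sum_i extrap y i * y i `^ a) * J.
  rewrite /Rintegral.
  under eq_integral do rewrite /H -sumEFin.
  rewrite integral_sum// -sum_fine; last first.
    by move=> i _; exact: integrable_fin_num.
  rewrite mulr_suml; apply: eq_bigr => i _.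
  have [I1 I2] := integral_pow_kernel b01 (y0 i).
  have := RintegralZl (extrap y i * y i ^+ k) measurableT I1.
  rewrite {1}/Rintegral => ->; rewrite I2 -/J !mulrA -[in LHS](mulrA (extrap y i)).
  congr (_ * _ * _).
  rewrite -powR_mulrn ?(ltW (y0 i))// -powRD; last by rewrite (gt_eqF (y0 i)) implybT.
  by congr (_ `^ _); rewrite /b; lra.
have Hpos t : 0 < t ->
    (-1) ^+ k * H t = (t `^ b^-1) ^+ k * \prod_i (y i / (y i + t `^ b^-1)).
  move=> t0; have v0 : 0 < t `^ b^-1 by rewrite powR_gt0.
  have := @extrap_resolvent _ _ _ yI k (t `^ b^-1) kn (lt0r_neq0 v0).
  have yv i : y i + t `^ b^-1 != 0 by rewrite gt_eqF// addr_gt0.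
  move=> /(_ yv) E.
  have -> : H t = (-1) ^+ k * (t `^ b^-1) ^+ k * \prod_i (y i / (y i + t `^ b^-1)).
    rewrite -E /H; apply: eq_bigr => i _.
    by rewrite /pow_kernel t0 exprS; ring.
  by rewrite !mulrA -expr2 sqrr_sign mul1r.
have Hge t : 0 <= (-1) ^+ k * H t.
  have [t0|t0] := ltP 0 t.
    rewrite Hpos// mulr_ge0// ?exprn_ge0 ?powR_ge0// prodr_ge0// => i _.
    by rewrite divr_ge0 ?addr_ge0 ?powR_ge0// ltW.
  rewrite /H big1 ?mulr0// => i _.
  by rewrite /pow_kernel ltNge t0/= mulr0.
have Hlow t : 2^-1 <= t <= 1 -> h0 <= (-1) ^+ k * H t.
  move=> /andP[t2 t1]; have t0 : 0 < t by lra.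
  have bV : 0 <= b^-1 by rewrite invr_ge0 ltW.
  rewrite Hpos// ler_pM ?exprn_ge0 ?powR_ge0 ?expR_ge0//.
    by rewrite lerXn2r ?nnegrE ?powR_ge0// ge0_ler_powR ?nnegrE//; lra.
  apply: (@le_trans _ _ (\prod_i expR (- (y i)^-1))).
    rewrite -(big_morph _ (@expRD R) (@expR0 R)) ler_expR sumrN lerN2//.
  apply: ler_prod => i _; rewrite expR_ge0/= expRN.
  have v1 : t `^ b^-1 <= 1.
    have := @ge0_ler_powR R b^-1 bV t 1; rewrite powR1 !nnegrE.
    by apply => //; lra.
  have v0 := powR_ge0 t b^-1.
  have yi := y0 i.
  have yi' : 0 < (y i)^-1 by rewrite invr_gt0.
  rewrite -[leRHS]invrK lef_pV2 ?posrE ?expR_gt0 ?invr_gt0 ?divr_gt0 ?addr_gt0 ?powR_gt0//.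
  apply: le_trans (expR_ge1Dx _).
  rewrite invf_div mulrDl mulfV ?gt_eqF// lerD2l.
  by rewrite ler_piMl// ltW.
have iHk : mu.-integrable [set: R] (EFin \o (fun t => (-1) ^+ k * H t)).
  have := integrableZl measurableT ((-1) ^+ k) intH.
  by apply: eq_integrable => // t _.
have low : h0 / 2 <= \int[mu]_t ((-1) ^+ k * H t).
  have -> : h0 / 2 = \int[mu]_(t in `[2^-1, 1]) (cst h0) t.
    rewrite Rintegral_cst//= lebesgue_measure_itv/= lte_fin.
    have -> : (2^-1 : R) < 1 by lra.
    by rewrite -EFinB/=; lra.
  rewrite [leLHS]Rintegral_mkcond; apply: le_Rintegral => //.
  - have : mu.-integrable `[2^-1, 1]%classic (EFin \o cst h0).
      apply/integrableP; split; first by apply/measurable_EFinP; exact: measurable_cst.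
      rewrite [X in (X < _)%E](_ : _ =
        (\int[mu]_(x in `[2^-1%R, 1%R]) (cst `|h0|%:E) x)%E)//.
      rewrite integral_cst//= lebesgue_measure_itv/= lte_fin.
      have -> : (2^-1 : R) < 1 by lra.
      by rewrite -EFinB -EFinM ltry.
    by move=> h; rewrite -restrict_EFin -integrable_mkcond.
  - move=> t _; rewrite patchE; case: ifPn => // /set_mem/=.
    by rewrite in_itv/=; exact: Hlow.
rewrite RintegralZl// HE mulrA in low.
rewrite ler_pdivrMr; last lra.
apply: (le_trans low); apply: (le_trans (ler_norm _)).
rewrite !normrM normrX normrN1 expr1n mul1r (ger0_norm J0).
by rewrite ler_wpM2l// lerDl.
Qed.

End extrapolation_of_powers.

(** * Moment matching *)
Section moment_matching.
Context {R : realType}.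

(** Squaring turns the functional [p |-> p.[0] - \sum_i extrap y i * p.[y i]]
    into a symmetric signed measure on the line: the atom at [y i] is shared
    by the two square roots of [y i]. *)
Definition sym_point n (y : 'I_n -> R) (a : 'I_n.+1 * bool) : R :=
  (-1) ^+ a.2 * Num.sqrt (oapp y 0 (unlift ord0 a.1)).

Definition sym_weight n (y : 'I_n -> R) (a : 'I_n.+1 * bool) : R :=
  oapp (fun i => - extrap y i) 1 (unlift ord0 a.1) / 2.

Lemma sum_sym n (F : 'I_n.+1 * bool -> R) :
  \sum_a F a = (F (ord0, true) + F (ord0, false)) +
    \sum_i (F (lift ord0 i, true) + F (lift ord0 i, false)).
Proof.
transitivity (\sum_i \sum_b F (i, b)).
  by rewrite pair_bigA; apply: eq_bigr => -[].
by under eq_bigr do rewrite big_bool; rewrite big_ord_recl.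
Qed.

(** The odd moments of the symmetric measure vanish, those of order [2 * k] are
    the extrapolation errors of [z ^ k], and the absolute moment of order [r] is
    that of [z `^ (r / 2)]. The [q.+1] nodes near zero bound the moments up to the
    order [2 * q]. *)
Lemma moment_matching (r : R) (q : nat) : 0 < r ->
  (forall k : nat, r != 2 * k%:R) -> r <= q.*2%:R ->
  exists2 c : R, 0 < c & exists2 C : R, 0 < C & forall N, (0 < N)%N ->
  exists I : finType, exists pt : I -> R, exists w : I -> R,
  [/\ forall i, `|pt i| <= N%:R,
      forall k, (k < N.*2)%N -> \sum_i w i * pt i ^+ k = 0,
      forall k, (k <= q)%N -> \sum_i `|w i| * `|pt i| ^+ k.*2 <= C,
      1 <= \sum_i `|w i| &
      c <= \sum_i w i * `|pt i| `^ r].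
Proof.
move=> r0 rk rq.
have [S S0 nodeS] := @sum_inv_node_le R q.+1.
have [C C0 nodeC] := @extrap_moment_le R q.
have a0 : 0 < r / 2 by lra.
have ak k : r / 2 != k%:R.
  by apply/eqP => e; move/eqP: (rk k); apply; lra.
have [c c0 powc] := extrap_powR_ge S a0 ak.
exists c => //; exists (1 + C); first lra.
move=> N N0; pose n := (q.+1 + N)%N; pose y := @node R q.+1 N.
have y0 i : 0 < y i by exact: node_gt0.
have yI : injective y by exact: node_inj.
pose D := \sum_i extrap y i * y i `^ (r / 2).
have [e De] : exists e : bool, (-1) ^+ e * - D = `|D|.
  have [D0|D0] := ltP 0 D.
    by exists true; rewrite expr1 mulN1r opprK gtr0_norm.
  by exists false; rewrite expr0 mul1r ler0_norm.
have ptS i b : sym_point y (lift ord0 i, b) = (-1) ^+ b * Num.sqrt (y i).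
  by rewrite /sym_point/= liftK.
have pt0 b : sym_point y (ord0, b) = 0.
  by rewrite /sym_point/= unlift_none/= sqrtr0 mulr0.
have wS i b : sym_weight y (lift ord0 i, b) = - extrap y i / 2.
  by rewrite /sym_weight/= liftK.
have w0 b : sym_weight y (ord0, b) = 1 / 2.
  by rewrite /sym_weight/= unlift_none.
have nptS i b : `|sym_point y (lift ord0 i, b)| = Num.sqrt (y i).
  by rewrite ptS normrM normrX normrN1 expr1n mul1r ger0_norm ?sqrtr_ge0.
exists ('I_n.+1 * bool)%type, (sym_point y),
  (fun a => (-1) ^+ e * sym_weight y a); split.
- move=> [i b]; case: (unliftP ord0 i) => [j ->|->]; last by rewrite pt0 normr0.
  rewrite nptS -[leRHS]ger0_norm// -sqrtr_sqr ler_wsqrtr//.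
  exact: node_le.
- move=> k kN.
  under eq_bigr do rewrite -mulrA.
  rewrite -mulr_sumr sum_sym !pt0 !w0.
  under eq_bigr do rewrite !wS !ptS.
  suff -> : \sum_i (- extrap y i / 2 * ((-1) ^+ true * Num.sqrt (y i)) ^+ k +
      - extrap y i / 2 * ((-1) ^+ false * Num.sqrt (y i)) ^+ k) = - 0 ^+ k.
    have E (z : R) : 1 / 2 * z + 1 / 2 * z + - z = 0 by lra.
    by rewrite E mulr0.
  have [kodd|keven] := boolP (odd k).
    rewrite big1 ?expr0n; first by case: (k) kodd => // k' _; rewrite oppr0.
    move=> i _; rewrite !exprMn -!exprM mul1n mul0n -signr_odd kodd; lra.
  have kE : k = (k./2).*2 by rewrite -[LHS]odd_double_half (negbTE keven).
  have := @extrapE _ _ _ yI ('X^(k./2)).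
  rewrite size_polyXn !hornerE => h.
  rewrite kE -muln2 mulnC exprM expr2 mulr0.
  have -> : (0 : R) ^+ k./2 = \sum_i extrap y i * (y i) ^+ k./2.
    rewrite h; first by apply: eq_bigr => i _; rewrite !hornerE.
    by rewrite /n; lia.
  rewrite -sumrN; apply: eq_bigr => i _.
  rewrite !exprM ![(_ * _) ^+ 2]exprMn !sqr_sqrtr ?(ltW (y0 i))// !sqrr_sign mul1r.
  lra.
- move=> k kq.
  under eq_bigr do rewrite normrM normrX normrN1 expr1n mul1r.
  rewrite sum_sym !pt0 !w0.
  under eq_bigr do rewrite !wS !nptS.
  apply: (@le_trans _ _ (1 + \sum_i `|extrap y i| * y i ^+ k)).
    apply: lerD.
      rewrite normr0 ger0_norm//.
      have : (0 : R) ^+ k.*2 <= 1 by rewrite expr0n; case: eqP.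
      lra.
    apply: ler_sum => i _.
    rewrite -muln2 mulnC exprM sqr_sqrtr; last exact/ltW/y0.
    rewrite normrM normrN (@ger0_norm _ 2^-1)//; lra.
  by rewrite lerD2l nodeC.
- have half b : `|(-1) ^+ e * sym_weight y (ord0, b)| = 1 / 2.
    rewrite w0 normrM normrX normrN1 expr1n mul1r ger0_norm; lra.
  rewrite sum_sym !half -[leLHS]addr0; apply: lerD; first lra.
  by apply: sumr_ge0 => i _; exact: addr_ge0.
- under eq_bigr do rewrite -mulrA.
  rewrite -mulr_sumr sum_sym !pt0 !w0.
  under eq_bigr do rewrite !wS !nptS.
  rewrite normr0 powR0 ?gt_eqF//.
  have -> : \sum_i (- extrap y i / 2 * Num.sqrt (y i) `^ r +
     - extrap y i / 2 * Num.sqrt (y i) `^ r) = - D.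
    rewrite -sumrN; apply: eq_bigr => i _.
    rewrite -powR12_sqrt ?(ltW (y0 i))// -powRrM [2^-1 * r]mulrC; lra.
  rewrite mulr0 !add0r De.
  apply: powc => //.
  rewrite truncn_lt_nat; last exact: ltW.
  have : (q%:R : R) < (q.+1 + N)%:R by rewrite ltr_nat; lia.
  by move: rq; rewrite -muln2 natrM; lra.
Qed.

End moment_matching.

(** * Integrals against a density *)

Section tilting.
Context d d' (T : measurableType d) (U : measurableType d') (R : realType).
Variables (mu : {measure set T -> \bar R}) (gamma : {measure set U -> \bar R}).
Variables (Z : T -> R) (X : T -> U).
Hypotheses (Z0 : forall t, 0 <= Z t) (mZ : measurable_fun [set: T] Z).
Hypothesis mX : measurable_fun [set: T] X.
Hypothesis ZX : forall A, measurable A ->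
  (\int[mu]_t (Z t * \1_A (X t))%:E = gamma A)%E.

(** A measure given by a density is determined by its values on indicator
    functions; the passage to nonnegative functions is monotone convergence. *)
Lemma ge0_integral_tilt (g : U -> R) : measurable_fun [set: U] g ->
  (forall u, 0 <= g u) ->
  (\int[mu]_t (Z t * g (X t))%:E = \int[gamma]_u (g u)%:E)%E.
Proof.
move=> mg g0.
have mgE : measurable_fun [set: U] (EFin \o g) by exact/measurable_EFinP.
pose f_ := nnsfun_approx measurableT mgE.
have f_cvg u : (f_ n u)%:E @[n --> \oo] --> (g u)%:E.
  by apply: (@cvg_nnsfun_approx _ _ _ _ measurableT (EFin \o g)) => // x _; rewrite /= lee_fin.
have f_nd u : {homo (fun n => f_ n u) : m n / (m <= n)%N >-> m <= n}.
  by move=> m n mn; exact/lefP/nd_nnsfun_approx.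
have mfX n : measurable_fun [set: T] (fun t => Z t * f_ n (X t)).
  by apply: measurable_funM => //; exact: measurableT_comp.
transitivity (limn (fun n => \int[mu]_t (Z t * f_ n (X t))%:E)%E).
  rewrite -monotone_convergence//.
  - apply: eq_integral => t _; apply/esym/cvg_lim => //.
    under eq_fun do rewrite EFinM.
    by rewrite EFinM; apply: cvgeZl.
  - by move=> n; exact/measurable_EFinP.
  - by move=> n t _; rewrite lee_fin mulr_ge0.
  - by move=> t _ m n mn; rewrite lee_fin ler_wpM2l// f_nd.
rewrite [X in limn X](_ : _ = (fun n => \int[gamma]_u (f_ n u)%:E)%E).
  rewrite -monotone_convergence//.
  - by apply: eq_integral => u _; apply/cvg_lim.
  - by move=> n; exact/measurable_EFinP.
  - by move=> n u _; rewrite lee_fin.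
  - by move=> u _ m n mn; rewrite lee_fin f_nd.
apply/funext => n.
transitivity (\sum_(k \in range (f_ n))
    \int[mu]_t (Z t * (k * \1_(f_ n @^-1` [set k]) (X t)))%:E)%E.
  rewrite -ge0_integral_fsum//; last 2 first.
  - move=> k; apply/measurable_EFinP/measurable_funM => //.
    apply: measurable_funM => //.
    by apply: (measurableT_comp _ mX); exact: measurable_indic.
  - move=> k t _; rewrite lee_fin mulr_ge0//.
    by have := nnfun_muleindic_ge0 (f_ n) k (X t); rewrite -EFinM lee_fin.
  apply: eq_integral => t _.
  by rewrite [in LHS]fimfunE fsumEFin// mulr_fsumr.
transitivity (\sum_(k \in range (f_ n))
    \int[gamma]_u (k * \1_(f_ n @^-1` [set k]) u)%:E)%E; last first.
  rewrite -ge0_integral_fsum//; last 2 first.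
  - by move=> k; exact/measurable_EFinP/measurable_funM.
  - by move=> k u _; rewrite nnfun_muleindic_ge0.
  by apply: eq_integral => u _; rewrite [in RHS]fimfunE fsumEFin.
apply: eq_fsbigr => k /set_mem[u _ <-].
under eq_integral do rewrite mulrCA EFinM.
rewrite ge0_integralZl//; last 3 first.
- apply/measurable_EFinP/measurable_funM => //.
  by apply: (measurableT_comp _ mX); exact: measurable_indic.
- by move=> t _; rewrite lee_fin mulr_ge0.
- by rewrite lee_fin.
under [RHS]eq_integral do rewrite EFinM.
rewrite ge0_integralZl//; last by rewrite lee_fin.
  by rewrite integral_indic// setIT ZX.
exact/measurable_EFinP/measurable_indic.
Qed.

End tilting.

Lemma integral_indicR (R : realType)
    (mu : {measure set (measurableTypeR R) -> \bar R}) (A : set R) :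
  measurable A -> (\int[mu]_x (\1_A x)%:E = mu A)%E.
Proof. by move=> mA; rewrite integral_indic//; congr (mu _); exact: setIT. Qed.

Section independent_product.
Context d (T : measurableType d) (R : realType).
Variables (P : probability T R) (k : nat) (X : nat -> T -> R).
Variable gamma : nat -> probability (measurableTypeR R) R.
Hypothesis mX : forall i, measurable_fun [set: T] (X i).
Hypothesis XP : forall A : nat -> set R, (forall i, measurable (A i)) ->
  (P (\bigcap_(i < k) (X i @^-1` A i)) = \prod_(i < k) gamma i (A i))%E.

Lemma bigcap_indicE (A : nat -> set R) t :
  \prod_(i < k) (\1_(A i) (X i t) : R) =
  \1_(\bigcap_(i < k) (X i @^-1` A i)) t.
Proof.
rewrite [RHS]indicE; have [/set_mem h|h] := boolP (t \in _).
  by rewrite big1// => i _; rewrite indicE mem_set//; exact: (h i (ltn_ord i)).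
have [i /not_implyP[ik nA]] : exists i, ~ ((i < k)%N -> A i (X i t)).
  by apply/existsNP => h'; move/negP: h; apply; apply/mem_set => i; exact: h'.
rewrite (bigD1 (Ordinal ik))//= indicE memNset ?mul0r//.
Qed.

(** One factor at a time is passed from an indicator function to an arbitrary
    one: with the other factors frozen, both sides are measures in that one. *)
Lemma integral_prod_indep (h : nat -> R -> R) (e : nat -> R) :
  (forall i, measurable_fun [set: R] (h i)) -> (forall i x, 0 <= h i x) ->
  (forall i, (\int[gamma i]_x (h i x)%:E = (e i)%:E)%E) ->
  (\int[P]_t (\prod_(i < k) h i (X i t))%:E = (\prod_(i < k) e i)%:E)%E.
Proof.
move=> mh h0 he.
suff H j : forall (h : nat -> R -> R) (e : nat -> R),
    (forall i, measurable_fun [set: R] (h i)) -> (forall i x, 0 <= h i x) ->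
    (forall i, (\int[gamma i]_x (h i x)%:E = (e i)%:E)%E) ->
    (forall i, (j <= i < k)%N -> exists2 A, measurable A & h i = \1_A) ->
    (\int[P]_t (\prod_(i < k) h i (X i t))%:E = (\prod_(i < k) e i)%:E)%E.
  by apply: (H k) => // i; case: (ltnP i k) => //; lia.
elim: j => [{}h {}e {}mh {}h0 {}he hA|j IH {}h {}e {}mh {}h0 {}he hA].
  have /choice[A AE] : forall i, exists A : set R,
      measurable A /\ ((i < k)%N -> h i = \1_A).
    move=> i; have [ik|ik] := ltnP i k; last by exists set0.
    by have [A mA hiA] := hA i ik; exists A.
  have mA i : measurable (A i) by have [] := AE i.
  have mXA i : measurable (X i @^-1` A i).
    by rewrite -[X in measurable X]setTI; exact: mX.
  transitivity (\int[P]_t (\1_(\bigcap_(i < k) (X i @^-1` A i)) t)%:E)%E.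
    apply: eq_integral => t _; rewrite -bigcap_indicE; congr EFin.
    by apply: eq_bigr => i _; have [_ ->] := AE i.
  rewrite integral_indic//; last by apply: fin_bigcap_measurable => // i _; exact: mXA.
  rewrite setIT; transitivity (\prod_(i < k) gamma i (A i))%E; first exact: XP.
  rewrite -prodEFin; apply: eq_bigr => i _.
  rewrite -he; have [_ ->//] := AE i.
  by rewrite integral_indicR.
have [jk|kj] := ltnP j k; last first.
  by apply: IH => // i ij; apply: hA; lia.
pose jo := Ordinal jk; have joE (i : 'I_k) : (i == j :> nat) = (i == jo) by [].
pose Z t := \prod_(i < k | i != jo) h i (X i t).
pose c := \prod_(i < k | i != jo) e i.
have e0 i : 0 <= e i.
  by rewrite -lee_fin -he; apply: integral_ge0 => x _; rewrite lee_fin.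
have c0 : 0 <= c by apply: prodr_ge0.
have mhX i : measurable_fun [set: T] (fun t => h i (X i t)).
  exact: (measurableT_comp (mh i) (mX i)).
have mZ : measurable_fun [set: T] Z.
  rewrite /Z; under eq_fun do rewrite -big_filter.
  by apply: measurable_prod => i _; exact: mhX.
have ZE (A : set R) : measurable A ->
    (\int[P]_t (Z t * \1_A (X j t))%:E = mscale (NngNum c0) (gamma j) A)%E.
  move=> mA.
  pose h' i := if i == j then \1_A : R -> R else h i.
  pose e' i := if i == j then fine (gamma j A) else e i.
  have := IH h' e'.
  rewrite (bigD1 jo)//= /e' eqxx => IHE.
  rewrite /mscale/= -[gamma j A]fineK ?fin_num_measure// -EFinM mulrC.
  have -> : c = \prod_(i < k | i != jo) (if i == j :> nat then fine (gamma j A) else e i).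
    by apply: eq_bigr => i ij; rewrite joE (negbTE ij).
  rewrite -IHE; first apply: eq_integral => t _.
  - rewrite (bigD1 jo)//= /h' eqxx mulrC; congr (EFin (_ * _)).
    by apply: eq_bigr => i ij; rewrite joE (negbTE ij).
  - by move=> i; rewrite /h'; case: eqP => // _; exact: measurable_indic.
  - by move=> i x; rewrite /h'; case: eqP => // _; rewrite indicE.
  - move=> i; rewrite /h'; case: eqP => // ->.
    by rewrite integral_indicR// fineK// fin_num_measure.
  - move=> i ik; rewrite /h'; case: eqP => [_|ij]; first by exists A.
    by apply: hA; lia.
have Z0 t : 0 <= Z t by apply: prodr_ge0.
have := @ge0_integral_tilt _ _ _ _ _ P (mscale (NngNum c0) (gamma j)) Z (X j)
  Z0 mZ (mX j) ZE (h j) (mh j) (h0 j).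
rewrite ge0_integral_mscale//; last 2 first.
- by apply/measurable_EFinP; exact: mh.
- by move=> x _; rewrite lee_fin.
rewrite he/= -EFinM => E.
rewrite [in RHS](bigD1 jo)//= mulrC -/c -E.
by apply: eq_integral => t _; rewrite (bigD1 jo)//= mulrC.
Qed.

End independent_product.

(** * Gaussian shifts *)
Section gaussian_shift.
Context {R : realType}.
Implicit Types (m s : R).

(** The likelihood ratio of the normal laws of means [m] and [0]. *)
Definition shift_density m s (x : R) : R :=
  expR (m * x / s ^+ 2 - m ^+ 2 / (2 * s ^+ 2)).

Lemma measurable_shift_density m s :
  measurable_fun [set: R] (shift_density m s).
Proof.
apply: measurableT_comp => //; apply: measurable_funB => //.
by apply: measurable_funM => //; exact: measurable_funM.
Qed.

Lemma normal_pdf_shift m s x : s != 0 ->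
  normal_pdf 0 s x * shift_density m s x = normal_pdf m s x.
Proof.
move=> s0; rewrite !normal_pdfE//= /normal_fun /shift_density -[LHS]mulrA -expRD.
by congr (_ * expR _); field.
Qed.

Lemma integral_normal_prob m s (g : R -> R) : measurable_fun [set: R] g ->
  (forall x, 0 <= g x) ->
  (\int[normal_prob m s]_x (g x)%:E =
   \int[lebesgue_measure]_x (normal_pdf m s x * g x)%:E)%E.
Proof.
move=> mg g0; apply/esym.
apply: (@ge0_integral_tilt _ _ _ _ _ lebesgue_measure (normal_prob m s)
  (normal_pdf m s) idfun) => //.
- exact: normal_pdf_ge0.
- exact: measurable_normal_pdf.
- exact: measurable_id.
- move=> A mA; rewrite /normal_prob [RHS]integral_mkcond.
  apply: eq_integral => x _; rewrite patchE indicE.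
  by case: ifPn => _; rewrite ?mulr1 ?mulr0.
Qed.

Lemma integral_shift_density m s (A : set R) : s != 0 -> measurable A ->
  (\int[normal_prob 0 s]_x (shift_density m s x * \1_A x)%:E =
   normal_prob m s A)%E.
Proof.
move=> s0 mA; rewrite integral_normal_prob; last 2 first.
- apply: measurable_funM; first exact: measurable_shift_density.
  exact: measurable_indic.
- by move=> x; rewrite mulr_ge0 ?expR_ge0// indicE.
rewrite /normal_prob [RHS]integral_mkcond.
apply: eq_integral => x _; rewrite patchE indicE mulrA normal_pdf_shift//.
by case: ifPn => _; rewrite ?mulr1 ?mulr0.
Qed.

Lemma normal_prob_shift m s (A : set R) : s != 0 -> measurable A ->
  normal_prob m s A = normal_prob 0 s ((fun x => x + m) @^-1` A).
Proof.
move=> s0 mA.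
have mAm : measurable ((fun x : R => x + m) @^-1` A).
  rewrite -[X in measurable X]setTI.
  have : measurable_fun [set: R] (fun x : R => x + m) by exact: measurable_funD.
  exact.
rewrite /normal_prob [LHS]integral_mkcond [RHS]integral_mkcond.
pose f (x : R) := ((fun x => (normal_pdf m s x)%:E) \_ A) x.
transitivity (((1 : R)^-1)%:E * \int[lebesgue_measure]_x f x)%E.
  by rewrite invr1 mul1e.
rewrite -(@ge0_integral_affine _ m 1 f)//.
- apply: eq_integral => x _; rewrite /f !patchE mul1r /=.
  rewrite [m + x]addrC.
  have -> : (x + m \in A) = (x \in (fun x => x + m) @^-1` A) by [].
  case: ifPn => // _; congr EFin.
  by rewrite !normal_pdfE//= /normal_fun addrK subr0.
- apply/(measurable_restrict _ _ _) => //; apply: measurable_funTS.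
  by apply/measurable_EFinP; exact: measurable_normal_pdf.
- by move=> x; rewrite /f patchE; case: ifPn => // _; rewrite lee_fin normal_pdf_ge0.
Qed.

End gaussian_shift.

Section cameron_martin.
Context d (T : measurableType d) (R : realType).
Variables (P : probability T R) (k : nat) (X : nat -> T -> R) (s : nat -> R).
Hypothesis mX : forall i, measurable_fun [set: T] (X i).
Hypothesis s0 : forall i, s i != 0.
Hypothesis XP : forall A : nat -> set R, (forall i, measurable (A i)) ->
  (P (\bigcap_(i < k) (X i @^-1` A i)) =
   \prod_(i < k) normal_prob 0 (s i) (A i))%E.

Definition joint_density (m : nat -> R) (t : T) : R :=
  \prod_(i < k) shift_density (m i) (s i) (X i t).

Lemma measurable_joint_density m : measurable_fun [set: T] (joint_density m).
Proof.
apply: measurable_prod => i _.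
by apply: (measurableT_comp _ (mX i)); exact: measurable_shift_density.
Qed.

Lemma joint_density_ge0 m t : 0 <= joint_density m t.
Proof. by apply: prodr_ge0 => i _; exact: expR_ge0. Qed.

(** On rectangles the formula factorizes into one-dimensional ones. *)
Lemma cameron_martin_rect (m : nat -> R) (A : nat -> set R) :
  (forall i, measurable (A i)) ->
  (P (\bigcap_(i < k) ((fun t => X i t + m i)%R @^-1` A i)) =
   \int[P]_t (joint_density m t * \1_(\bigcap_(i < k) (X i @^-1` A i)) t)%:E)%E.
Proof.
move=> mA.
have mAm i : measurable ((fun x : R => x + m i) @^-1` A i).
  rewrite -[X in measurable X]setTI.
  have : measurable_fun [set: R] (fun x : R => x + m i) by exact: measurable_funD.
  by move=> h; exact: h.
have -> : \bigcap_(i < k) ((fun t => X i t + m i) @^-1` A i) =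
   \bigcap_(i < k) (X i @^-1` ((fun x => x + m i) @^-1` A i)) by [].
rewrite (XP mAm).
pose h i x := shift_density (m i) (s i) x * \1_(A i) x.
have := @integral_prod_indep _ T R P k X (fun i => normal_prob 0 (s i)) mX XP
  h (fun i => fine (normal_prob (m i) (s i) (A i))).
move=> H.
transitivity (\int[P]_t (\prod_(i < k) h i (X i t))%:E)%E; last first.
  apply: eq_integral => t _; rewrite -bigcap_indicE.
  by rewrite /h big_split.
rewrite H -?prodEFin.
- apply: eq_bigr => i _; rewrite fineK -?normal_prob_shift//.
  by apply: fin_num_measure; exact: mA.
- move=> i; apply: measurable_funM; first exact: measurable_shift_density.
  exact: measurable_indic.
- by move=> i x; rewrite mulr_ge0 ?expR_ge0// indicE.
- move=> i; rewrite integral_shift_density// fineK//.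
  by apply: fin_num_measure; exact: mA.
Qed.

Lemma integral_joint_density m : (\int[P]_t (joint_density m t)%:E = 1)%E.
Proof.
transitivity (P (\bigcap_(i < k) ((fun t => X i t + m i)%R @^-1` setT)))%E.
  rewrite cameron_martin_rect//; apply: eq_integral => t _.
  by rewrite indicE mem_set ?mulr1.
rewrite -[RHS](@probability_setT _ _ _ P); congr (P _).
by apply/seteqP; split.
Qed.

End cameron_martin.

(** * Signed mixtures of shifted laws *)
Section mixture_bound.
Context d (T : measurableType d) (R : realType).
Variables (P : probability T R) (k : nat) (X : nat -> T -> R) (s : nat -> R).
Hypothesis mX : forall i, measurable_fun [set: T] (X i).
Hypothesis s0 : forall i, s i != 0.
Hypothesis XP : forall A : nat -> set R, (forall i, measurable (A i)) ->
  (P (\bigcap_(i < k) (X i @^-1` A i)) =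
   \prod_(i < k) normal_prob 0 (s i) (A i))%E.
Variable m : nat -> R.

Let D (x : R) := joint_density k X s (fun i => x * m i).

(** The product of two densities is a density up to a constant factor; hence the
    second moment of a mixture is an explicit double sum. *)
Lemma joint_densityM (x y : R) t :
  D x t * D y t =
  expR ((\sum_(i < k) m i ^+ 2 / s i ^+ 2) * (x * y)) * D (x + y) t.
Proof.
rewrite /D /joint_density mulr_suml (big_morph _ (@expRD R) (@expR0 R)).
rewrite -!big_split/=; apply: eq_bigr => i _.
rewrite /shift_density -!expRD; congr expR.
by field; exact: s0.
Qed.

Let mD x : measurable_fun [set: T] (D x).
Proof. exact: measurable_joint_density. Qed.

Let D0 x t : 0 <= D x t. Proof. exact: joint_density_ge0. Qed.

Let iD x : P.-integrable [set: T] (EFin \o D x).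
Proof.
apply/integrableP; split; first exact/measurable_EFinP.
under eq_integral do rewrite /= ger0_norm//.
by rewrite integral_joint_density// ltry.
Qed.

Variables (I : finType) (x w : I -> R) (dlt : R).
Hypothesis dlt0 : 0 < dlt.
Hypothesis Vdlt : \sum_a \sum_b w a * w b *
  expR ((\sum_(i < k) m i ^+ 2 / s i ^+ 2) * (x a * x b)) <= dlt ^+ 2.

Let H t := \sum_a w a * D (x a) t.

Let iwD (c : R) y : P.-integrable [set: T] (fun t => (c * D y t)%:E).
Proof. by exact: (integrableZl measurableT c (iD y)). Qed.

Let mH : measurable_fun [set: T] H.
Proof. by apply: measurable_sum => a; exact: measurable_funM. Qed.

Let integral_wD (c : R) y : (\int[P]_t (c * D y t)%:E = c%:E)%E.
Proof.
under eq_integral do rewrite EFinM.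
rewrite (integralZl measurableT (iD y)).
by rewrite /= integral_joint_density// mule1.
Qed.

Let V : R := \sum_a \sum_b w a * w b *
  expR ((\sum_(i < k) m i ^+ 2 / s i ^+ 2) * (x a * x b)).

Let integral_sqr : (\int[P]_t (H t ^+ 2)%:E = V%:E)%E.
Proof.
transitivity (\int[P]_t (\sum_(p : I * I) (w p.1 * w p.2 *
    expR ((\sum_(i < k) m i ^+ 2 / s i ^+ 2) * (x p.1 * x p.2)) *
    D (x p.1 + x p.2) t)%:E))%E.
  apply: eq_integral => t _; rewrite sumEFin; congr EFin.
  rewrite -(pair_bigA _ (fun a b => w a * w b *
    expR ((\sum_(i < k) m i ^+ 2 / s i ^+ 2) * (x a * x b)) *
    D (x a + x b) t))/= /H expr2 mulr_suml.
  apply: eq_bigr => a _; rewrite mulr_sumr; apply: eq_bigr => b _.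
  by rewrite mulrACA joint_densityM; exact: mulrA.
rewrite integral_sum//.
rewrite /V pair_bigA/= -sumEFin; apply: eq_bigr => p _.
exact: integral_wD.
Qed.

Let integral_normH : (\int[P]_t `|H t|%:E <= dlt%:E)%E.
Proof.
have d2 : 0 < (2 * dlt)^-1 by rewrite invr_gt0 mulr_gt0.
(* [2 |H| <= H ^ 2 / dlt + dlt] *)
apply: (@le_trans _ _ (\int[P]_t ((2 * dlt)^-1 * H t ^+ 2 + dlt / 2)%:E)%E).
  apply: ge0_le_integral => //.
  - by apply/measurable_EFinP; exact: measurableT_comp.
  - apply/measurable_EFinP/measurable_funD => //; apply: measurable_funM => //.
    exact: measurable_funX.
  - move=> t _; rewrite lee_fin.
    rewrite -subr_ge0 -(real_normK (num_real (H t))).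
    set h := `|H t|.
    have -> : (2 * dlt)^-1 * h ^+ 2 + dlt / 2 - h = (2 * dlt)^-1 * (h - dlt) ^+ 2.
      by field; rewrite gt_eqF.
    by rewrite mulr_ge0 ?sqr_ge0// ltW.
under eq_integral do rewrite EFinD EFinM.
rewrite ge0_integralD//; last 3 first.
- by move=> t _; rewrite -EFinM lee_fin mulr_ge0 ?sqr_ge0// ltW.
- by under eq_fun do rewrite -EFinM; apply/measurable_EFinP/measurable_funM => //;
    exact: measurable_funX.
- by move=> t _; rewrite lee_fin divr_ge0// ltW.
rewrite ge0_integralZl//; last 3 first.
- by apply/measurable_EFinP; exact: measurable_funX.
- by move=> t _; rewrite lee_fin sqr_ge0.
- by rewrite lee_fin ltW.
rewrite integral_sqr integral_cst//= probability_setT mule1 -EFinM -EFinD lee_fin.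
apply: (@le_trans _ _ ((2 * dlt)^-1 * dlt ^+ 2 + dlt / 2)).
  by rewrite lerD2r ler_wpM2l// ltW.
by rewrite le_eqVlt; apply/orP; left; apply/eqP; field; rewrite gt_eqF.
Qed.

(** The left-hand side is the integral of the signed mixture [H] of the
    densities over [E0], and the second moment of [H] is at most [dlt ^+ 2]. *)
Lemma mixture_prob_le (E : I -> set T) (E0 : set T) :
  measurable E0 -> (forall a, measurable (E a)) ->
  (forall a, (P (E a) = \int[P]_(t in E0) (D (x a) t)%:E)%E) ->
  `|\sum_a w a * fine (P (E a))| <= dlt.
Proof.
move=> mE0 mE PE.
have iDE a : P.-integrable E0 (EFin \o D (x a)) by exact: integrableS (iD (x a)).
have -> : \sum_a w a * fine (P (E a)) = \int[P]_(t in E0) H t.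
  rewrite /Rintegral.
  transitivity (fine (\sum_a (\int[P]_(t in E0) ((w a)%:E * (D (x a) t)%:E))%E)).
    rewrite -sum_fine; last first.
      move=> a _; apply: integrable_fin_num => //.
      exact: (integrableZl mE0 (w a) (iDE a)).
    apply: eq_bigr => a _; rewrite PE.
    rewrite -RintegralZl//.
  rewrite -integral_sum//.
    by congr fine; apply: eq_integral => t _; rewrite -sumEFin.
  by move=> a; exact: (integrableZl mE0 (w a) (iDE a)).
have iH : P.-integrable E0 (EFin \o H).
  apply: (@integrableS _ _ _ _ setT) => //.
  have := @integrable_sum _ _ _ P _ measurableT _ (index_enum I) xpredT
    (fun a t => (w a * D (x a) t)%:E) (fun a _ => iwD (w a) (x a)).
  by apply: eq_integrable => // t _; rewrite /= /H -sumEFin.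
apply: (le_trans (le_normr_Rintegral mE0 iH)).
rewrite /Rintegral -lee_fin fineK; last first.
  by apply: integrable_fin_num => //; exact: integrable_norm iH.
apply: le_trans integral_normH.
apply: ge0_subset_integral => //.
by apply/measurable_EFinP; exact: measurableT_comp.
Qed.

End mixture_bound.

(** * Brownian paths on a grid *)
Section grid_events.
Context {R : realType}.
Implicit Types (t : nat -> R) (y : R -> R).

(** The case [i = 0] is the value at [t 0], so that the increments determine the
    path on the whole grid. *)
Definition increment t (i : nat) y : R :=
  y (t i) - (if i is j.+1 then y (t j) else 0).

Definition rectangles (k : nat) t : set_system (R -> R) :=
  [set S | exists2 A : nat -> set R, (forall i, measurable (A i)) &
     S = \bigcap_(i < k.+1) (increment t i @^-1` A i)].

Lemma rectangles_setI k t : setI_closed (rectangles k t).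
Proof.
move=> _ _ [A mA ->] [A' mA' ->]; exists (fun i => A i `&` A' i).
  by move=> i; exact: measurableI.
by rewrite -bigcapI.
Qed.

Lemma eval_rectangles k t i (U : set R) : (i <= k)%N -> measurable U ->
  <<s rectangles k t >> ((fun y => y (t i)) @^-1` U).
Proof.
move=> ik mU.
pose T := g_sigma_algebraType (rectangles k t).
have minc j : (j <= k)%N -> measurable_fun [set: T] (increment t j : T -> R).
  move=> jk _ B mB; rewrite setTI; apply: sub_gen_smallest.
  exists (fun i => if i == j then B else setT).
    by move=> l; case: eqP.
  apply/seteqP; split => y /=.
    by move=> By l /= lk; case: eqP => // ->.
  by move=> /(_ j); rewrite /= eqxx; apply; rewrite ltnS.
have mev j : (j <= k)%N -> measurable_fun [set: T] ((fun y => y (t j)) : T -> R).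
  elim: j => [|j IH] jk.
    have := minc 0%N jk; congr (measurable_fun _ _).
    by apply/funext => y; rewrite /increment subr0.
  have -> : (fun y : T => y (t j.+1)) = increment t j.+1 \+ (fun y : T => y (t j)).
    by apply/funext => y; rewrite /= /increment subrK.
  apply: measurable_funD; first exact: minc.
  by apply: IH; exact: ltnW.
by have := mev i ik measurableT U mU; rewrite setTI.
Qed.

End grid_events.

Section grid_shift.
Context d (Omega : measurableType d) (R : realType).
Variables (P : probability Omega R) (B : R -> {RV P >-> R}).
Hypothesis BB : brownian01 B.
Variables (c : R) (c0 : 0 < c) (G Phi : R -> R) (Phi0 : Phi 0 = 0).
Variables (k : nat) (t : nat -> R).
Hypotheses (t0 : t 0%N = 0) (tk : t k <= 1)
  (tS : forall i, (i < k)%N -> t i < t i.+1).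

(** The process vanishes at [0] almost surely only; with [B 0] subtracted, the
    path has a deterministic value at [0]. *)
Definition shifted_path (x : R) (w : Omega) : R -> R :=
  fun u => G u + x * Phi u + c * (B u w - B 0 w).

Definition grid_increment (i : nat) (w : Omega) : R := B (t i.+1) w - B (t i) w.

Definition grid_std (i : nat) : R :=
  if (i < k)%N then Num.sqrt (t i.+1 - t i) else 1.

Definition grid_drift (i : nat) : R := (Phi (t i.+1) - Phi (t i)) / c.

Local Notation X := grid_increment.
Local Notation s := grid_std.
Local Notation m := grid_drift.

Lemma grid_std_neq0 i : s i != 0.
Proof.
rewrite /grid_std; case: ifPn => // ik; rewrite gt_eqF// sqrtr_gt0 subr_gt0.
exact: tS.
Qed.

Lemma measurable_grid_increment i : measurable_fun [set: Omega] (X i).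
Proof. exact: measurable_funB. Qed.

Let t_ge0 i : (i <= k)%N -> 0 <= t i.
Proof.
elim: i => [|i IH] ik; first by rewrite t0.
by apply: (le_trans (IH (ltnW ik))); exact/ltW/tS.
Qed.

Let t_le1 i : (i <= k)%N -> t i <= 1.
Proof.
move=> ik; apply: le_trans tk.
have : forall j, (i + j <= k)%N -> t i <= t (i + j)%N.
  elim=> [|j IH] ijk; first by rewrite addn0.
  rewrite addnS in ijk *.
  by apply: (le_trans (IH (ltnW ijk))); exact/ltW/tS.
by move=> /(_ (k - i)%N); rewrite subnKC//; exact.
Qed.

Lemma grid_increment_law (A : nat -> set R) : (forall i, measurable (A i)) ->
  (P (\bigcap_(i < k) (X i @^-1` A i)) =
   \prod_(i < k) normal_prob 0 (s i) (A i))%E.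
Proof.
move=> mA; have [_ indep gauss _] := BB.
have := indep k t A; rewrite t0 => ->//; last by move=> i ik; exact/ltW/tS.
apply: eq_bigr => i _; rewrite /grid_std ltn_ord.
apply: gauss => //.
- exact/t_ge0/ltnW.
- exact: tS.
- exact: t_le1.
Qed.

Lemma measurable_shifted_path x :
  measurable_fun [set: Omega]
    (shifted_path x : Omega -> g_sigma_algebraType (rectangles k t)).
Proof.
apply: measurability => // _ [_ [A mA ->] <-]; rewrite setTI.
rewrite preimage_bigcap; apply: fin_bigcap_measurable => // i _.
rewrite -comp_preimage -[X in measurable X]setTI.
suff : measurable_fun [set: Omega] (increment t i \o shifted_path x) by exact.
have mp u : measurable_fun [set: Omega] (fun w => shifted_path x w u).
  apply: measurable_funD => //; apply: measurable_funM => //.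
  exact: measurable_funB.
by case: i => [|i]; rewrite /increment /comp; exact: measurable_funB.
Qed.

(** Rectangles are stable under intersection, so that the formula extends to the
    sigma-algebra that they generate. *)
Lemma shifted_path_prob x (S : set (R -> R)) : <<s rectangles k t >> S ->
  (P (shifted_path x @^-1` S) =
   \int[P]_(w in shifted_path 0 @^-1` S)
      (joint_density k X s (fun i => x * m i) w)%:E)%E.
Proof.
pose T := g_sigma_algebraType (rectangles k t).
have mS y (F : set T) : measurable F -> measurable (shifted_path y @^-1` F).
  by move=> mF; rewrite -[X in measurable X]setTI; exact: measurable_shifted_path.
pose D := joint_density k X s (fun i => x * m i).
have mD : measurable_fun [set: Omega] D by
    apply: measurable_joint_density; exact: measurable_grid_increment.
have D0 w : 0 <= D w by exact: joint_density_ge0.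
have DT : (\int[P]_w (D w)%:E = 1)%E by
    apply: integral_joint_density;
    [exact: measurable_grid_increment|exact: grid_std_neq0|exact: grid_increment_law].
have mDE (F : set Omega) : measurable F -> measurable_fun F (EFin \o D).
  by move=> mF; apply/measurable_EFinP; exact: measurable_funTS.
apply: (@dynkin_induction _ T (rectangles k t) (fun S =>
  P (shifted_path x @^-1` S) =
  \int[P]_(w in shifted_path 0 @^-1` S) (D w)%:E)%E) => //.
- exact: rectangles_setI.
- by rewrite !preimage_setT probability_setT DT.
- move=> _ [A mA ->].
  have inc y w i : (i < k)%N -> increment t i.+1 (shifted_path y w) =
      (G (t i.+1) - G (t i)) + c * (X i w + y * m i).
    by move=> ik; rewrite /increment /shifted_path /grid_drift /grid_increment; field; rewrite gt_eqF.
  have inc0 y w : increment t 0 (shifted_path y w) = G 0.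
    by rewrite /increment /shifted_path t0 Phi0 subrr !mulr0 !addr0 subr0.
  have [GA|GA] := pselect (A 0%N (G 0)); last first.
    have E0 y : shifted_path y @^-1` (\bigcap_(i < k.+1) increment t i @^-1` A i) = set0.
      apply/seteqP; split => // w /= /(_ 0%N (ltn0Sn _)) /=.
      by rewrite inc0.
    by rewrite !E0 measure0 integral_set0.
  pose A' i : set R := (fun z => G (t i.+1) - G (t i) + c * z) @^-1` A i.+1.
  have mA' i : measurable (A' i).
    rewrite /A' -[X in measurable X]setTI.
    have : measurable_fun [set: R] (fun z : R => G (t i.+1) - G (t i) + c * z).
      by apply: measurable_funD => //; exact: measurable_funM.
    by move=> h; exact: h.
  have E y : shifted_path y @^-1` (\bigcap_(i < k.+1) increment t i @^-1` A i) =
      \bigcap_(i < k) ((fun w => X i w + y * m i) @^-1` A' i).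
    apply/seteqP; split => w /= h.
      by move=> i /= ik; rewrite /A' /= -inc//; exact: (h i.+1).
    move=> [|i] /= ik; first by rewrite inc0.
    by rewrite inc//; exact: (h i).
  rewrite !E (@cameron_martin_rect _ _ _ P k X s measurable_grid_increment
    grid_std_neq0 grid_increment_law (fun i => x * m i) A' mA').
  rewrite [RHS]integral_mkcond; apply: eq_integral => w _.
  rewrite patchE indicE.
  have -> : \bigcap_(i < k) ((fun w => X i w + 0 * m i) @^-1` A' i) =
     \bigcap_(i < k) (X i @^-1` A' i).
    by apply: eq_bigcapr => i _; apply/seteqP; split => z /=; rewrite mul0r addr0.
  by case: ifPn => _; rewrite ?mulr1 ?mulr0.
- move=> F mF PF.
  have mF0 := mS 0 F mF; have mFx := mS x F mF.
  have -> y : shifted_path y @^-1` (~` F) = ~` (shifted_path y @^-1` F) by [].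
  have -> : shifted_path 0 @^-1` (~` F) = ~` (shifted_path 0 @^-1` F) by [].
  rewrite probability_setC//.
  rewrite PF -DT -[in LHS](setUv (shifted_path 0 @^-1` F)).
  rewrite ge0_integral_setU//=; last 4 first.
  - by apply: measurableC.
  - by apply: mDE; rewrite setUv.
  - by move=> w _; rewrite lee_fin.
  - by rewrite disj_set2E setICr.
  rewrite addeAC subee ?add0e//.
  rewrite ge0_fin_numE; last by apply: integral_ge0 => w _; rewrite lee_fin.
  apply: (@le_lt_trans _ _ (\int[P]_w (D w)%:E)%E); last by rewrite DT ltry.
  apply: ge0_subset_integral => //; first exact: (mDE _ measurableT).
  by move=> w _; rewrite lee_fin.
- move=> F mF tF PF.
  rewrite !preimage_bigcup.
  rewrite measure_bigcup//=; last 2 first.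
  - by move=> i _; exact: mS.
  - move=> i j _ _ [w [Fi Fj]]; apply: tF => //.
    by exists (shifted_path x w).
  rewrite ge0_integral_bigcup//=.
  - transitivity (\sum_(0 <= i <oo) P (shifted_path x @^-1` F i))%E.
      by apply: eq_eseriesl => i; rewrite in_setT.
    by apply: eq_eseriesr => i _; exact: PF.
  - by move=> i; exact: mS.
  - apply: mDE; apply: bigcup_measurable => i _; exact: mS.
  - by move=> w _; rewrite lee_fin.
  - move=> i j _ _ [w [Fi Fj]]; apply: tF => //.
    by exists (shifted_path 0 w).
Qed.

End grid_shift.

(** * From grids to all cylinder events *)
Section algebra_approximation.
Context d (Omega : measurableType d) (R : realType) (P : probability Omega R).
Context (T : Type) (J : finType) (Psi : J -> Omega -> T).
Variable A : set_system T.
Hypotheses (AT : A setT) (AC : setC_closed A) (AU : setU_closed A).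
Hypothesis mA : forall a S, A S -> measurable (Psi a @^-1` S).

Definition approximable (S : set T) : Prop :=
  (forall a, measurable (Psi a @^-1` S)) /\
  (forall e : R, 0 < e -> exists2 C, A C & forall a,
     (P (Psi a @^-1` (S `\` C)) <= e%:E)%E /\
     (P (Psi a @^-1` (C `\` S)) <= e%:E)%E).

Let psiD a X Y : Psi a @^-1` (X `\` Y) = (Psi a @^-1` X) `\` (Psi a @^-1` Y).
Proof. by []. Qed.

Let Abigcup (F : nat -> set T) n : (forall i, A (F i)) ->
  A (\big[setU/set0]_(i < n) F i).
Proof.
move=> AF; elim: n => [|n IH]; last by rewrite big_ord_recr/=; exact: AU.
by rewrite big_ord0 -setCT; exact: AC.
Qed.

(** Every event of the generated sigma-algebra is, for finitely many laws at
    once, the limit in measure of events of the generating algebra. *)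
Lemma sigma_algebra_approximable S : <<s A >> S -> approximable S.
Proof.
suff h : sigma_algebra setT approximable.
  apply: (smallest_sub h) => {}S AS; split=> [a|e e0]; first exact: mA.
  exists S => // a; rewrite setDv preimage_set0 measure0.
  by split; rewrite lee_fin ltW.
split.
- split=> [a|e e0]; first by rewrite preimage_set0.
  exists set0; first by rewrite -setCT; exact: AC.
  move=> a; rewrite setDv preimage_set0 measure0.
  by split; rewrite lee_fin ltW.
- move=> S0 [mS S0e]; rewrite setTD; split=> [a|e e0].
    by rewrite preimage_setC; apply: measurableC; exact: mS.
  have [C AC' Ce] := S0e e e0; exists (~` C); first exact: AC.
  by move=> a; have [? ?] := Ce a; rewrite !setDE !setCK !(setIC (~` _)) -!setDE.
- move=> F aF.
  have mF a n : measurable (Psi a @^-1` F n) by have [] := aF n.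
  have mU a : measurable (Psi a @^-1` (\bigcup_n F n)).
    by rewrite preimage_bigcup; exact: bigcupT_measurable.
  split=> // e e0.
  pose U n := \big[setU/set0]_(i < n) F i.
  have UE n a : Psi a @^-1` U n = \big[setU/set0]_(i < n) (Psi a @^-1` F i).
    by rewrite /U; elim/big_ind2: _ => // ? ? ? ? <- <-.
  have mUn n a : measurable (Psi a @^-1` U n).
    by rewrite UE; apply: bigsetU_measurable.
  have e20 : 0 < e / 2 by rewrite divr_gt0.
  have [n Hn] : exists n, forall a,
      (P (Psi a @^-1` ((\bigcup_n F n) `\` U n)) <= (e / 2)%:E)%E.
    have cv a : P (Psi a @^-1` ((\bigcup_n F n) `\` U n)) @[n --> \oo] --> 0%E.
      have -> : 0%E = P (\bigcap_n (Psi a @^-1` ((\bigcup_n F n) `\` U n))) :> \bar R.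
        rewrite -(measure0 P); congr (P _); apply/esym/seteqP; split => // w h.
        have [[i _ Fi] _] := h 0%N Logic.I.
        have [_] := h i.+1 Logic.I; apply.
        by rewrite /U big_ord_recr/=; right.
      apply: nonincreasing_cvg_mu => //.
      + by rewrite (le_lt_trans (probability_le1 _ _)) ?ltry// /= psiD; exact: measurableD.
      + by move=> i; rewrite psiD; exact: measurableD.
      + by apply: bigcapT_measurable => i; rewrite psiD; exact: measurableD.
      + move=> i j ij; apply/subsetPset; apply: preimage_subset.
        apply: setDS; rewrite /U.
        by apply: subset_bigsetU.
    have : \forall n \near \oo, forall a,
        (P (Psi a @^-1` ((\bigcup_n F n) `\` U n)) <= (e / 2)%:E)%E.
      apply: filter_forall => a; near=> n; rewrite -[leLHS]fineK ?lee_fin.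
        near: n; exact: (cvgr_le _ (fine_cvg (cv a))).
      by rewrite fin_num_measure// psiD; exact: measurableD.
    by case=> N _ HN; exists N; apply: HN => /=.
  have e30 : 0 < e / 2 / n.+1%:R by rewrite divr_gt0.
  have /choice[C HC] : forall i, exists C, A C /\ forall a,
     (P (Psi a @^-1` (F i `\` C)) <= (e / 2 / n.+1%:R)%:E)%E /\
     (P (Psi a @^-1` (C `\` F i)) <= (e / 2 / n.+1%:R)%:E)%E.
    by move=> i; have [_ /(_ _ e30)[C AC' H]] := aF i; exists C.
  have AFC i : A (C i) by have [] := HC i.
  have mC i a : measurable (Psi a @^-1` C i) by exact/mA.
  exists (\big[setU/set0]_(i < n) C i); first exact: Abigcup.
  have sumle (f : nat -> \bar R) : (forall i, f i <= (e / 2 / n.+1%:R)%:E)%E ->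
      (\sum_(i < n) f i <= (e / 2)%:E)%E.
    move=> fe; apply: (@le_trans _ _ (\sum_(i < n) (e / 2 / n.+1%:R)%:E)%E).
      by apply: lee_sum.
    rewrite sumEFin lee_fin sumr_const card_ord -[leLHS]mulr_natr mulrAC ler_pdivrMr//.
    by rewrite ler_wpM2l ?(ltW e20)// ler_nat.
  have mDF a i : measurable (Psi a @^-1` (F i `\` C i)).
    by rewrite psiD; exact: measurableD.
  have mDC a i : measurable (Psi a @^-1` (C i `\` F i)).
    by rewrite psiD; exact: measurableD.
  have mCn a : measurable (Psi a @^-1` (\big[setU/set0]_(i < n) C i)).
    by apply/mA/Abigcup.
  move=> a; split.
  + apply: (@le_trans _ _ (P (Psi a @^-1` ((\bigcup_n F n) `\` U n)) +
        P (\big[setU/set0]_(i < n) (Psi a @^-1` (F i `\` C i))))%E).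
      apply: le_trans (measureU2 _ _ _); last 2 first.
      * by rewrite psiD; exact: measurableD.
      * exact: bigsetU_measurable.
      apply: le_measure; rewrite ?inE.
      * by rewrite psiD; exact: measurableD.
      * apply: measurableU; last exact: bigsetU_measurable.
        by rewrite psiD; exact: measurableD.
      * move=> w [Fw nC]; have [Uw|nUw] := pselect (U n (Psi a w)); last by left.
        right; rewrite -(bigcup_mkord _ (fun i => Psi a @^-1` (F i `\` C i))); move: Uw; rewrite /U -bigcup_mkord => -[i ni Fi].
        exists i => //; split => // Ci; apply: nC.
        by rewrite -bigcup_mkord; exists i.
    rewrite [e in leRHS](splitr e) EFinD; apply: leeD; first exact: Hn.
    apply: le_trans (sumle _ (fun i => ((HC i).2 a).1)).
    by apply: (@Boole_inequality _ _ _ P (fun i => Psi a @^-1` (F i `\` C i))) => i _.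
  + apply: (@le_trans _ _
        (P (\big[setU/set0]_(i < n) (Psi a @^-1` (C i `\` F i))))%E).
      apply: le_measure; rewrite ?inE.
      * by rewrite psiD; exact: measurableD.
      * exact: bigsetU_measurable.
      * move=> w [/=]; rewrite -bigcup_mkord => -[i ni Ci] nF.
        rewrite -(bigcup_mkord _ (fun i => Psi a @^-1` (C i `\` F i))).
        exists i => //; split => // Fi; apply: nF.
        by exists i.
    apply: (@le_trans _ _ (e / 2)%:E); last by rewrite lee_fin; lra.
    apply: le_trans (sumle _ (fun i => ((HC i).2 a).2)).
    by apply: (@Boole_inequality _ _ _ P (fun i => Psi a @^-1` (C i `\` F i))) => i _.
Unshelve. all: by end_near. Qed.

End algebra_approximation.

Section finite_time_events.
Context {R : realType}.

Definition timed_events (l : seq R) : set_system (R -> R) :=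
  [set S | exists u, exists2 U, measurable U &
     u \in l /\ S = (fun y => y u) @^-1` U].

Definition finite_time_events : set_system (R -> R) :=
  [set S | exists2 l : seq R, {in l, forall u, 0 <= u <= 1} &
     <<s timed_events l >> S].

Lemma finite_time_eventsT : finite_time_events setT.
Proof.
exists [::] => //.
exact: (@measurableT _ (g_sigma_algebraType (timed_events [::]))).
Qed.

Lemma finite_time_eventsC : setC_closed finite_time_events.
Proof.
move=> S [l l01 lS]; exists l => //.
exact: (@measurableC _ (g_sigma_algebraType (timed_events l))).
Qed.

Lemma finite_time_eventsU : setU_closed finite_time_events.
Proof.
move=> S S' [l l01 lS] [l' l01' lS']; exists (l ++ l').
  by move=> u; rewrite mem_cat => /orP[/l01|/l01'].
have sub (l1 : seq R) : {subset l1 <= l ++ l'} ->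
    <<s timed_events l1 >> `<=` <<s timed_events (l ++ l') >>.
  move=> l1l; apply: smallest_sub; first exact: smallest_sigma_algebra.
  move=> _ [u [U mU [ul ->]]]; apply: sub_gen_smallest.
  by exists u, U => //; split => //; exact: l1l.
pose T := g_sigma_algebraType (timed_events (l ++ l')).
have mS : measurable (S : set T).
  by apply: sub lS => u ul; rewrite mem_cat ul.
have mS' : measurable (S' : set T).
  by apply: sub lS' => u ul; rewrite mem_cat ul orbT.
exact: (measurableU _ _ mS mS').
Qed.

Lemma finite_time_event_grid S : finite_time_events S ->
  exists k t, [/\ t 0%N = 0 :> R, t k <= 1,
    forall i, (i < k)%N -> t i < t i.+1 & <<s rectangles k t >> S].
Proof.
move=> [l l01 lS].
pose L : seq R := sort <=%O (undup (0 :: l)).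
have LE (u : R) : (u \in L) = (u \in 0 :: l) by rewrite mem_sort mem_undup.
have L01 (u : R) : u \in L -> 0 <= u <= 1.
  by rewrite LE inE => /orP[/eqP->|/l01//]; rewrite lexx ler01.
have Lsort : sorted <%O L by rewrite sort_lt_sorted undup_uniq.
have L0 : (0 < size L)%N.
  by have : 0 \in L by [rewrite LE inE eqxx]; case: (L).
exists (size L).-1, (nth 0 L).
have Llt i j : (i < j)%N -> (j < size L)%N -> nth 0 L i < nth 0 L j.
  move=> ij jL; rewrite (sorted_ltn_nth lt_trans)// ?inE//.
  exact: ltn_trans jL.
split.
- have : index (0%R : R) L = 0%N.
    case E : (index (0%R : R) L) => [//|j].
    have i0 : (index (0%R : R) L < size L)%N by rewrite index_mem LE inE eqxx.
    have := Llt 0%N j.+1 isT; rewrite -E => /(_ i0).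
    rewrite nth_index ?LE ?inE ?eqxx// => h.
    have /L01 : nth 0 L 0 \in L by rewrite mem_nth.
    by rewrite leNgt h.
  by move=> h; rewrite -[X in nth 0 L X]h nth_index// LE inE eqxx.
- have /L01/andP[//] : nth 0 L (size L).-1 \in L by rewrite mem_nth// prednK.
- by move=> i iL; apply: Llt => //; rewrite -ltn_predRL.
- move: lS; apply: smallest_sub.
    exact: smallest_sigma_algebra.
  move=> _ [u [U mU [ul ->]]].
  have uL : u \in L by rewrite LE inE ul orbT.
  rewrite -(nth_index 0 uL); apply: eval_rectangles => //.
  by rewrite -ltnS prednK// index_mem.
Qed.

Lemma cylinders_finite_time : @cylinders R `<=` finite_time_events.
Proof.
move=> _ [u u01 [U mU <-]]; exists [:: u].
  by move=> v; rewrite inE => /eqP ->; move: u01; rewrite /unit_itv/= in_itv.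
apply: sub_gen_smallest; exists u, U => //.
by rewrite inE eqxx.
Qed.

End finite_time_events.

Section cylinder_mixture.
Context d (Omega : measurableType d) (R : realType).
Variables (P : probability Omega R) (B : R -> {RV P >-> R}).
Hypothesis BB : brownian01 B.
Variables (c : R) (c0 : 0 < c) (Phi : R -> R) (Phi0 : Phi 0 = 0).
Variable lam : R.
Hypothesis Philam : forall k (t : nat -> R), t 0%N = 0 -> t k <= 1 ->
  (forall i, (i < k)%N -> t i < t i.+1) ->
  \sum_(i < k) ((Phi (t i.+1) - Phi (t i)) / c) ^+ 2 / (t i.+1 - t i) <= lam.
Variables (I : finType) (x w : I -> R) (dlt : R).
Hypothesis dlt0 : 0 < dlt.
Hypothesis Vdlt : forall l, 0 <= l <= lam ->
  \sum_a \sum_b w a * w b * expR (l * (x a * x b)) <= dlt ^+ 2.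

Definition drifted_path (G : R -> R) (y : R) (o : Omega) : R -> R :=
  fun u => G u + y * Phi u + c * B u o.

Let path G a := shifted_path B c G Phi (x a).

Let grid_mixture G k t S : t 0%N = 0 -> t k <= 1 ->
  (forall i, (i < k)%N -> t i < t i.+1) -> <<s rectangles k t >> S ->
  `|\sum_a w a * fine (P (path G a @^-1` S))| <= dlt.
Proof.
move=> t0 tk tS rS.
have mS y : measurable (shifted_path B c G Phi y @^-1` S).
  rewrite -[X in measurable X]setTI.
  exact: (measurable_shifted_path B c G Phi y measurableT rS).
apply: (mixture_prob_le (measurable_grid_increment B t) (grid_std_neq0 tS)
  (grid_increment_law BB t0 tk tS) (m := grid_drift c Phi t) dlt0 _ (mS 0)).
- apply: Vdlt; apply/andP; split.
    by apply: sumr_ge0 => i _; rewrite divr_ge0 ?sqr_ge0.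
  apply: le_trans (Philam t0 tk tS); apply: ler_sum => i _.
  rewrite /grid_drift /grid_std ltn_ord sqr_sqrtr//.
  by rewrite subr_ge0; apply/ltW/tS.
- by move=> a; exact: mS.
- by move=> a; exact: shifted_path_prob.
Qed.

Lemma measurable_drifted_path G y :
  measurable_fun [set: Omega]
    (drifted_path G y : Omega -> g_sigma_algebraType (@cylinders R)).
Proof.
apply: measurability => // _ [_ [u _ [U mU <-]] <-]; rewrite setTI.
rewrite -comp_preimage -[X in measurable X]setTI.
suff : measurable_fun [set: Omega] (fun o => drifted_path G y o u) by exact.
by apply: measurable_funD => //; exact: measurable_funM.
Qed.

Let drifted_pathE G y S : <<s @cylinders R >> S ->
  P (drifted_path G y @^-1` S) = P (shifted_path B c G Phi y @^-1` S).
Proof.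
move=> cS; have [[N [mN N0 BN]] _ _ _] := BB.
have mS (Z : R -> Omega -> R) : (forall u, measurable_fun [set: Omega] (Z u)) ->
    measurable ((fun o u => Z u o) @^-1` S).
  move=> mZ; rewrite -[X in measurable X]setTI.
  have : measurable_fun [set: Omega]
      ((fun o u => Z u o) : Omega -> g_sigma_algebraType (@cylinders R)).
    apply: measurability => // _ [_ [u _ [U mU <-]] <-]; rewrite setTI.
    rewrite -comp_preimage -[X in measurable X]setTI.
    by have := mZ u; exact.
  by move=> h; exact: h.
have m1 : measurable (drifted_path G y @^-1` S).
  apply: (mS (fun u o => drifted_path G y o u)) => u.
  by apply: measurable_funD => //; exact: measurable_funM.
have m2 : measurable (shifted_path B c G Phi y @^-1` S).
  apply: (mS (fun u o => shifted_path B c G Phi y o u)) => u.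
  by apply: measurable_funD => //; apply: measurable_funM => //; exact: measurable_funB.
have pathE o : ~ N o -> drifted_path G y o = shifted_path B c G Phi y o.
  move=> No; have B0 : B 0 o = 0 by apply: contrapT => h; apply: No; exact: BN.
  by apply/funext => u; rewrite /drifted_path /shifted_path B0 subr0.
have le_of E F : measurable E -> measurable F ->
    (forall o, ~ N o -> E o -> F o) -> (P E <= P F)%E.
  move=> mE mF EF; rewrite -[leRHS]adde0 -N0.
  apply: le_trans (measureU2 _ mF mN).
  apply: le_measure; rewrite ?inE//; first exact: measurableU.
  move=> o Eo; have [No|No] := pselect (N o); first by right.
  by left; exact: EF.
apply/eqP; rewrite eq_le !le_of// => o No; rewrite /preimage/=.
  by rewrite pathE.
by rewrite pathE.
Qed.

(** Events that depend on finitely many times obey the bound, with a constant that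
    does not depend on the grid, and they approximate all cylinder events. *)
Lemma cylinder_mixture_le G S : <<s @cylinders R >> S ->
  `|\sum_a w a * fine (P (drifted_path G (x a) @^-1` S))| <= dlt.
Proof.
move=> cS; under eq_bigr do rewrite drifted_pathE//.
have fS : <<s finite_time_events >> S.
  move: cS; apply: smallest_sub; first exact: smallest_sigma_algebra.
  move=> Z /cylinders_finite_time fZ; exact: sub_gen_smallest.
have mgrid a Z : finite_time_events Z -> measurable (path G a @^-1` Z).
  move=> /finite_time_event_grid[k [t [t0 tk tS rZ]]].
  rewrite -[X in measurable X]setTI.
  exact: (measurable_shifted_path B c G Phi (x a) measurableT rZ).
have [mS approx] := @sigma_algebra_approximable _ Omega R P _ I (path G)
  finite_time_events finite_time_eventsT finite_time_eventsC
  finite_time_eventsU mgrid S fS.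
apply/ler_addgt0Pr => e e0.
pose W := 1 + \sum_a `|w a|.
have W0 : 0 < W by rewrite ltr_pwDl// sumr_ge0.
have [C fC Ce] := approx (e / W) (divr_gt0 e0 W0).
have mC a := mgrid a C fC.
have close a : `|fine (P (path G a @^-1` S)) - fine (P (path G a @^-1` C))| <= e / W.
  have fin Z : measurable Z -> P Z = (fine (P Z))%:E.
    by move=> mZ; rewrite fineK// fin_num_measure.
  have half E F : measurable E -> measurable F -> (P (E `\` F) <= (e / W)%:E)%E ->
      fine (P E) <= fine (P F) + e / W.
    move=> mE mF EF; rewrite -lee_fin EFinD -!fin//.
    apply: le_trans (leeD2l _ EF).
    apply: le_trans (measureU2 _ mF _); last exact: measurableD.
    apply: le_measure; rewrite ?inE//.
      by apply: measurableU => //; exact: measurableD.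
    by move=> o Eo; have [Fo|nFo] := pselect (F o); [left|right].
  have [C1 C2] := Ce a.
  have h1 := half _ _ (mS a) (mC a) C1.
  have h2 := half _ _ (mC a) (mS a) C2.
  by rewrite ler_norml; apply/andP; split; lra.
have [k [t [t0 tk tS rC]]] := finite_time_event_grid fC.
have bC := grid_mixture G t0 tk tS rC.
have -> : \sum_a w a * fine (P (path G a @^-1` S)) =
    \sum_a w a * fine (P (path G a @^-1` C)) +
    \sum_a w a * (fine (P (path G a @^-1` S)) - fine (P (path G a @^-1` C))).
  by rewrite -big_split/=; apply: eq_bigr => a _; rewrite -mulrDr subrKC.
apply: (le_trans (ler_normD _ _)); apply: lerD => //.
apply: (le_trans (ler_norm_sum _ _ _)).
apply: (@le_trans _ _ (\sum_a `|w a| * (e / W))).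
  by apply: ler_sum => a _; rewrite normrM ler_wpM2l.
rewrite -mulr_suml mulrA ler_pdivrMr// mulrC ler_pM2l// /W.
by rewrite lerDr.
Qed.

End cylinder_mixture.

(** * Exponential sums over measures with vanishing moments *)
Section exp_tail.
Context {R : realType}.

Lemma exp_partial_le (t : R) n : 0 <= t ->
  series (exp_coeff t) n <= expR t.
Proof.
move=> t0; rewrite /expR; apply: nondecreasing_cvgn_le.
  move=> a b ab; rewrite /series/= [leRHS](big_cat_nat (leq0n _) ab)/= lerDl.
  by apply: sumr_ge0 => i _; rewrite /exp_coeff divr_ge0// exprn_ge0.
exact: is_cvg_series_exp_coeff.
Qed.

(** Chernoff-type bound: each term of degree at least [K] is multiplied by
    [(expR 2) ^+ (k - K) >= 1]. *)
Lemma exp_remainder_le (t : R) (K : nat) : expR 2 * `|t| <= K%:R ->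
  `|expR t - series (exp_coeff t) K| <= expR (- K%:R).
Proof.
move=> tK; pose rho : R := expR 2.
have rho0 : 0 < rho by exact: expR_gt0.
have rho1 : 1 <= rho by rewrite /rho; apply: le_trans (expR_ge1Dx _); lra.
have cv : `|series (exp_coeff t) n - series (exp_coeff t) K| @[n --> \oo] -->
    `|expR t - series (exp_coeff t) K|.
  apply: cvg_norm; apply: cvgB; last exact: cvg_cst.
  exact: is_cvg_series_exp_coeff.
apply: (cvgr_to_le cv); near=> n.
have Kn : (K <= n)%N by near: n; exact: nbhs_infty_ge.
rewrite sub_series_geq//; apply: (le_trans (ler_norm_sum _ _ _)).
apply: (@le_trans _ _ (rho ^- K * \sum_(K <= k < n) exp_coeff (rho * `|t|) k)).
  rewrite mulr_sumr; apply: ler_sum_nat => k /andP[Kk _].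
  rewrite /exp_coeff/= normrM normfV normrX (ger0_norm (ler0n _ _)).
  rewrite exprMn !mulrA ler_wpM2r ?invr_ge0// ler_peMl ?exprn_ge0//.
  by rewrite mulrC ler_pdivlMr ?exprn_gt0// mul1r ler_weXn2l.
apply: (@le_trans _ _ (rho ^- K * expR (rho * `|t|))).
  rewrite ler_wpM2l ?invr_ge0 ?exprn_ge0 ?(ltW rho0)//.
  apply: (le_trans _ (exp_partial_le n _)); last by rewrite mulr_ge0// ltW.
  rewrite /series/= [leRHS](big_cat_nat (leq0n _) Kn)/= lerDr sumr_ge0// => i _.
  by rewrite /exp_coeff divr_ge0// exprn_ge0// mulr_ge0// ltW.
rewrite /rho -expRM_natl -expRN -expRD ler_expR.
by rewrite mulr_natr in tK *; lra.
Unshelve. all: by end_near. Qed.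

(** The vanishing moments remove the Taylor polynomial of the exponential, and
    only the remainder of order [K] contributes. *)
Lemma moment_exp_le (I : finType) (x w : I -> R) (K : nat) (M l : R) :
  (forall a, `|x a| <= M) ->
  (forall k, (k < K)%N -> \sum_a w a * x a ^+ k = 0) ->
  0 <= l -> expR 2 * (l * M ^+ 2) <= K%:R ->
  \sum_a \sum_b w a * w b * expR (l * (x a * x b)) <=
  (\sum_a `|w a|) ^+ 2 * expR (- K%:R).
Proof.
move=> xM wK l0 lK.
pose S a b := series (exp_coeff (l * (x a * x b))) K.
have S0 : \sum_a \sum_b w a * w b * S a b = 0.
  transitivity (\sum_(0 <= k < K) l ^+ k / k`!%:R *
      (\sum_a w a * x a ^+ k) * (\sum_b w b * x b ^+ k)).
    rewrite /S /series/=.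
    under eq_bigr do under eq_bigr do rewrite mulr_sumr.
    under eq_bigr do rewrite exchange_big/=.
    rewrite exchange_big/=; apply: eq_bigr => k _.
    rewrite -mulrA big_distrlr/= mulr_sumr; apply: eq_bigr => a _.
    rewrite mulr_sumr; apply: eq_bigr => b _.
    by rewrite /exp_coeff/= !exprMn; ring.
  rewrite big_nat big1// => k /andP[_ kK].
  by rewrite (wK k kK) mulr0.
rewrite -[leLHS]subr0 -[X in _ - X <= _]S0 -sumrB.
under eq_bigr do rewrite -sumrB.
rewrite expr2 mulr_suml mulr_suml; apply: ler_sum => a _.
rewrite -mulrA mulr_suml mulr_sumr; apply: ler_sum => b _.
rewrite -mulrBr; apply: (le_trans (ler_norm _)).
rewrite !normrM [leRHS]mulrA ler_wpM2l ?mulr_ge0//.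
apply: exp_remainder_le; apply: le_trans lK.
rewrite ler_wpM2l ?expR_ge0// normrM (ger0_norm l0) ler_wpM2l// normrM expr2.
exact: ler_pM.
Qed.

End exp_tail.

(** * Independent draws *)
Section product_prior.
Context {R : realType} {I : finType}.
Implicit Types (mu nu : I -> R) (m : nat) (F G : seq I -> R) (g : I -> R).

(** Expectation under the product law, by recursion on the draws so that a single
    draw can be split off. *)
Fixpoint iid_mean mu m F : R :=
  if m is m'.+1 then \sum_a mu a * iid_mean mu m' (fun th => F (a :: th))
  else F [::].

Definition prob_weights mu := (forall a, 0 <= mu a) /\ \sum_a mu a = 1.

Lemma le_iid_mean mu m F G : prob_weights mu ->
  (forall th, size th = m -> F th <= G th) ->
  iid_mean mu m F <= iid_mean mu m G.
Proof.
move=> [mu0 mu1]; elim: m F G => [|m IH] F G FG /=; first exact: FG.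
apply: ler_sum => a _; apply: ler_wpM2l => //; apply: IH => th sth.
by apply: FG; rewrite /= sth.
Qed.

Lemma iid_meanD mu m F G :
  iid_mean mu m (fun th => F th + G th) = iid_mean mu m F + iid_mean mu m G.
Proof.
elim: m F G => [//|m IH] F G /=; rewrite -big_split/=.
by apply: eq_bigr => a _; rewrite IH mulrDr.
Qed.

Lemma iid_meanZ mu m c F :
  iid_mean mu m (fun th => c * F th) = c * iid_mean mu m F.
Proof.
elim: m F => [//|m IH] F /=; rewrite mulr_sumr.
by apply: eq_bigr => a _; rewrite IH mulrCA.
Qed.

Lemma iid_mean_cst mu m c : prob_weights mu -> iid_mean mu m (fun=> c) = c.
Proof.
move=> [_ mu1]; elim: m => [//|m IH] /=.
by under eq_bigr do rewrite IH; rewrite -mulr_suml mu1 mul1r.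
Qed.

Lemma iid_mean_sum mu m (J : finType) (F : J -> seq I -> R) :
  iid_mean mu m (fun th => \sum_j F j th) = \sum_j iid_mean mu m (F j).
Proof.
elim: m F => [//|m IH] F /=.
under eq_bigr do rewrite IH mulr_sumr.
by rewrite exchange_big.
Qed.

Lemma eq_iid_mean mu m F G : F =1 G -> iid_mean mu m F = iid_mean mu m G.
Proof. by move=> /funext ->. Qed.

Lemma normr_iid_mean_le mu m F c : prob_weights mu ->
  (forall th, size th = m -> `|F th| <= c) -> `|iid_mean mu m F| <= c.
Proof.
move=> pmu Fc; rewrite ler_norml; apply/andP; split.
  rewrite -[leLHS](iid_mean_cst m (- c) pmu); apply: le_iid_mean => // th sth.
  by have := Fc th sth; rewrite ler_norml => /andP[].
rewrite -[leRHS](iid_mean_cst m c pmu); apply: le_iid_mean => // th sth.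
by have := Fc th sth; rewrite ler_norml => /andP[].
Qed.

(** Hybrid argument: the draws are exchanged one at a time, and each exchange
    costs at most [dlt] whatever the other draws are. *)
Lemma iid_mean_swap mu nu m F dlt : prob_weights mu -> prob_weights nu ->
  (forall th th', (size th + size th').+1 = m ->
     `|\sum_a (mu a - nu a) * F (th ++ a :: th')| <= dlt) ->
  `|iid_mean mu m F - iid_mean nu m F| <= m%:R * dlt.
Proof.
move=> pmu pnu; elim: m F => [|m IH] F Fd /=.
  by rewrite subrr normr0 mul0r.
have [mu0 mu1] := pmu.
have -> : \sum_a mu a * iid_mean mu m (fun th => F (a :: th)) -
    \sum_a nu a * iid_mean nu m (fun th => F (a :: th)) =
  \sum_a mu a * (iid_mean mu m (fun th => F (a :: th)) -
     iid_mean nu m (fun th => F (a :: th))) +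
  iid_mean nu m (fun th => \sum_a (mu a - nu a) * F (a :: th)).
  rewrite iid_mean_sum -sumrB -big_split/=; apply: eq_bigr => a _.
  by rewrite iid_meanZ; ring.
rewrite -natr1 mulrDl mul1r; apply: (le_trans (ler_normD _ _)); apply: lerD.
  apply: (le_trans (ler_norm_sum _ _ _)).
  rewrite -[leRHS]mul1r -[X in _ <= X * _]mu1 mulr_suml; apply: ler_sum => a _.
  rewrite normrM (ger0_norm (mu0 a)) ler_wpM2l//; apply: IH => th th' sth.
  by apply: (Fd (a :: th) th'); rewrite /= addSn sth.
apply: normr_iid_mean_le => // th sth.
by apply: (Fd [::] th); rewrite sth.
Qed.

Lemma iid_mean_additive mu m g : prob_weights mu ->
  iid_mean mu m (fun th => \sum_(a <- th) g a) = m%:R * \sum_a mu a * g a.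
Proof.
move=> pmu; elim: m => [|m IH] /=; first by rewrite big_nil mul0r.
rewrite -natr1 mulrDl mul1r addrC -IH.
under eq_bigr => a _.
  under eq_iid_mean => th do rewrite big_cons.
  rewrite iid_meanD iid_mean_cst// IH mulrDr; over.
rewrite big_split/= -mulr_suml; have [_ ->] := pmu.
by rewrite mul1r IH.
Qed.

Lemma iid_mean_variance mu m g : prob_weights mu ->
  iid_mean mu m (fun th =>
    (\sum_(a <- th) g a - m%:R * \sum_a mu a * g a) ^+ 2) <=
  m%:R * \sum_a mu a * g a ^+ 2.
Proof.
move=> pmu; set b := \sum_a mu a * g a; set v := \sum_a mu a * g a ^+ 2.
have [mu0 mu1] := pmu.
elim: m => [|m IH] /=; first by rewrite big_nil !mul0r subrr expr0n.
pose Z th := \sum_(a <- th) g a - m%:R * b.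
have Z0 : iid_mean mu m Z = 0.
  by rewrite /Z iid_meanD iid_mean_cst// iid_mean_additive// subrr.
have E a : iid_mean mu m (fun th => (\sum_(c <- a :: th) g c - m.+1%:R * b) ^+ 2) =
    iid_mean mu m (fun th => Z th ^+ 2) + (g a - b) ^+ 2.
  transitivity (iid_mean mu m (fun th =>
      (Z th ^+ 2 + (2 * (g a - b)) * Z th) + (g a - b) ^+ 2)).
    by apply: eq_iid_mean => th; rewrite /Z big_cons -natr1; ring.
  by rewrite !iid_meanD iid_meanZ Z0 mulr0 addr0 iid_mean_cst.
under eq_bigr do rewrite E mulrDr.
rewrite big_split/= -mulr_suml mu1 mul1r -natr1 mulrDl mul1r.
apply: lerD; first exact: IH.
have -> : \sum_a mu a * (g a - b) ^+ 2 = v - b ^+ 2.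
  transitivity (\sum_a (mu a * g a ^+ 2 - 2 * b * (mu a * g a) + b ^+ 2 * mu a)).
    by apply: eq_bigr => a _; ring.
  by rewrite big_split/= sumrB -!mulr_sumr mu1 -/b -/v; ring.
by rewrite gerBl sqr_ge0.
Qed.

End product_prior.

(** * Finite differences *)
Section differences.
Context {R : realType}.
Implicit Types (f g : R -> R) (u x : R) (k n : nat).

Definition fdiff u f x : R := f (x + u) - f x.

Lemma iter_fdiffE n u f x : iter n (fdiff u) f x =
  \sum_(k < n.+1) (-1) ^+ (n - k) * 'C(n, k)%:R * f (x + k%:R * u).
Proof.
elim: n x => [|n IH] x.
  by rewrite big_ord_recl big_ord0 /= bin0 expr0 !mul1r mul0r !addr0.
rewrite iterS {1}/fdiff !IH.
rewrite [RHS]big_ord_recl [in X in X - _]big_ord_recr/= [in X in _ - X]big_ord_recl/=.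
rewrite [in RHS]big_ord_recr/= !subnn !binn !bin0 !expr0 !mul1r !mulr1 !subn0.
rewrite !mul0r !addr0.
have -> : x + u + n%:R * u = x + (bump 0 n)%:R * u.
  by rewrite /bump/= -natr1; ring.
have -> : \sum_(i < n) (-1) ^+ (n.+1 - bump 0 i) * 'C(n.+1, bump 0 i)%:R *
    f (x + (bump 0 i)%:R * u) =
  \sum_(i < n) (-1) ^+ (n - i) * 'C(n, i)%:R * f (x + u + i%:R * u) -
  \sum_(i < n) (-1) ^+ (n - bump 0 i) * 'C(n, bump 0 i)%:R *
    f (x + (bump 0 i)%:R * u).
  rewrite -sumrB; apply: eq_bigr => i _; rewrite /bump/= !add1n subSS binS natrD.
  have -> : x + u + i%:R * u = x + i.+1%:R * u by rewrite -natr1; ring.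
  have -> : (n - i = (n - i.+1).+1)%N by have := ltn_ord i; lia.
  by rewrite exprS; ring.
by rewrite exprS; ring.
Qed.

Lemma sym_diffE n u f x :
  (0 <= x + n%:R / 2 * u <= 1) && (0 <= x - n%:R / 2 * u <= 1) ->
  sym_diff n u f x = iter n (fdiff u) f (x - n%:R / 2 * u).
Proof.
move=> h; rewrite /sym_diff h iter_fdiffE; apply: eq_bigr => i _.
by congr (_ * f _); ring.
Qed.

Lemma iter_fdiffZ n u c f x :
  iter n (fdiff u) (fun y => c * f y) x = c * iter n (fdiff u) f x.
Proof.
elim: n x => [//|n IH] x; rewrite !iterS /fdiff !IH; ring.
Qed.

Lemma iter_fdiffB n u f g x :
  iter n (fdiff u) (fun y => f y - g y) x =
  iter n (fdiff u) f x - iter n (fdiff u) g x.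
Proof.
elim: n x => [//|n IH] x; rewrite !iterS /fdiff !IH; ring.
Qed.

Lemma iter_fdiff_affine n u f a c x :
  iter n (fdiff u) (fun y => f (a * y + c)) x =
  iter n (fdiff (a * u)) f (a * x + c).
Proof.
elim: n x => [//|n IH] x; rewrite !iterS /fdiff !IH.
by rewrite (_ : a * (x + u) + c = a * x + c + a * u)//; ring.
Qed.

Lemma is_derive_shift f (df : R -> R) u : (forall x, is_derive x 1 f (df x)) ->
  forall x, is_derive x 1 (fun y => f (y + u)) (df (x + u)).
Proof.
move=> fdf x.
have h2 : is_derive x 1 (fun y : R => y + u) 1.
  have := is_deriveD (is_derive_id (x : R^o) 1) (is_derive_cst (u : R^o) (x : R^o) 1).
  by rewrite addr0.
have := @is_derive1_comp R f (fun y => y + u) x _ _ (fdf (x + u)) h2.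
by rewrite mulr1.
Qed.

Lemma is_derive_iter_fdiff n u f df : (forall x, is_derive x 1 f (df x)) ->
  forall x, is_derive x 1 (iter n (fdiff u) f) (iter n (fdiff u) df x).
Proof.
move=> fdf; elim: n => [//|n IH] x; rewrite !iterS.
by have := is_deriveB (is_derive_shift u IH x) (IH x).
Qed.

Definition trunc_pow k (x : R) : R := Num.max x 0 ^+ k.

Lemma is_derive_trunc_pow k x :
  is_derive x 1 (trunc_pow k.+2) (k.+2%:R * trunc_pow k.+1 x).
Proof.
have [x0|x0|->] := ltgtP x 0.
- have -> : k.+2%:R * trunc_pow k.+1 x = 0.
    by rewrite /trunc_pow max_r ?expr0n ?mulr0// ltW.
  apply: (@near_eq_is_derive _ _ _ (cst 0)) => //.
  near=> y; rewrite /trunc_pow max_r ?expr0n//.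
  by apply: ltW; near: y; exact: lt_nbhsl.
- apply: (@near_eq_is_derive _ _ _ (fun y : R => y ^+ k.+2)).
    near=> y; rewrite /trunc_pow max_l//.
    by apply: ltW; near: y; exact: lt_nbhsr.
  have := is_deriveX k.+2 (is_derive_id (x : R^o) 1).
  have -> : (id : R^o -> R^o) ^+ k.+2 = (fun y : R => y ^+ k.+2).
    by apply/funext => y; rewrite exprfctE.
  have -> : k.+2%:R * trunc_pow k.+1 x = (k.+2%:R * x ^+ k.+1) *: (1 : R^o).
    by rewrite /GRing.scale/= mulr1 /trunc_pow; congr (_ * _ ^+ _); apply: max_l; exact: ltW.
  exact.
- rewrite /trunc_pow max_r// expr0n mulr0.
  have h : h^-1 *: (trunc_pow k.+2 (h *: 1 + 0) - trunc_pow k.+2 0)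
      @[h --> 0^'] --> (0 : R).
    apply/cvgr0Pnorm_le => e e0; near=> h.
    have h0 : h != 0 by near: h; exact: nbhs_dnbhs_neq.
    have h1 : `|h| < 1.
      by near: h; apply: dnbhs0_lt.
    have he : `|h| < e by near: h; apply: dnbhs0_lt.
    have -> : trunc_pow k.+2 0 = 0 by rewrite /trunc_pow max_r// expr0n.
    rewrite subr0 addr0 /GRing.scale/= mulr1 /trunc_pow.
    rewrite normrM normfV normrX.
    have hm : `|Num.max h 0| <= `|h|.
      by case: (leP 0 h) => // _; rewrite normr0.
    rewrite ler_pdivrMl ?normr_gt0//.
    apply: (@le_trans _ _ (`|h| ^+ k.+2)); first by rewrite lerXn2r ?nnegrE.
    rewrite exprS ler_wpM2l// exprS; apply: le_trans (ltW he).
    by rewrite ler_piMr// exprn_ile1// ltW.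
  apply: DeriveDef; first by apply/cvg_ex; exists 0.
  exact: cvg_lim h.
Unshelve. all: by end_near. Qed.

(** By the mean value theorem each difference costs a factor [u] and a
    derivative; the last derivative is the positive part, which is Lipschitz. *)
Lemma iter_fdiff_trunc_pow k u x : 0 < u ->
  `|iter k.+1 (fdiff u) (trunc_pow k.+1) x| <= (k.+1)`!%:R * u ^+ k.+1.
Proof.
move=> u0; elim: k x => [|k IH] x.
  rewrite /= /fdiff /trunc_pow !expr1 mul1r.
  rewrite ler_norml; apply/andP; split.
    by case: (leP 0 (x + u)) => ?; case: (leP 0 x) => ?; lra.
  by case: (leP 0 (x + u)) => ?; case: (leP 0 x) => ?; lra.
rewrite iterS {1}/fdiff.
have xu : x < x + u by rewrite ltrDl.
have dI y := is_derive_iter_fdiff k.+1 u (is_derive_trunc_pow k) y.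
have [|y _ ->] := @MVT R _ _ x (x + u) xu (fun y _ => dI y).
  apply: continuous_subspaceT => y; apply/differentiable_continuous/derivable1_diffP.
  exact: ex_derive.
rewrite iter_fdiffZ addrAC subrr add0r normrM (gtr0_norm u0) normrM normr_nat.
rewrite factS natrM exprSr mulrA ler_wpM2r ?(ltW u0)// -mulrA ler_wpM2l//.
Qed.

End differences.

(** * A bump with small differences *)
Section bump.
Context {R : realType}.
Implicit Types (f : R -> R) (p : {poly R}) (u x : R) (k n : nat).

Definition bdiff f x : R := f x - f (x - 1).

Lemma iter_fdiff_bdiff k n u f (C : R) :
  (forall x, `|iter k (fdiff u) f x| <= C) ->
  forall x, `|iter k (fdiff u) (iter n bdiff f) x| <= 2 ^+ n * C.
Proof.
move=> fC; elim: n => [|n IH] x; first by rewrite expr0 mul1r.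
rewrite iterS iter_fdiffB.
have := iter_fdiff_affine k u (iter n bdiff f) 1 (- 1) x.
rewrite mul1r; under [X in iter k (fdiff u) X]eq_fun do rewrite mul1r.
move=> ->; rewrite mul1r; apply: (le_trans (ler_normB _ _)).
by rewrite exprS -mulrA mulr2n mulrDl mul1r lerD.
Qed.

Lemma iter_bdiff_le n f (X C : R) : (forall x, x <= X -> `|f x| <= C) ->
  forall x, x <= X -> `|iter n bdiff f x| <= 2 ^+ n * C.
Proof.
move=> fC; elim: n => [|n IH] x xX; first by rewrite expr0 mul1r; exact: fC.
rewrite iterS /bdiff; apply: (le_trans (ler_normB _ _)).
rewrite exprS -mulrA mulr2n mulrDl mul1r lerD//; apply: IH => //; lra.
Qed.

Lemma iter_bdiff_left n f : (forall x, x <= 0 -> f x = 0) ->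
  forall x, x <= 1 -> iter n bdiff f x = f x.
Proof.
move=> f0; elim: n => [//|n IH] x x1.
rewrite iterS /bdiff !IH ?[f (x - 1)]f0 ?subr0//; lra.
Qed.

Lemma size_poly_bdiff p n : (size p <= n.+1)%N ->
  (size (p - (p \Po ('X - 1%:P)))%R <= n)%N.
Proof.
move=> pn; apply/leq_sizeP => j nj; rewrite coefB.
have sz : size (p \Po ('X - 1%:P)) = size p.
  by rewrite size_comp_poly2// size_XsubC.
have [jp|pj] := ltnP j (size p); last first.
  by rewrite !nth_default ?subr0// sz.
have jE : j = (size p).-1 by lia.
have := @lead_coef_comp R p ('X - 1%:P).
rewrite size_XsubC lead_coefXsubC expr1n mulr1 => /(_ isT).
by rewrite /lead_coef sz -jE => ->; rewrite subrr.
Qed.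

Lemma iter_bdiff_poly n f p (a : R) : (size p <= n)%N ->
  (forall x, a <= x -> f x = p.[x]) ->
  forall x, a + n%:R <= x -> iter n bdiff f x = 0.
Proof.
elim: n f p a => [|n IH] f p a sp fp x ax.
  move: sp; rewrite leqn0 size_poly_eq0 => /eqP p0.
  by rewrite /= fp ?p0 ?horner0//; lra.
rewrite iterSr; apply: (IH _ (p - (p \Po ('X - 1%:P))) (a + 1)).
- exact: size_poly_bdiff.
- move=> y ay; rewrite /bdiff !fp; [|lra|lra].
  by rewrite !hornerE horner_comp !hornerE.
- by move: ax; rewrite -natr1; lra.
Qed.

Lemma continuous_trunc_pow k : continuous (@trunc_pow R k).
Proof.
move=> x; rewrite /trunc_pow.
apply: (@continuous_comp _ _ _ (fun x : R => Num.max x 0) (fun y => y ^+ k)).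
  apply: (@continuous_max R _ idfun (cst 0)) => //; first exact: cvg_cst.
exact: exprn_continuous.
Qed.

Lemma continuous_affine f (a c : R) : continuous f ->
  continuous (fun x => f (a * x + c)).
Proof.
move=> cf x; apply: (@continuous_comp _ _ _ (fun x => a * x + c) f); last exact: cf.
apply: cvgD; last exact: cvg_cst.
by apply: cvgM; [exact: cvg_cst|exact: cvg_id].
Qed.

Lemma continuous_iter_bdiff n f : continuous f -> continuous (iter n bdiff f).
Proof.
move=> cf; elim: n => [//|n IH] x; rewrite iterS.
apply: cvgB; first exact: IH.
suff : continuous (fun y : R => iter n bdiff f (y - 1)) by exact.
have -> : (fun y : R => iter n bdiff f (y - 1)) =
    (fun y : R => iter n bdiff f (1 * y + (- 1))).
  by apply/funext => y; rewrite mul1r.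
exact: continuous_affine.
Qed.

(** A dilated cardinal B-spline of degree [k], which is a difference of order
    [k.+1] of [trunc_pow k]: its own differences are combinations of those of
    [trunc_pow k], and its support is bounded because on the right of the knots a
    difference of order [k.+1] kills a polynomial of degree [k]. It lives in the
    middle half of the unit interval, to leave room between adjacent bumps. *)
Lemma bump_exists k : (0 < k)%N -> exists b : R -> R, exists2 C : R, 0 < C &
  [/\ continuous b,
      forall y, ~~ (4^-1 < y < 3 / 4) -> b y = 0,
      forall y, `|b y| <= C,
      forall u y, 0 < u -> `|iter k (fdiff u) b y| <= C * u ^+ k &
      exists e y0 y1 : R, [/\ 0 < e, y0 < y1 & forall y, y0 <= y <= y1 -> e <= b y]].
Proof.
case: k => [//|k] _.
pose n : nat := k.+2.
pose phi := iter n bdiff (trunc_pow k.+1).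
pose a : R := 2 * n%:R; pose c : R := - (n%:R / 2).
have n0 : 0 < n%:R :> R by [].
have a0 : 0 < a by rewrite /a; lra.
pose b y := phi (a * y + c).
have tp0 x : x <= 0 -> trunc_pow k.+1 x = 0.
  by move=> x0; rewrite /trunc_pow max_r// expr0n.
have phi0 x : x <= 0 -> phi x = 0.
  by move=> x0; rewrite /phi iter_bdiff_left ?tp0//; lra.
have phin x : n%:R <= x -> phi x = 0.
  move=> nx; apply: (@iter_bdiff_poly n _ 'X^(k.+1) 0); rewrite ?add0r//.
    by rewrite size_polyXn.
  by move=> y y0; rewrite /trunc_pow max_l// hornerXn.
pose C1 : R := 2 ^+ n * n%:R ^+ k.+1.
have C10 : 0 < C1 by rewrite mulr_gt0 ?exprn_gt0.
have phiC x : `|phi x| <= C1.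
  have [xn|xn] := leP x n%:R; last by rewrite phin ?normr0 ?ltW.
  apply: (@iter_bdiff_le n _ n%:R) xn => y yn.
  rewrite /trunc_pow normrX lerXn2r ?nnegrE//.
  by case: (leP 0 y) => y0; [rewrite ger0_norm|rewrite normr0].
pose C2 : R := 2 ^+ n * (k.+1)`!%:R * a ^+ k.+1.
have C20 : 0 <= C2.
  apply: mulr_ge0; last by apply: exprn_ge0; exact: ltW.
  by apply: mulr_ge0 => //; exact: exprn_ge0.
exists b, (C1 + C2); first by rewrite ltr_wpDr.
split.
- apply: continuous_affine; apply: continuous_iter_bdiff.
  exact: continuous_trunc_pow.
- move=> y; rewrite negb_and -!leNgt => /orP[y1|y3].
    by apply: phi0; rewrite /a /c; nra.
  by apply: phin; rewrite /a /c; nra.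
- by move=> y; apply: (le_trans (phiC _)); rewrite lerDl.
- move=> u y u0; rewrite /b iter_fdiff_affine.
  have au : 0 < a * u by exact: mulr_gt0.
  apply: (@le_trans _ _ (2 ^+ n * ((k.+1)`!%:R * (a * u) ^+ k.+1))).
    apply: iter_fdiff_bdiff => x; exact: iter_fdiff_trunc_pow.
  rewrite exprMn !mulrA mulrDl -/C2 lerDr.
  by rewrite mulr_ge0 ?exprn_ge0 ?ltW.
- exists (2^-1 ^+ k.+1), ((2^-1 - c) / a), ((1 - c) / a); split.
  + by rewrite exprn_gt0.
  + by rewrite ltr_pM2r ?invr_gt0// ltrD2r; lra.
  + move=> y /andP[]; rewrite ler_pdivrMr// ler_pdivlMr// => y0 y1.
    rewrite /b /phi (iter_bdiff_left _ tp0); last lra.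
    rewrite /trunc_pow max_l; last lra.
    by rewrite lerXn2r ?nnegrE//; lra.
Qed.

End bump.

(** * Norms of sums of bumps *)
Section norm01_lemmas.
Context {R : realType}.
Local Notation mu := (@lebesgue_measure R).
Implicit Types (g h : R -> R) (p N : R).

Lemma measurable_unit_itv : measurable (@unit_itv R).
Proof. exact: measurable_itv. Qed.

Lemma norm01E p g :
  norm01 p g =
  ((\int[mu]_x (`|(g \_ unit_itv) x| `^ p)%:E) `^ p^-1)%E.
Proof.
by rewrite /norm01 unlock.
Qed.

Lemma measurable_norm_powR p g : measurable_fun [set: R] g ->
  measurable_fun [set: R] (fun x => `|g x| `^ p).
Proof.
move=> mg; apply: (measurableT_comp (measurable_powR _)).
exact: measurableT_comp.
Qed.

Lemma norm01_le p N g h : 0 < p -> 0 <= N -> measurable_fun [set: R] g ->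
  measurable_fun [set: R] h -> (forall x, 0 <= h x) ->
  (forall x, unit_itv x -> `|g x| `^ p <= h x) ->
  (\int[mu]_x (h x)%:E <= N%:E)%E ->
  (norm01 p g <= (N `^ p^-1)%:E)%E.
Proof.
move=> p0 N0 mg mh h0 gh hN; rewrite norm01E -poweR_EFin.
apply: gt0_ler_poweR; rewrite ?invr_ge0 ?(ltW p0)// ?in_itv/= ?leey ?andbT ?lee_fin//.
  by rewrite integral_ge0// => x _; rewrite lee_fin powR_ge0.
apply: le_trans hN; apply: ge0_le_integral => //.
- apply/measurable_EFinP; apply: measurable_norm_powR.
  apply: (measurable_restrictT g measurable_unit_itv).1.
  exact: measurable_funTS.
- exact/measurable_EFinP.
- move=> x _; rewrite lee_fin patchE; case: ifPn => [/set_mem ux|_]; first exact: gh.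
  by rewrite normr0 powR0// gt_eqF.
Qed.

Lemma norm01_eq p N g : 0 < p -> (forall x, ~ unit_itv x -> g x = 0) ->
  (\int[mu]_x (`|g x| `^ p)%:E = N%:E)%E ->
  norm01 p g = (N `^ p^-1)%:E.
Proof.
move=> p0 g0 gN; rewrite norm01E -poweR_EFin -gN.
congr ((_ : \bar R) `^ _)%E; apply: eq_integral => x _.
rewrite patchE; case: ifPn => // /negP nx; rewrite g0//.
by move=> ux; apply: nx; exact/mem_set.
Qed.

Lemma measurable_sym_diff k u f : measurable_fun [set: R] f ->
  measurable_fun [set: R] (@sym_diff R k u f).
Proof.
move=> mf; rewrite /sym_diff; apply: measurable_fun_ifT => //=.
  by do !(apply: measurable_and || apply: measurable_fun_ler ||
    apply: measurable_funD || apply: measurable_funB) => //.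
apply: measurable_sum => i; apply: measurable_funM => //.
apply: (measurableT_comp mf).
exact: measurable_funD.
Qed.

End norm01_lemmas.

Section bump_sum.
Context {R : realType}.
Local Notation mu := (@lebesgue_measure R).
Variables (b : R -> R) (C : R).
Hypotheses (C0 : 0 < C) (cb : continuous b)
  (b0 : forall y, ~~ (4^-1 < y < 3 / 4) -> b y = 0)
  (bC : forall y, `|b y| <= C).
Hypothesis b_pos : exists e y0 y1 : R,
  [/\ 0 < e, y0 < y1 & forall y, y0 <= y <= y1 -> e <= b y].

Let mb : measurable_fun [set: R] b.
Proof. exact: continuous_measurable_fun. Qed.

Lemma bump_integral q : 0 < q -> exists2 beta : R, 0 < beta &
  forall m j : nat, (0 < m)%N ->
  (\int[mu]_y (`|b (m%:R * y - j%:R)| `^ q)%:E = (beta / m%:R)%:E)%E.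
Proof.
move=> q0; pose I := (\int[mu]_y (`|b y| `^ q)%:E)%E.
have mbq : measurable_fun [set: R] (fun y => (`|b y| `^ q)%:E).
  by apply/measurable_EFinP; exact: measurable_norm_powR.
have Ile : (I <= (C `^ q)%:E)%E.
  have -> : (C `^ q)%:E = (\int[mu]_(y in `[0%R, 1%R]) (cst (C `^ q)%:E) y)%E.
    rewrite integral_cst//= lebesgue_measure_itv/= lte01 -EFinB subr0.
    by rewrite mule1.
  rewrite [leRHS]integral_mkcond; apply: ge0_le_integral => //.
  - by apply: (measurable_restrictT _ (measurable_itv _)).1; exact: measurable_cst.
  - move=> y _; rewrite patchE; case: ifPn => [_|/negP ny].
      by rewrite lee_fin ge0_ler_powR ?nnegrE ?(ltW q0) ?(ltW C0).
    rewrite b0 ?normr0 ?powR0 ?gt_eqF//.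
    apply/negP => /andP[y1 y3]; apply: ny; apply/mem_set.
    by rewrite /= in_itv/=; apply/andP; split; lra.
have [e [y0 [y1 [e0 y01 be]]]] := b_pos.
have Ige : ((e `^ q * (y1 - y0))%:E <= I)%E.
  have -> : (e `^ q * (y1 - y0))%:E =
      (\int[mu]_(y in `[y0, y1]) (cst (e `^ q)%:E) y)%E.
    by rewrite integral_cst//= lebesgue_measure_itv/= lte_fin y01 -EFinB -EFinM.
  rewrite [leLHS]integral_mkcond; apply: ge0_le_integral => //.
  - by move=> y _; rewrite patchE; case: ifPn => // _; rewrite lee_fin powR_ge0.
  - by apply: (measurable_restrictT _ (measurable_itv _)).1; exact: measurable_cst.
  - move=> y _; rewrite patchE; case: ifPn => [/set_mem/=|_].
      rewrite in_itv/= => /be eb; rewrite lee_fin ge0_ler_powR ?nnegrE ?(ltW q0) ?(ltW e0)//.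
      exact: le_trans (ler_norm _).
    by rewrite lee_fin powR_ge0.
have Ifin : I \is a fin_num.
  rewrite ge0_fin_numE; first exact: le_lt_trans Ile (ltry _).
  by apply: integral_ge0 => y _; rewrite lee_fin powR_ge0.
exists (fine I).
  rewrite -lte_fin fineK//; apply: lt_le_trans Ige.
  by rewrite lte_fin mulr_gt0 ?powR_gt0// subr_gt0.
move=> m j m0.
under eq_integral do rewrite [_ - j%:R]addrC.
rewrite (@ge0_integral_affine _ (- j%:R) m%:R (fun y => (`|b y| `^ q)%:E)).
- by rewrite -/I -(fineK Ifin) -EFinM mulrC.
- by rewrite ltr0n.
- exact: mbq.
- by move=> y; rewrite lee_fin powR_ge0.
Qed.

Definition bump_sum (A : R) (m : nat) (th : seq R) (y : R) : R :=
  A * \sum_(j < m) th`_j * b (m%:R * y - j%:R).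

Lemma measurable_bump_sum A m th : measurable_fun [set: R] (bump_sum A m th).
Proof.
apply: measurable_funM => //; apply: measurable_sum => j.
apply: measurable_funM => //; apply: (measurableT_comp mb).
by apply: measurable_funB => //; exact: measurable_funM.
Qed.

Lemma bump_sum_out A m th y : ~ unit_itv y -> bump_sum A m th y = 0.
Proof.
move=> ny; rewrite /bump_sum big1 ?mulr0// => j _.
rewrite b0 ?mulr0//; apply/negP => /andP[h1 h2]; apply: ny.
have jm : (j%:R : R) + 1 <= m%:R by rewrite natr1 ler_nat.
have j0 : 0 <= (j%:R : R) by [].
have m0 : 0 < (m%:R : R) by lra.
rewrite /unit_itv/= in_itv/=; apply/andP; split.
  by rewrite -(pmulr_rge0 _ m0); lra.
by rewrite -(ler_pM2l m0) mulr1; lra.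
Qed.

Lemma norm_sum_disjoint m (g : 'I_m -> R) q : 0 < q ->
  (forall i j, g i != 0 -> g j != 0 -> i = j) ->
  `|\sum_j g j| `^ q = \sum_j `|g j| `^ q.
Proof.
move=> q0 dj; have [[j gj]|none] := pselect (exists j, g j != 0).
  have g0 i : i != j -> g i = 0.
    by move=> ij; apply/eqP; apply: contraNT ij => gi; rewrite (dj i j).
  rewrite (bigD1 j)//= big1 ?addr0// (bigD1 j)//= [X in _ + X]big1 ?addr0//.
  by move=> i ij; rewrite g0// normr0 powR0// gt_eqF.
have g0 i : g i = 0.
  by apply/eqP; apply: contrapT => /negP gi; apply: none; exists i.
by rewrite !big1 ?normr0 ?powR0 ?gt_eqF// => i _; rewrite g0 normr0 powR0// gt_eqF.
Qed.

Lemma cell_uniq (x : R) (i j : nat) :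
  0 < x - i%:R < 1 -> 0 < x - j%:R < 1 -> i = j.
Proof.
move=> /andP[i0 i1] /andP[j0 j1]; apply/eqP; rewrite eqn_leq.
have ij : (i%:R : R) < j.+1%:R by rewrite -natr1; lra.
have ji : (j%:R : R) < i.+1%:R by rewrite -natr1; lra.
by move: ij ji; rewrite !ltr_nat !ltnS => -> ->.
Qed.

Lemma bump_sum_pow A m th q y : 0 <= A -> 0 < q ->
  `|bump_sum A m th y| `^ q =
  A `^ q * \sum_(j < m) `|th`_j| `^ q * `|b (m%:R * y - j%:R)| `^ q.
Proof.
move=> A0 q0; rewrite /bump_sum normrM powRM// (ger0_norm A0); congr (_ * _).
rewrite norm_sum_disjoint//.
  by apply: eq_bigr => j _; rewrite normrM powRM.
have bj (j : 'I_m) : th`_j * b (m%:R * y - j%:R) != 0 -> 0 < m%:R * y - j%:R < 1.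
  move=> h; have : b (m%:R * y - j%:R) != 0.
    by apply: contraNneq h => ->; rewrite mulr0.
  move=> /eqP nb; have /negP := contra_not (@b0 (m%:R * y - j%:R)) nb.
  by rewrite negbK => /andP[? ?]; apply/andP; split; lra.
by move=> i j /bj hi /bj hj; apply/val_inj; exact: cell_uniq hi hj.
Qed.

Lemma bump_sum_integral A m th q beta : 0 <= A -> 0 < q ->
  (forall m j : nat, (0 < m)%N ->
   (\int[mu]_y (`|b (m%:R * y - j%:R)| `^ q)%:E = (beta / m%:R)%:E)%E) ->
  (0 < m)%N ->
  (\int[mu]_y (`|bump_sum A m th y| `^ q)%:E =
   (A `^ q * (beta * (m%:R^-1 * \sum_(j < m) `|th`_j| `^ q)))%:E)%E.
Proof.
move=> A0 q0 hb m0.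
have mbj (j : nat) : measurable_fun [set: R]
    (fun y => (`|b (m%:R * y - j%:R)| `^ q)%:E).
  apply/measurable_EFinP; apply: measurable_norm_powR.
  apply: (measurableT_comp mb).
  by apply: measurable_funB => //; exact: measurable_funM.
under eq_integral do rewrite bump_sum_pow// EFinM -sumEFin.
rewrite ge0_integralZl//; last 3 first.
- apply: emeasurable_sum => j; under eq_fun do rewrite EFinM.
  by apply: emeasurable_funM => //; exact: mbj.
- by move=> y _; apply: sume_ge0 => j _; rewrite lee_fin mulr_ge0 ?powR_ge0.
- by rewrite lee_fin powR_ge0.
rewrite EFinM; congr (_ * _)%E.
rewrite ge0_integral_sum//; last first.
- move=> j; under eq_fun do rewrite EFinM.
  by apply: emeasurable_funM => //; exact: mbj.
rewrite !mulr_sumr -sumEFin; apply: eq_bigr => j _.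
under eq_integral do rewrite EFinM.
rewrite ge0_integralZl//.
- by rewrite hb// -EFinM; congr EFin; ring.
- exact: mbj.
Qed.

Lemma bump_sum_norm A m th q beta : 0 <= A -> 0 < q -> 0 < beta ->
  (forall m j : nat, (0 < m)%N ->
   (\int[mu]_y (`|b (m%:R * y - j%:R)| `^ q)%:E = (beta / m%:R)%:E)%E) ->
  (0 < m)%N ->
  norm01 q (bump_sum A m th) =
  (A * beta `^ q^-1 * (m%:R^-1 * \sum_(j < m) `|th`_j| `^ q) `^ q^-1)%:E.
Proof.
move=> A0 q0 be0 hb m0; rewrite (norm01_eq q0 _ (bump_sum_integral th A0 q0 hb m0)).
  have S0 : 0 <= m%:R^-1 * \sum_(j < m) `|th`_j| `^ q.
    by rewrite mulr_ge0 ?invr_ge0// sumr_ge0// => j _; rewrite powR_ge0.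
  rewrite powRM; [|exact: powR_ge0|by rewrite mulr_ge0// ltW].
  rewrite (@powRM _ beta); [|exact: ltW|by []].
  by rewrite -powRrM mulfV ?powRr1 ?gt_eqF// mulrA.
by move=> y; exact: bump_sum_out.
Qed.

End bump_sum.

(** * Besov norm of sums of bumps *)
Section besov_bound.
Context {R : realType}.
Local Notation mu := (@lebesgue_measure R).

Lemma iter_fdiff_sum n (u : R) (I : finType) (g : I -> R -> R) x :
  iter n (fdiff u) (fun y => \sum_i g i y) x = \sum_i iter n (fdiff u) (g i) x.
Proof.
elim: n x => [//|n IH] x.
by rewrite iterS /fdiff !IH -sumrB.
Qed.

Lemma norm_sum_powR n (a : 'I_n -> R) p : 0 < p ->
  `|\sum_i a i| `^ p <= n%:R `^ p * \sum_i `|a i| `^ p.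
Proof.
move=> p0; set T := \sum_i _.
have T0 : 0 <= T by apply: sumr_ge0 => i _; exact: powR_ge0.
have aT i : `|a i| <= T `^ p^-1.
  rewrite -[leLHS](@powRr1 _) // -(mulfV (lt0r_neq0 p0)) powRrM.
  rewrite ge0_ler_powR ?nnegrE ?powR_ge0 ?invr_ge0 ?(ltW p0)//.
  by rewrite /T (bigD1 i)//= lerDl sumr_ge0// => j _; exact: powR_ge0.
have : `|\sum_i a i| <= n%:R * T `^ p^-1.
  apply: (le_trans (ler_norm_sum _ _ _)).
  apply: (@le_trans _ _ (\sum_(i < n) T `^ p^-1)); first exact: ler_sum.
  by rewrite sumr_const card_ord mulr_natl.
move=> h; apply: (@le_trans _ _ ((n%:R * T `^ p^-1) `^ p)).
  by rewrite ge0_ler_powR ?nnegrE ?mulr_ge0 ?powR_ge0// ltW.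
rewrite powRM ?powR_ge0// -powRrM mulVf ?powRr1//.
exact: lt0r_neq0.
Qed.

Variables (b : R -> R) (C : R) (k : nat).
Hypotheses (k0 : (0 < k)%N) (C0 : 0 < C) (cb : continuous b)
  (b0 : forall y, ~~ (4^-1 < y < 3 / 4) -> b y = 0)
  (bD : forall u y, 0 < u -> `|iter k (fdiff u) b y| <= C * u ^+ k).
Variables (p beta : R).
Hypotheses (p1 : 1 <= p) (beta0 : 0 < beta)
  (hb : forall m j : nat, (0 < m)%N ->
    (\int[mu]_y (`|b (m%:R * y - j%:R)| `^ p)%:E = (beta / m%:R)%:E)%E).

Let p0 : 0 < p. Proof. exact: lt_le_trans p1. Qed.

Variables (A : R) (m : nat) (th : seq R).
Hypotheses (A0 : 0 <= A) (m0 : (0 < m)%N).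

Let f := bump_sum b A m th.
Let S := m%:R^-1 * \sum_(j < m) `|th`_j| `^ p.

Let m0R : 0 < m%:R :> R. Proof. by rewrite ltr0n. Qed.

Let S0 : 0 <= S.
Proof. by rewrite mulr_ge0 ?invr_ge0// sumr_ge0// => j _; exact: powR_ge0. Qed.

Let mf : measurable_fun [set: R] f.
Proof. exact: measurable_bump_sum. Qed.

Let D (u x : R) (j : nat) : R :=
  iter k (fdiff (m%:R * u)) b (m%:R * (x - k%:R / 2 * u) - j%:R).

Let sym_diff_cells u x : sym_diff k u f x != 0 ->
  sym_diff k u f x = A * \sum_(j < m) th`_j * D u x j.
Proof.
have [h _|/negbTE h] := boolP ((0 <= x + k%:R / 2 * u <= 1) &&
    (0 <= x - k%:R / 2 * u <= 1)); last by rewrite /sym_diff h eqxx.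
rewrite sym_diffE// /f /bump_sum iter_fdiffZ iter_fdiff_sum; congr (_ * _).
apply: eq_bigr => j _; rewrite iter_fdiffZ; congr (_ * _).
by rewrite (iter_fdiff_affine k u b m%:R (- j%:R)).
Qed.

(** The bumps sit in the middle halves of the cells, so that differences of
    small step of distinct bumps still have disjoint supports. *)
Let D_cell u x (j : nat) : 0 < u -> m%:R * k%:R * u <= 2^-1 ->
  D u x j != 0 -> 0 <= m%:R * x - j%:R <= 1 /\ 0 < m%:R * x - j%:R < 1.
Proof.
move=> u0 mku Dj.
suff h : 0 < m%:R * x - j%:R < 1 by split => //; case/andP: h => ? ?; rewrite !ltW.
apply: contraNT Dj => nh; apply/eqP; rewrite /D iter_fdiffE.
apply: big1 => l _; rewrite b0 ?mulr0//; apply: contra nh => /andP[h1 h2].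
have lk : (l%:R : R) <= k%:R by rewrite ler_nat -ltnS.
have l0 : 0 <= (l%:R : R) by [].
have mu0 : 0 < m%:R * u by exact: mulr_gt0.
have lmu : l%:R * (m%:R * u) <= k%:R * (m%:R * u) by rewrite ler_wpM2r// ltW.
have lmu0 : 0 <= l%:R * (m%:R * u) by rewrite mulr_ge0// ltW.
have e1 : m%:R * (x - k%:R / 2 * u) = m%:R * x - 2^-1 * (m%:R * k%:R * u) by ring.
have e2 : k%:R * (m%:R * u) = m%:R * k%:R * u by ring.
rewrite e1 in h1 h2; rewrite e2 in lmu.
by apply/andP; split; lra.
Qed.

Let small_step u : 0 < u -> m%:R * k%:R * u <= 2^-1 ->
  (norm01 p (sym_diff k u f) <=
   (A * C * (m%:R * u) ^+ k * S `^ p^-1)%:E)%E.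
Proof.
move=> u0 mku.
have mu0 : 0 <= (m%:R * u) by rewrite mulr_ge0// ltW.
pose c := C * (m%:R * u) ^+ k.
have c0 : 0 <= c by rewrite mulr_ge0 ?exprn_ge0// ltW.
pose g (j : nat) (x : R) : R := \1_(`[0, 1]%classic : set R) (m%:R * x - j%:R).
have mg j : measurable_fun [set: R] (g j).
  have mi : measurable_fun [set: R] (\1_(`[0, 1]%classic : set R) : R -> R).
    exact: measurable_indic.
  have mh : measurable_fun [set: R] (fun x : R => m%:R * x - j%:R).
    by apply: measurable_funB => //; exact: measurable_funM.
  exact: (measurableT_comp mi mh).
have Ig j : (\int[mu]_x (g j x)%:E = (m%:R^-1)%:E)%E.
  rewrite /g; under eq_integral do rewrite [_ - j%:R]addrC.
  rewrite (@ge0_integral_affine _ (- j%:R) m%:R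
    (fun x => (\1_(`[0, 1]%classic : set R) x)%:E))//.
  - by rewrite integral_indic//= setIT lebesgue_measure_itv/= lte01 -EFinB subr0 mule1.
  - by apply/measurable_EFinP; exact: measurable_indic.
pose h x := (A * c) `^ p * \sum_(j < m) `|th`_j| `^ p * g j x.
have Ih : (\int[mu]_x (h x)%:E = ((A * c) `^ p * S)%:E)%E.
  under eq_integral do rewrite EFinM -sumEFin.
  rewrite ge0_integralZl//; last 3 first.
  - apply: emeasurable_sum => j; apply/measurable_EFinP.
    by apply: measurable_funM => //; exact: mg.
  - move=> x _; apply: sume_ge0 => j _.
    by rewrite lee_fin mulr_ge0 ?powR_ge0// /g indicE.
  - by rewrite lee_fin powR_ge0.
  rewrite EFinM; congr (_ * _)%E.
  rewrite ge0_integral_sum//; last 2 first.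
  - move=> j; apply/measurable_EFinP.
    by apply: measurable_funM => //; exact: mg.
  - by move=> j x _; rewrite lee_fin mulr_ge0 ?powR_ge0// /g indicE.
  rewrite /S mulr_sumr -sumEFin; apply: eq_bigr => j _.
  under eq_integral do rewrite EFinM.
  rewrite ge0_integralZl//; last 2 first.
  - by apply/measurable_EFinP; exact: mg.
  - by move=> x _; rewrite lee_fin /g indicE.
  by rewrite Ig -EFinM mulrC.
have -> : A * C * (m%:R * u) ^+ k * S `^ p^-1 = ((A * c) `^ p * S) `^ p^-1.
  rewrite (@powRM _ (_ `^ p)) ?powR_ge0// -powRrM mulfV ?gt_eqF//.
  rewrite powRr1; last exact: mulr_ge0.
  by rewrite /c !mulrA.
apply: (@norm01_le _ _ _ _ h) => //.
- by rewrite mulr_ge0 ?powR_ge0.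
- exact: measurable_sym_diff.
- apply: measurable_funM => //; apply: measurable_sum => j.
  by apply: measurable_funM => //; exact: mg.
- move=> x; rewrite mulr_ge0 ?powR_ge0// sumr_ge0// => j _.
  by rewrite mulr_ge0 ?powR_ge0// /g indicE.
- move=> x _; have [->|nz] := eqVneq (sym_diff k u f x) 0.
    rewrite normr0 powR0 ?gt_eqF// mulr_ge0 ?powR_ge0// sumr_ge0// => j _.
    by rewrite mulr_ge0 ?powR_ge0// /g indicE.
  rewrite sym_diff_cells// normrM powRM// (ger0_norm A0) /h.
  rewrite (@powRM _ A)// -mulrA ler_wpM2l ?powR_ge0//.
  rewrite norm_sum_disjoint//; last first.
    move=> i j Di Dj; apply/val_inj.
    have Dn (l : 'I_m) : th`_l * D u x l != 0 -> D u x l != 0.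
      by apply: contraNneq => ->; rewrite mulr0.
    have [_ hi] := D_cell u0 mku (Dn _ Di).
    have [_ hj] := D_cell u0 mku (Dn _ Dj).
    exact: cell_uniq hi hj.
  rewrite mulr_sumr; apply: ler_sum => j _.
  rewrite normrM powRM// mulrCA ler_wpM2l ?powR_ge0//.
  have [->|nD] := eqVneq (D u x j) 0.
    by rewrite normr0 powR0 ?gt_eqF// mulr_ge0 ?powR_ge0// /g indicE.
  have [h01 _] := D_cell u0 mku nD.
  have -> : g j x = 1 by rewrite /g indicE mem_set//= in_itv.
  rewrite mulr1.
  rewrite ge0_ler_powR ?nnegrE ?(ltW p0)//.
  by apply: bD; exact: mulr_gt0.
- by rewrite Ih.
Qed.

Let If : (\int[mu]_x (`|f x| `^ p)%:E = (A `^ p * (beta * S))%:E)%E.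
Proof. exact: bump_sum_integral. Qed.

Let any_step u :
  (norm01 p (sym_diff k u f) <=
   (A * (k.+1%:R ^+ 2 * 2 ^+ k * beta `^ p^-1) * S `^ p^-1)%:E)%E.
Proof.
pose h x := (k.+1%:R * 2 ^+ k) `^ p *
  \sum_(l < k.+1) `|f (x + (l%:R - k%:R / 2) * u)| `^ p.
have mfl (l : nat) : measurable_fun [set: R]
    (fun x => `|f (x + (l%:R - k%:R / 2) * u)| `^ p).
  apply: measurable_norm_powR; apply: (measurableT_comp mf).
  exact: measurable_funD.
have Il (l : nat) : (\int[mu]_x (`|f (x + (l%:R - k%:R / 2) * u)| `^ p)%:E =
    (A `^ p * (beta * S))%:E)%E.
  rewrite -If.
  under eq_integral do rewrite addrC -[X in _ + X]mul1r.
  rewrite (@ge0_integral_affine _ _ 1 (fun x => (`|f x| `^ p)%:E))//.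
  - by rewrite invr1 mul1e.
  - by apply/measurable_EFinP; exact: measurable_norm_powR.
have Ih : (\int[mu]_x (h x)%:E =
    ((k.+1%:R * 2 ^+ k) `^ p * (k.+1%:R * (A `^ p * (beta * S))))%:E)%E.
  under eq_integral do rewrite EFinM -sumEFin.
  rewrite ge0_integralZl//; last 2 first.
  - by apply: emeasurable_sum => l; apply/measurable_EFinP; exact: mfl.
  - by move=> x _; apply: sume_ge0 => l _; rewrite lee_fin powR_ge0.
  rewrite EFinM; congr (_ * _)%E.
  rewrite ge0_integral_sum//; last first.
  - by move=> l; apply/measurable_EFinP; exact: mfl.
  under eq_bigr do rewrite Il.
  by rewrite sumEFin sumr_const card_ord mulr_natl.
have bS0 : 0 <= beta * S by rewrite mulr_ge0// ltW.
have X0 : 0 <= A `^ p * (beta * S) by rewrite mulr_ge0 ?powR_ge0.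
have K0 : 0 <= k.+1%:R * 2 ^+ k :> R by rewrite mulr_ge0 ?exprn_ge0.
apply: (@le_trans _ _ (((k.+1%:R * 2 ^+ k) `^ p *
    (k.+1%:R * (A `^ p * (beta * S)))) `^ p^-1)%:E); last first.
  rewrite lee_fin powRM; [|exact: powR_ge0|exact: mulr_ge0].
  rewrite -(powRrM (k.+1%:R * 2 ^+ k)) mulfV ?gt_eqF// powRr1//.
  rewrite (@powRM _ k.+1%:R); [|by []|exact: X0].
  rewrite (@powRM _ (A `^ p)); [|exact: powR_ge0|exact: bS0].
  rewrite (@powRM _ beta); [|exact: ltW|exact: S0].
  rewrite -(powRrM A) mulfV ?gt_eqF// powRr1//.
  set s := S `^ p^-1; set bb := beta `^ p^-1.
  have -> : A * (k.+1%:R ^+ 2 * 2 ^+ k * bb) * s =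
    k.+1%:R * 2 ^+ k * (k.+1%:R * (A * (bb * s))) by ring.
  rewrite ler_wpM2l// ler_wpM2r//.
    by rewrite mulr_ge0// mulr_ge0 ?powR_ge0.
  apply: ler1_powR; first by rewrite ler1n.
  by rewrite invf_le1.
apply: (@norm01_le _ _ _ _ h) => //.
- by rewrite mulr_ge0 ?powR_ge0// mulr_ge0.
- exact: measurable_sym_diff.
- by apply: measurable_funM => //; apply: measurable_sum => l; exact: mfl.
- by move=> x; rewrite mulr_ge0 ?powR_ge0// sumr_ge0// => l _; exact: powR_ge0.
- move=> x _; rewrite /sym_diff; case: ifPn => _; last first.
    rewrite normr0 powR0 ?gt_eqF//; apply: mulr_ge0; first exact: powR_ge0.
    by apply: sumr_ge0 => l _; exact: powR_ge0.
  apply: (le_trans (norm_sum_powR _ p0)).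
  rewrite /h powRM ?exprn_ge0// -mulrA ler_wpM2l ?powR_ge0//.
  rewrite mulr_sumr; apply: ler_sum => l _.
  rewrite -powRM ?exprn_ge0// ge0_ler_powR ?nnegrE ?(ltW p0) ?mulr_ge0 ?exprn_ge0//.
  rewrite !normrM normrX normrN1 expr1n mul1r ler_wpM2r// normr_nat.
  rewrite -natrX ler_nat -[X in (_ <= X ^ _)%N]/(1 + 1)%N expnDn (bigD1 l)//=.
  by rewrite !exp1n !muln1 leq_addr.
- by rewrite Ih.
Qed.

(** For steps that are small with respect to the cells, the differences of
    distinct bumps do not overlap and the smoothness of one bump suffices. For
    larger steps [u] the triangle inequality suffices, as [u `^ (- s)] is then
    at most [(2 * k * m) `^ s]. *)
Lemma besov_bump_sum (s : R) : (Num.truncn s).+1 = k -> 0 < s ->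
  (besov_norm s p f <=
   (A * m%:R `^ s * ((C + (2 * k%:R) `^ s * (k.+1%:R ^+ 2 * 2 ^+ k * beta `^ p^-1))
     + beta `^ p^-1) * S `^ p^-1)%:E)%E.
Proof.
move=> sk s0.
set bb := beta `^ p^-1; set T := S `^ p^-1.
have bb0 : 0 <= bb by exact: powR_ge0.
have T0 : 0 <= T by exact: powR_ge0.
have ms1 : 1 <= m%:R `^ s.
  have := @ge0_ler_powR R s (ltW s0) 1 m%:R; rewrite powR1; apply; rewrite ?nnegrE//.
  by rewrite ler1n.
pose Q := k.+1%:R ^+ 2 * 2 ^+ k * bb.
have Q0 : 0 <= Q by rewrite mulr_ge0// mulr_ge0 ?exprn_ge0.
pose E := (2 * k%:R) `^ s * Q.
have E0 : 0 <= E by rewrite mulr_ge0 ?powR_ge0.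
pose B := A * m%:R `^ s * (C + E) * T.
have B0 : 0 <= B by rewrite !mulr_ge0 ?powR_ge0// addr_ge0// ltW.
have step u : 0 < u -> (norm01 p (sym_diff k u f) <= (B * u `^ s)%:E)%E.
  move=> u0; have mu0 : 0 < m%:R * u by exact: mulr_gt0.
  have kR : 1 <= k%:R :> R by rewrite ler1n.
  have Bs : B * u `^ s = A * (C + E) * (m%:R * u) `^ s * T.
    by rewrite /B powRM ?(ltW u0)//; ring.
  rewrite Bs; have [mku|mku] := leP (m%:R * k%:R * u) 2^-1.
    apply: (le_trans (small_step u0 mku)); rewrite lee_fin ler_wpM2r//.
    rewrite ler_pM ?mulr_ge0 ?exprn_ge0 ?(ltW C0) ?(ltW mu0)//.
      by rewrite ler_wpM2l// lerDl.
    rewrite -powR_mulrn ?(ltW mu0)//.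
    apply: ger_powR.
      rewrite mu0/=; have : m%:R * u <= m%:R * k%:R * u.
        by rewrite mulrAC ler_peMr// ltW.
      lra.
    by rewrite -sk; apply/ltW/truncnS_gt.
  apply: (le_trans (any_step u)); rewrite lee_fin ler_wpM2r// -/bb -/Q -mulrA.
  rewrite ler_wpM2l//.
  apply: (@le_trans _ _ (E * (m%:R * u) `^ s)); last first.
    by rewrite ler_wpM2r ?powR_ge0// lerDr ltW.
  rewrite /E mulrAC -powRM; [|by rewrite mulr_ge0|exact: ltW].
  rewrite ler_peMl//.
  have := @ge0_ler_powR R s (ltW s0) 1; rewrite powR1; apply; rewrite ?nnegrE//.
    by rewrite !mulr_ge0// ltW.
  have -> : 2 * k%:R * (m%:R * u) = 2 * (m%:R * k%:R * u) by ring.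
  lra.
rewrite /besov_norm sk.
have -> : A * m%:R `^ s * (C + (2 * k%:R) `^ s * (k.+1%:R ^+ 2 * 2 ^+ k * bb) + bb) * T
   = A * m%:R `^ s * bb * T + B by rewrite /B /E /Q; ring.
rewrite EFinD; apply: leeD.
  rewrite /f (bump_sum_norm cb b0 th A0 p0 beta0 hb m0) lee_fin ler_wpM2r//.
  by rewrite ler_wpM2r// ler_peMr.
apply: ge_ereal_sup => _ [t /= t0 <-].
have mod_le : (modulus k p f t <= (B * t `^ s)%:E)%E.
  apply: ge_ereal_sup => _ [u /= /andP[u0 ut] <-].
  apply: (le_trans (step u u0)); rewrite lee_fin ler_wpM2l//.
  by rewrite ge0_ler_powR ?nnegrE ?(ltW s0) ?(ltW t0) ?(ltW u0).
have tN : (0 <= (t `^ (- s))%:E)%E by rewrite lee_fin powR_ge0.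
apply: (le_trans (lee_wpmul2l tN mod_le)).
rewrite -EFinM lee_fin mulrCA -powRD; last by rewrite (gt_eqF t0) implybT.
by rewrite addNr powRr0 mulr1.
Qed.

End besov_bound.

(** * Drift of a bump *)
Section bump_drift.
Context {R : realType}.
Local Notation mu := (@lebesgue_measure R).

Lemma integrable_bounded_itv (f : R -> R) (M : R) (i : interval R) :
  measurable_fun [set: R] f -> (forall x, `|f x| <= M) ->
  (mu [set` i] < +oo)%E -> mu.-integrable [set` i] (EFin \o f).
Proof.
move=> mf fM mui; apply: measurable_bounded_integrable => //.
  exact: measurable_funTS.
exists M; split; first exact: num_real.
by move=> N MN x _; apply: (le_trans (fM x)); exact: ltW.
Qed.

Let mu_itv_lty (b0 b1 : bool) (x y : R) :
  (mu [set` Interval (BSide b0 x) (BSide b1 y)] < +oo)%E.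
Proof.
by rewrite lebesgue_measure_itv/=; case: ifPn => // _; rewrite -EFinB ltry.
Qed.

Variables (b : R -> R) (C : R).
Hypotheses (C0 : 0 < C) (cb : continuous b)
  (b0 : forall y, ~~ (4^-1 < y < 3 / 4) -> b y = 0)
  (bC : forall y, `|b y| <= C).
Variables (A : R) (m : nat).
Hypotheses (A0 : 0 <= A) (m0 : (0 < m)%N).

Definition mean_path (f : R -> R) (t : R) : R :=
  \int[mu]_(y in `[0, t]) f y.

Definition cell_bump (j : nat) (y : R) : R := A * b (m%:R * y - j%:R).

Let mb : measurable_fun [set: R] b.
Proof. exact: continuous_measurable_fun. Qed.

Let m0R : 0 < m%:R :> R. Proof. by rewrite ltr0n. Qed.

Lemma bump_sum_insert (th th' : seq R) (x y : R) :
  (size th + size th').+1 = m ->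
  bump_sum b A m (th ++ x :: th') y =
  bump_sum b A m (th ++ 0 :: th') y + x * cell_bump (size th) y.
Proof.
move=> sm; have jm : (size th < m)%N by lia.
rewrite /bump_sum (bigD1 (Ordinal jm))//= [in RHS](bigD1 (Ordinal jm))//=.
rewrite !nth_cat ltnn subnn/= mul0r add0r /cell_bump.
rewrite (eq_bigr (fun j : 'I_m => (th ++ 0 :: th')`_j * b (m%:R * y - j%:R))).
  by ring.
move=> j jn; congr (_ * _); rewrite !nth_cat; case: ltnP => // thj.
have : (0 < j - size th)%N.
  by rewrite subn_gt0 ltn_neqAle thj andbT eq_sym; exact: jn.
by case: (j - size th)%N.
Qed.

Lemma bump_sum_bounded (th : seq R) y :
  `|bump_sum b A m th y| <= A * \sum_(j < m) (`|th`_j| * C).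
Proof.
rewrite normrM (ger0_norm A0) ler_wpM2l//.
apply: (le_trans (ler_norm_sum _ _ _)); apply: ler_sum => j _.
by rewrite normrM ler_wpM2l.
Qed.

Let mcell j : measurable_fun [set: R] (cell_bump j).
Proof.
apply: measurable_funM => //; apply: (measurableT_comp mb).
by apply: measurable_funB => //; exact: measurable_funM.
Qed.

Let cell_bump_le j y : `|cell_bump j y| <= A * C.
Proof. by rewrite normrM (ger0_norm A0) ler_wpM2l. Qed.

Lemma mean_path_insert (th th' : seq R) (x t : R) :
  (size th + size th').+1 = m ->
  mean_path (bump_sum b A m (th ++ x :: th')) t =
  mean_path (bump_sum b A m (th ++ 0 :: th')) t +
  x * mean_path (cell_bump (size th)) t.
Proof.
move=> sm; rewrite /mean_path.
have ic : mu.-integrable `[0, t]%classic (EFin \o cell_bump (size th)).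
  by apply: (integrable_bounded_itv _ (cell_bump_le (size th))).
have icx : mu.-integrable `[0, t]%classic
    (EFin \o (fun y => x * cell_bump (size th) y)).
  by apply: eq_integrable (integrableZl _ x ic).
have ib : mu.-integrable `[0, t]%classic (EFin \o bump_sum b A m (th ++ 0 :: th')).
  apply: (integrable_bounded_itv _ (bump_sum_bounded (th ++ 0 :: th'))) => //.
  exact: measurable_bump_sum.
rewrite -RintegralZl// -RintegralD//.
by apply: eq_Rintegral => y _; rewrite bump_sum_insert.
Qed.

Let cell (j : nat) (y : R) : R := \1_(`[0, 1]%classic : set R) (m%:R * y - j%:R).

Let mcelli j : measurable_fun [set: R] (cell j).
Proof.
have mi : measurable_fun [set: R] (\1_(`[0, 1]%classic : set R) : R -> R).
  exact: measurable_indic.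
have mh : measurable_fun [set: R] (fun x : R => m%:R * x - j%:R).
  by apply: measurable_funB => //; exact: measurable_funM.
exact: (measurableT_comp mi mh).
Qed.

Let cell01 j y : 0 <= cell j y <= 1.
Proof. by rewrite /cell indicE; case: (_ \in _); rewrite ?lexx ?ler01. Qed.

Let icell j (i : interval R) : (mu [set` i] < +oo)%E ->
  mu.-integrable [set` i] (EFin \o cell j).
Proof.
move=> h; apply: (integrable_bounded_itv (M := 1)) => // y.
by have /andP[c0 c1] := cell01 j y; rewrite ger0_norm.
Qed.

Let occupation (j : nat) (t : R) : R := mean_path (cell j) t.

Let occupation1 j : occupation j 1 <= m%:R^-1.
Proof.
rewrite /occupation /mean_path -lee_fin fineK; last first.
  by apply: integrable_fin_num => //; apply: icell; exact: mu_itv_lty.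
apply: (@le_trans _ _ (\int[mu]_y (cell j y)%:E)%E).
  apply: ge0_subset_integral => //.
    by apply/measurable_EFinP; exact: mcelli.
  by move=> y _; rewrite lee_fin; have /andP[] := cell01 j y.
rewrite /cell; under eq_integral do rewrite [_ - j%:R]addrC.
rewrite (@ge0_integral_affine _ (- j%:R) m%:R
  (fun x => (\1_(`[0, 1]%classic : set R) x)%:E))//.
  by rewrite integral_indic//= setIT lebesgue_measure_itv/= lte01 -EFinB subr0 mule1.
by apply/measurable_EFinP; exact: measurable_indic.
Qed.

Let mean_path_sub (f : R -> R) (M : R) (s t : R) :
  measurable_fun [set: R] f -> (forall y, `|f y| <= M) -> 0 <= s -> s < t ->
  mean_path f t - mean_path f s = \int[mu]_(y in `]s, t]) f y.
Proof.
move=> mf fM s0 st; rewrite /mean_path Rintegral_itvB ?bnd_simp//.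
- by apply: (integrable_bounded_itv mf fM); exact: mu_itv_lty.
- exact: ltW.
Qed.

Let drift_step j s t : 0 <= s -> s < t ->
  (mean_path (cell_bump j) t - mean_path (cell_bump j) s) ^+ 2 / (t - s) <=
  (A * C) ^+ 2 * (occupation j t - occupation j s).
Proof.
move=> s0 st; have ts0 : 0 < t - s by rewrite subr_gt0.
have AC0 : 0 <= A * C by rewrite mulr_ge0// ltW.
rewrite (mean_path_sub (mcell j) (cell_bump_le j))//.
have cM y : `|cell j y| <= 1.
  by have /andP[c0 c1] := cell01 j y; rewrite ger0_norm.
rewrite /occupation (mean_path_sub (mcelli j) cM)//.
set I := \int[mu]_(y in _) cell_bump j y; set J := \int[mu]_(y in _) cell j y.
have ic := integrable_bounded_itv (mcell j) (cell_bump_le j)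
  (mu_itv_lty false false s t).
have ii := icell j (mu_itv_lty false false s t).
have J0 : 0 <= J by apply: Rintegral_ge0 => y _; have /andP[] := cell01 j y.
have J1 : J <= t - s.
  have -> : t - s = \int[mu]_(y in `]s, t]) (cst 1) y.
    by rewrite Rintegral_cst//= lebesgue_measure_itv/= lte_fin st -EFinB/= mul1r.
  apply: le_Rintegral => //; last by move=> y _; have /andP[] := cell01 j y.
  apply: (integrable_bounded_itv (M := 1)); last exact: (mu_itv_lty false false).
    exact: measurable_cst.
  by move=> y; rewrite /cst normr1.
have IJ : `|I| <= A * C * J.
  rewrite /J -RintegralZl//; apply: (le_trans (le_normr_Rintegral _ ic)) => //.
  apply: le_Rintegral => //.
  - exact: integrable_norm ic.
  - by apply: eq_integrable (integrableZl _ (A * C) ii).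
  - move=> y _; rewrite /cell_bump normrM (ger0_norm A0) -mulrA ler_wpM2l//.
    have [yc|nyc] := boolP (4^-1 < m%:R * y - j%:R < 3 / 4).
      rewrite /cell indicE mem_set ?mulr1//= in_itv/=.
      by case/andP: yc => ? ?; apply/andP; split; lra.
    by rewrite b0// normr0 mulr_ge0 ?(ltW C0)//; have /andP[] := cell01 j y.
rewrite ler_pdivrMr// -mulrA -[leLHS](real_normK (num_real I)).
apply: (@le_trans _ _ ((A * C * J) ^+ 2)).
  by rewrite lerXn2r ?nnegrE// mulr_ge0.
by rewrite exprMn ler_wpM2l ?sqr_ge0// expr2 ler_wpM2l.
Qed.

(** The energy of the drift seen on a grid is controlled by the time spent in
    the cell, so that it does not depend on the grid. *)
Lemma cell_drift_energy (j : nat) (c : R) (k : nat) (t : nat -> R) : 0 < c ->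
  t 0%N = 0 -> t k <= 1 -> (forall i, (i < k)%N -> t i < t i.+1) ->
  \sum_(i < k) ((mean_path (cell_bump j) (t i.+1) -
     mean_path (cell_bump j) (t i)) / c) ^+ 2 / (t i.+1 - t i) <=
  (A * C / c) ^+ 2 / m%:R.
Proof.
move=> c0 t0 tk tS.
have t_ge0 i : (i <= k)%N -> 0 <= t i.
  elim: i => [|i IH] ik; first by rewrite t0.
  by apply: (le_trans (IH (ltnW ik))); exact/ltW/tS.
have occ_mono s u : 0 <= s -> s <= u -> occupation j s <= occupation j u.
  move=> s0; rewrite le_eqVlt => /orP[/eqP->//|su].
  have cM y : `|cell j y| <= 1.
    by have /andP[c0' c1] := cell01 j y; rewrite ger0_norm.
  rewrite -subr_ge0 /occupation (mean_path_sub (mcelli j) cM)//.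
  by apply: Rintegral_ge0 => y _; have /andP[] := cell01 j y.
have occ0 : 0 <= occupation j 0.
  by apply: Rintegral_ge0 => y _; have /andP[] := cell01 j y.
apply: (@le_trans _ _ (\sum_(i < k)
    (A * C / c) ^+ 2 * (occupation j (t i.+1) - occupation j (t i)))).
  apply: ler_sum => i _.
  have := drift_step j (t_ge0 i (ltnW (ltn_ord i))) (tS i (ltn_ord i)).
  set dPhi := _ - _; set docc := occupation j _ - _ => h.
  rewrite !expr_div_n mulrAC [leRHS]mulrAC.
  by rewrite ler_wpM2r// invr_ge0 sqr_ge0.
rewrite -mulr_sumr ler_wpM2l ?sqr_ge0//.
rewrite -(big_mkord xpredT (fun i => occupation j (t i.+1) - occupation j (t i))).
rewrite telescope_sumr// t0.
have h1 := occ_mono _ _ (t_ge0 k (leqnn k)) tk.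
have h2 := occupation1 j.
by lra.
Qed.

Lemma mean_path0 (f : R -> R) : mean_path f 0 = 0.
Proof. by rewrite /mean_path set_itv1 Rintegral_set1. Qed.

End bump_drift.

(** * Two laws for the amplitudes *)
Section prior_pair.
Context {R : realType}.

Lemma powR_le_even (x p : R) (q : nat) : 0 <= x -> 0 <= p -> p <= q.*2%:R ->
  x `^ p <= 1 + x ^+ q.*2.
Proof.
move=> x0 p0 pq; have [x1|x1] := leP x 1.
  have : x `^ p <= 1.
    by have := @ge0_ler_powR R p p0 x 1; rewrite powR1; apply; rewrite ?nnegrE.
  by have := exprn_ge0 q.*2 x0; lra.
rewrite -powR_mulrn//.
have : x `^ p <= x `^ q.*2%:R by apply: ler_powR => //; exact: ltW.
lra.
Qed.

(** The positive and negative parts of a signed measure that annihilates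
    polynomials of low degree: they have equal masses, and dividing by their
    common mass, which is bounded above and below, preserves the estimates. *)
Lemma prior_pair (r : R) (q : nat) : 0 < r ->
  (forall k : nat, r != 2 * k%:R) -> r <= q.*2%:R ->
  exists2 c : R, 0 < c & exists2 C : R, 0 < C & forall N, (0 < N)%N ->
  exists I : finType, exists pt : I -> R, exists mu : bool -> I -> R,
  [/\ forall b, prob_weights (mu b),
      forall i, `|pt i| <= N%:R,
      forall k, (k < N.*2)%N -> \sum_i (mu true i - mu false i) * pt i ^+ k = 0,
      forall b, \sum_i mu b i * `|pt i| ^+ q.*2 <= C &
      c <= \sum_i (mu true i - mu false i) * `|pt i| `^ r].
Proof.
move=> r0 rk rq; have [c c0 [C C0 mm]] := moment_matching r0 rk rq.
exists (2 * c / C); first by rewrite divr_gt0// mulr_gt0.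
exists (2 * C); first by rewrite mulr_gt0.
move=> N N0; have [I [pt [w [ptN wk wC w1 wr]]]] := mm N N0.
set W := \sum_i `|w i| in w1.
have W0 : 0 < W by lra.
have WC : W <= C.
  have := wC 0%N isT; rewrite double0.
  by under eq_bigr do rewrite expr0 mulr1.
pose mu (b : bool) i := (`|w i| - (-1) ^+ b * w i) / W.
have muE i : mu true i - mu false i = 2 / W * w i.
  by rewrite /mu expr1 expr0; field; rewrite gt_eqF.
have wi i (b : bool) : `|(-1) ^+ b * w i| = `|w i|.
  by rewrite normrM normrX normrN1 expr1n mul1r.
have mu0 b i : 0 <= mu b i.
  rewrite /mu divr_ge0 ?(ltW W0)// subr_ge0 -(wi i b); exact: ler_norm.
have muw b i : mu b i <= 2 * `|w i|.
  rewrite /mu ler_pdivrMr//.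
  have : - ((-1) ^+ b * w i) <= `|w i| by rewrite -(wi i b) -normrN ler_norm.
  have : `|w i| <= `|w i| * W by rewrite ler_peMr.
  lra.
exists I, pt, mu; split => //.
- move=> b; split; first exact: mu0.
  rewrite /mu -mulr_suml sumrB -/W -mulr_sumr.
  have : \sum_i w i = 0.
    have := wk 0%N; under eq_bigr do rewrite expr0 mulr1.
    by apply; rewrite double_gt0.
  by move=> ->; rewrite mulr0 subr0 divff// gt_eqF.
- move=> k kN; under eq_bigr do rewrite muE -[_ * w _ * _]mulrA.
  by rewrite -mulr_sumr wk// mulr0.
- move=> b; apply: (@le_trans _ _ (2 * \sum_i `|w i| * `|pt i| ^+ q.*2)).
    by rewrite mulr_sumr ler_sum// => i _; rewrite mulrA ler_wpM2r ?exprn_ge0.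
  by rewrite ler_pM2l// wC.
- under eq_bigr do rewrite muE -[_ * w _ * _]mulrA.
  rewrite -mulr_sumr mulrAC ler_pM ?divr_ge0 ?(ltW c0) ?(ltW C0)//.
  by rewrite ler_pM2l// lef_pV2 ?posrE.
Qed.

End prior_pair.

(** * Reduction to two priors *)
Section two_priors.
Context {d : measure_display} {Omega : measurableType d} {R : realType}.
Variables (P : probability Omega R) (B : R -> {RV P >-> R}).
Variables (sigma : R) (n : nat) (r : R).

Lemma observationE f : observation B sigma n f =
  drifted_path B (sigma / Num.sqrt n%:R) (fun=> 0) (mean_path f) 0.
Proof.
apply/funext => o; apply/funext => u.
by rewrite /observation /drifted_path mulr0 addr0.
Qed.

Lemma measurable_observation f :
  measurable_fun [set: Omega]
    (observation B sigma n f : Omega -> g_sigma_algebraType (@cylinders R)).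
Proof. by rewrite observationE; exact: measurable_drifted_path. Qed.

Lemma sq_risk_ge (T : (R -> R) -> R) f (A : set Omega) (D : R) :
  estimators T -> measurable A ->
  (forall o, A o ->
     D ^+ 2 <= (T (observation B sigma n f o) - fine (norm01 r f)) ^+ 2) ->
  ((D ^+ 2)%:E * P A <= sq_risk B sigma n r T f)%E.
Proof.
move=> mT mA DA; rewrite /sq_risk unlock.
rewrite -integral_cst// integral_mkcond.
have mTo : measurable_fun [set: Omega] (fun o => T (observation B sigma n f o)).
  exact: (measurableT_comp mT (measurable_observation f)).
apply: ge0_le_integral => //.
- by move=> o _; rewrite patchE; case: ifP; rewrite ?lee_fin ?sqr_ge0.
- by move/measurable_restrictT: (measurable_cst (D ^+ 2)%:E : measurable_fun A _); exact.
- apply/measurable_EFinP; apply: measurable_funX; exact: measurable_funB.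
- move=> o _; rewrite patchE; case: ifPn => [|_].
    by rewrite inE => /DA; rewrite lee_fin.
  by rewrite lee_fin sqr_ge0.
Qed.

(** If the laws of the observations under two product priors are close and the
    priors concentrate on values of the norm at distance [2 * D], then an
    estimator errs by at least [D] with fair probability: the event that the
    estimator exceeds the midpoint would otherwise be rare under the first
    prior and frequent under the second. The functions [bad b] dominate the
    indicators of the exceptional draws, so that bounding their means replaces a
    bound on the probability of those draws. *)
Lemma two_prior_risk (F : set (R -> R)) (I : finType) (mu : bool -> I -> R)
    (m : nat) (f : seq I -> R -> R) (bad : bool -> seq I -> R) (a D dlt : R) :
  0 < D -> (forall b, prob_weights (mu b)) ->
  (forall b th, size th = m -> 0 <= bad b th) ->
  (forall b, iid_mean (mu b) m (bad b) <= 1 / 4) ->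
  (forall th, size th = m -> bad false th < 1 ->
     F (f th) /\ fine (norm01 r (f th)) <= a) ->
  (forall th, size th = m -> bad true th < 1 ->
     F (f th) /\ a + 2 * D <= fine (norm01 r (f th))) ->
  (forall S, <<s @cylinders R >> S -> forall th th',
     (size th + size th').+1 = m ->
     `|\sum_x (mu true x - mu false x) *
         fine (P (observation B sigma n (f (th ++ x :: th')) @^-1` S))| <= dlt) ->
  m%:R * dlt <= 1 / 8 ->
  ((D ^+ 2 / 8)%:E <= minimax_risk B sigma n r F)%E.
Proof.
move=> D0 pmu bad0 badm bf bt close mdlt.
apply: le_ereal_inf_tmp => _ [T mT <-].
rewrite leNgt; apply/negP => risk.
have riskF g : F g -> (sq_risk B sigma n r T g < (D ^+ 2 / 8)%:E)%E.
  by move=> Fg; apply: le_lt_trans risk; apply: ereal_sup_ubound; exists g.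
pose S := T @^-1` `]a + D, +oo[.
have mS : <<s @cylinders R >> S.
  have := mT measurableT _ (measurable_itv `]a + D, +oo[).
  by rewrite setTI.
have mA g : measurable (observation B sigma n g @^-1` S).
  rewrite -[X in measurable X]setTI.
  exact: (measurable_observation g measurableT mS).
have DD : 0 < D ^+ 2 by rewrite exprn_gt0.
pose p th := fine (P (observation B sigma n (f th) @^-1` S)).
have pE th : P (observation B sigma n (f th) @^-1` S) = (p th)%:E.
  by rewrite /p fineK// fin_num_measure.
have p0 th : 0 <= p th by rewrite /p fine_ge0.
have p1 th : p th <= 1 by rewrite -lee_fin -pE; exact: probability_le1.
have small th : size th = m -> p th <= 1 / 8 + bad false th.
  move=> sth; have [b1|b1] := leP 1 (bad false th).
    by have := p1 th; lra.
  have [Fth nth] := bf th sth b1.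
  suff : p th < 1 / 8 by have := bad0 false th sth; lra.
  suff : ((D ^+ 2)%:E * (p th)%:E < (D ^+ 2 / 8)%:E)%E.
    by rewrite -EFinM lte_fin ltr_pM2l// div1r.
  apply: le_lt_trans (riskF _ Fth); rewrite -pE; apply: sq_risk_ge => // o.
  rewrite /S/= in_itv/= andbT => h1.
  by rewrite ler_sqr ?nnegrE; lra.
have large th : size th = m -> 7 / 8 - bad true th <= p th.
  move=> sth; have [b1|b1] := leP 1 (bad true th).
    by have := p0 th; lra.
  have [Fth nth] := bt th sth b1.
  suff : 1 - p th < 1 / 8 by have := bad0 true th sth; lra.
  suff : ((D ^+ 2)%:E * (1 - p th)%:E < (D ^+ 2 / 8)%:E)%E.
    by rewrite -EFinM lte_fin ltr_pM2l// div1r.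
  apply: le_lt_trans (riskF _ Fth).
  rewrite EFinB -pE -probability_setC//.
  apply: sq_risk_ge => //; first exact: measurableC.
  move=> o; rewrite /S/= in_itv/= andbT => /negP; rewrite -leNgt => h1.
  by rewrite -[leRHS]sqrrN ler_sqr ?nnegrE; lra.
have h0 : iid_mean (mu false) m p <= 1 / 8 + 1 / 4.
  apply: le_trans (le_iid_mean (pmu false) small) _.
  by rewrite iid_meanD iid_mean_cst// lerD2l.
have h1 : 7 / 8 - 1 / 4 <= iid_mean (mu true) m p.
  apply: le_trans (le_iid_mean (pmu true) large).
  under eq_iid_mean do rewrite -mulN1r.
  rewrite iid_meanD iid_mean_cst// iid_meanZ; have := badm true; lra.
have := @iid_mean_swap _ _ _ _ m p dlt (pmu true) (pmu false) (close S mS).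
by move=> /(le_trans (ler_norm _)); lra.
Qed.

End two_priors.

(** * Properties of the priors *)
Section prior_closeness.
Context {d : measure_display} {Omega : measurableType d} {R : realType}.
Variables (P : probability Omega R) (B : R -> {RV P >-> R}).
Hypothesis BB : brownian01 B.
Variables (b : R -> R) (C : R).
Hypotheses (C0 : 0 < C) (cb : continuous b)
  (b0 : forall y, ~~ (4^-1 < y < 3 / 4) -> b y = 0)
  (bC : forall y, `|b y| <= C).
Variables (sigma : R) (n : nat).
Hypotheses (sigma0 : 0 < sigma) (n0 : (0 < n)%N).
Variables (I : finType) (pt : I -> R) (mu : bool -> I -> R) (N : nat).
Hypotheses (pmu : forall c, prob_weights (mu c))
  (ptN : forall i, `|pt i| <= N%:R)
  (mom : forall k, (k < N.*2)%N ->
     \sum_i (mu true i - mu false i) * pt i ^+ k = 0).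

(** The bump on one cell is seen through a one-dimensional Gaussian shift of
    energy [(A * C * sqrt n / sigma) ^+ 2 / m], too weak to tell apart two
    amplitude laws that share their first [2 * N] moments. *)
Lemma swap_cell_le (A : R) (m : nat) S th th' : 0 <= A -> (0 < m)%N ->
  expR 2 * ((A * C * Num.sqrt n%:R / sigma) ^+ 2 / m%:R * N%:R ^+ 2) <= N.*2%:R ->
  <<s @cylinders R >> S -> (size th + size th').+1 = m ->
  `|\sum_x (mu true x - mu false x) * fine (P (observation B sigma n
       (bump_sum b A m [seq pt i | i <- th ++ x :: th']) @^-1` S))| <=
  2 * expR (- N%:R).
Proof.
move=> A0 m0 lamN cS sm.
pose c := sigma / Num.sqrt n%:R.
have sn0 : 0 < Num.sqrt n%:R :> R by rewrite sqrtr_gt0 ltr0n.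
have c0 : 0 < c by rewrite divr_gt0.
pose G := mean_path (bump_sum b A m (map pt th ++ 0 :: map pt th')).
pose Phi := mean_path (cell_bump b A m (size th)).
have obsE x : observation B sigma n
    (bump_sum b A m [seq pt i | i <- th ++ x :: th']) =
    drifted_path B c Phi G (pt x).
  apply/funext => o; apply/funext => u.
  rewrite /observation /drifted_path -/(mean_path _ _) map_cat/=.
  rewrite (mean_path_insert C0 cb bC A0 m0) ?size_map//.
under eq_bigr do rewrite obsE.
pose lam := (A * C * Num.sqrt n%:R / sigma) ^+ 2 / m%:R.
have lamE : lam = (A * C / c) ^+ 2 / m%:R.
  by rewrite /lam /c invf_div -!mulrA.
apply: (@cylinder_mixture_le _ _ _ P B BB c c0 Phi (mean_path0 _) lam) => //.
  move=> k t t0 tk tS; rewrite lamE.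
  exact: (cell_drift_energy C0 cb b0 bC).
move=> l /andP[l0 llam].
apply: (le_trans (moment_exp_le ptN mom l0 _)).
  apply: le_trans lamN; rewrite ler_pM2l ?expR_gt0//.
  by rewrite ler_wpM2r ?exprn_ge0.
have W2 : \sum_a `|mu true a - mu false a| <= 2.
  apply: (@le_trans _ _ (\sum_a (mu true a + mu false a))).
    apply: ler_sum => a _; apply: (le_trans (ler_normB _ _)).
    by have [[h _] [h' _]] := (pmu true, pmu false); rewrite !ger0_norm.
  by rewrite big_split/=; have [[_ ->] [_ ->]] := (pmu true, pmu false); lra.
rewrite exprMn -expRM_natl mulrN -natrM mul2n ler_pM2r ?expR_gt0//.
by rewrite ler_pXn2r ?nnegrE// sumr_ge0.
Qed.

End prior_closeness.

Section prior_concentration.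
Context {R : realType} {I : finType}.
Variables (mu g h : I -> R) (m : nat) (v C1 tau : R).

(** The normalizations are such that [atypical th >= 1] as soon as the average of
    [g] is off by [tau] or that of [h] reaches [8 * C1]. *)
Definition atypical (th : seq I) : R :=
  (m%:R^-1 * \sum_(a <- th) g a - v) ^+ 2 / tau ^+ 2 +
  m%:R^-1 * (\sum_(a <- th) h a) / (8 * C1).

Hypotheses (pmu : prob_weights mu) (h0 : forall a, 0 <= h a) (m0 : (0 < m)%N)
  (vE : v = \sum_a mu a * g a) (C10 : 0 < C1) (tau0 : 0 < tau)
  (g2 : \sum_a mu a * g a ^+ 2 <= C1) (h1 : \sum_a mu a * h a <= C1)
  (mtau : 8 * C1 <= m%:R * tau ^+ 2).

Let m0R : 0 < m%:R :> R. Proof. by rewrite ltr0n. Qed.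

Lemma atypical_ge0 th : 0 <= atypical th.
Proof.
rewrite /atypical addr_ge0// divr_ge0 ?sqr_ge0 ?mulr_ge0 ?invr_ge0 ?(ltW C10)//.
exact: sumr_ge0.
Qed.

(** Chebyshev's and Markov's inequalities, for the averages of [g] and [h]. *)
Lemma iid_mean_atypical : iid_mean mu m atypical <= 1 / 4.
Proof.
pose Z th := (\sum_(a <- th) g a - m%:R * v) ^+ 2.
have aE th : atypical th = ((m%:R * tau) ^+ 2)^-1 * Z th +
    (m%:R * (8 * C1))^-1 * \sum_(a <- th) h a.
  by rewrite /atypical /Z; field; rewrite !gt_eqF.
under eq_iid_mean do rewrite aE.
rewrite iid_meanD !iid_meanZ iid_mean_additive//.
have -> : 1 / 4 = 8^-1 + 8^-1 :> R by lra.
apply: lerD.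
  have := iid_mean_variance m g pmu; rewrite -vE => hZ.
  rewrite mulrC ler_pdivrMr ?exprn_gt0 ?mulr_gt0//.
  apply: (le_trans hZ); apply: (@le_trans _ _ (m%:R * C1)).
    by rewrite ler_pM2l.
  have -> : 8^-1 * (m%:R * tau) ^+ 2 = m%:R * ((m%:R * tau ^+ 2) / 8) by ring.
  by rewrite ler_pM2l// ler_pdivlMr// mulrC.
rewrite mulrC ler_pdivrMr ?mulr_gt0//.
have -> : 8^-1 * (m%:R * (8 * C1)) = m%:R * C1 by field.
by rewrite ler_pM2l.
Qed.

Lemma typical_averages th : atypical th < 1 ->
  `|m%:R^-1 * (\sum_(a <- th) g a) - v| < tau /\
  m%:R^-1 * (\sum_(a <- th) h a) < 8 * C1.
Proof.
rewrite /atypical; set x := _ - v; set y := m%:R^-1 * \sum_(a <- th) h a.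
have x0 : 0 <= x ^+ 2 / tau ^+ 2 by rewrite divr_ge0 ?sqr_ge0.
have y0 : 0 <= y / (8 * C1).
  by rewrite divr_ge0 ?mulr_ge0 ?invr_ge0 ?(ltW C10)// sumr_ge0.
move=> xy; split.
  have : x ^+ 2 / tau ^+ 2 < 1 by lra.
  rewrite ltr_pdivrMr ?exprn_gt0// mul1r -real_normK ?num_real//.
  by rewrite ltr_pXn2r ?nnegrE// ltW.
have : y / (8 * C1) < 1 by lra.
by rewrite ltr_pdivrMr ?mulr_gt0// mul1r.
Qed.

End prior_concentration.

(** * Lower bound at a given resolution *)
Section scale_lower_bound.
Context {R : realType}.

(** A bound [x <= K] gives [x <= rho * (x + h)] with [rho < 1], and powers are
    multiplicative. *)
Lemma powR_gap (e h K : R) : 0 < e -> 0 < h -> 0 < K ->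
  exists2 g : R, 0 < g &
  forall x y, 0 <= x <= K -> x + h <= y -> x `^ e + g <= y `^ e.
Proof.
move=> e0 h0 K0; pose rho : R := K / (K + h).
have Kh : 0 < K + h by lra.
have rho0 : 0 < rho by rewrite divr_gt0.
have rho1 : rho < 1 by rewrite ltr_pdivrMr// mul1r; lra.
have rhoe : rho `^ e < 1.
  have := @gt0_ltr_powR R e e0 rho 1; rewrite powR1; apply; rewrite ?nnegrE//.
  exact: ltW.
exists (h `^ e * (1 - rho `^ e)).
  by rewrite mulr_gt0 ?powR_gt0// subr_gt0.
move=> x y /andP[x0 xK] xy.
have le_pow u z : 0 <= u -> u <= z -> u `^ e <= z `^ e.
  move=> u0 uz; apply: ge0_ler_powR; rewrite ?nnegrE//; first exact: ltW.
  exact: le_trans uz.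
have h1 : x `^ e <= rho `^ e * y `^ e.
  rewrite -powRM; [|exact: ltW|lra].
  apply: le_pow => //; apply: (@le_trans _ _ (rho * (x + h))); last by rewrite ler_pM2l.
  rewrite /rho mulrAC ler_pdivlMr//.
  have : x * h <= K * h by rewrite ler_pM2r.
  lra.
have h2 : h `^ e <= y `^ e by apply: le_pow; lra.
have h3 : h `^ e * (1 - rho `^ e) <= y `^ e * (1 - rho `^ e).
  by rewrite ler_wpM2r// subr_ge0 ltW.
lra.
Qed.

Lemma sum_nth_map (I : eqType) (pt : I -> R) (G : R -> R) (m : nat) (th : seq I) :
  size th = m -> \sum_(j < m) G [seq pt i | i <- th]`_j = \sum_(a <- th) G (pt a).
Proof.
move=> <-; rewrite -(big_map pt xpredT G) (big_nth 0) big_mkord size_map.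
by [].
Qed.

(** The lower bound at resolution [m]: one independent amplitude for each of [m]
    cells, scaled by [m `^ - s] to stay in the Besov ball. *)
Lemma scale_lower_bound (r p s L sigma : R) : 1 < r ->
  (forall k : nat, r != 2 * k%:R) -> r <= p -> 0 < s -> 0 < L -> 0 < sigma ->
  exists E c1 m0 : R, [/\ 0 < E, 0 < c1 & forall n m N : nat,
    (0 < n)%N -> (0 < m)%N -> (0 < N)%N -> m0 <= m%:R ->
    E * (n%:R * N%:R) <= 2 * m%:R `^ (2 * s + 1) ->
    m%:R * (2 * expR (- N%:R)) <= 1 / 8 :> R ->
    forall (d : measure_display) (Omega : measurableType d)
      (P : probability Omega R) (B : R -> {RV P >-> R}), brownian01 B ->
    (((c1 * m%:R `^ (- s)) ^+ 2)%:E
       <= minimax_risk B sigma n r (besov_ball s p L))%E].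
Proof.
move=> r1 rk rp s0 L0 sg0.
have r0 : 0 < r by lra.
have p1 : 1 <= p by lra.
have p0 : 0 < p by lra.
(* [2 * q] exceeds [r], [2 * r] and [p]. *)
pose q : nat := (Num.truncn (r + p)).+1.
have qrp : r + p < q%:R by apply: truncnS_gt.
have q2 : q.*2%:R = 2 * q%:R :> R by rewrite -muln2 natrM mulrC.
have rq : r <= q.*2%:R by rewrite q2; lra.
have r2q : r * 2 <= q.*2%:R by rewrite q2; lra.
have pq : p <= q.*2%:R by rewrite q2; lra.
have [c0 c00 [Cq Cq0 prior]] := prior_pair r0 rk rq.
(* [C1] bounds the absolute moments of the amplitudes of these three orders. *)
pose C1 : R := 1 + Cq.
have C10 : 0 < C1 by rewrite /C1; lra.
pose k := (Num.truncn s).+1.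
have [b [C C0 [cb b0 bC bD bpos]]] := @bump_exists R k isT.
have [br br0 hr] := bump_integral C0 cb b0 bC bpos r0.
have [bp bp0 hp] := bump_integral C0 cb b0 bC bpos p0.
pose Kb := C + (2 * k%:R) `^ s * (k.+1%:R ^+ 2 * 2 ^+ k * bp `^ p^-1) + bp `^ p^-1.
have Kb0 : 0 < Kb.
  rewrite /Kb -addrA ltr_pwDl// addr_ge0 ?powR_ge0// mulr_ge0 ?powR_ge0//.
  by rewrite mulr_ge0 ?powR_ge0// mulr_ge0// exprn_ge0.
pose C3 := (8 * C1) `^ p^-1.
have C30 : 0 < C3 by rewrite powR_gt0// mulr_gt0.
(* [Kb] is the constant of [besov_bump_sum], and [8 * C1] the threshold of
   [atypical] for the average of the powers of order [p]. *)
pose a0 := L / (Kb * C3).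
have a00 : 0 < a0 by rewrite divr_gt0// mulr_gt0.
(* A tolerance of [c0 / 4] on the two averages, whose means are at distance at
   least [c0], leaves a gap of [c0 / 2]. *)
have tau0 : 0 < c0 / 4 by lra.
have [g g0 gap] : exists2 g : R, 0 < g & forall x y,
    0 <= x <= C1 + c0 / 4 -> x + c0 / 2 <= y -> x `^ r^-1 + g <= y `^ r^-1.
  by apply: powR_gap; rewrite ?invr_gt0//; lra.
pose brr := br `^ r^-1.
have brr0 : 0 < brr by exact: powR_gt0.
pose c1 := a0 * brr * g / 2 / Num.sqrt 8.
have s80 : 0 < Num.sqrt 8 :> R by rewrite sqrtr_gt0; lra.
have c10 : 0 < c1.
  by apply: divr_gt0 => //; apply: divr_gt0 => //; apply: mulr_gt0 => //; exact: mulr_gt0.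
exists (expR 2 * (a0 * C / sigma) ^+ 2), c1, (8 * C1 / (c0 / 4) ^+ 2); split => //.
  by rewrite mulr_gt0 ?expR_gt0// exprn_gt0// divr_gt0// mulr_gt0.
move=> n m N n0 m0 N0 m0m EnN mdlt d Omega P B BB.
have m0R : 0 < m%:R :> R by rewrite ltr0n.
have N0R : 0 < N%:R :> R by rewrite ltr0n.
pose A := a0 * m%:R `^ (- s).
have A0 : 0 < A by rewrite mulr_gt0// powR_gt0.
pose u := m%:R `^ s.
have u0 : 0 < u by exact: powR_gt0.
have uN : m%:R `^ (- s) = u^-1 by rewrite powRN.
have AE : A * m%:R `^ s = a0 by rewrite /A uN divfK// gt_eqF.
have [I [pt [mu [pmu ptN mom muC mur]]]] := prior N N0.
have mean_le (e : R) c : 0 < e -> e <= q.*2%:R ->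
    \sum_i mu c i * `|pt i| `^ e <= C1.
  move=> e0 eq; have [mu0 mu1] := pmu c.
  apply: (@le_trans _ _ (\sum_i (mu c i + mu c i * `|pt i| ^+ q.*2))).
    apply: ler_sum => i _.
    rewrite -[X in X + _]mulr1 -mulrDr ler_wpM2l//.
    by apply: powR_le_even => //; exact: ltW.
  by rewrite big_split/= mu1 lerD2l.
pose v c := \sum_i mu c i * `|pt i| `^ r.
have v0 c : 0 <= v c.
  by apply: sumr_ge0 => i _; rewrite mulr_ge0 ?powR_ge0//; have [] := pmu c.
have vC c : v c <= C1 by exact: mean_le.
have vgap : v false + c0 <= v true.
  have : v true - v false = \sum_i (mu true i - mu false i) * `|pt i| `^ r.
    by rewrite -sumrB; apply: eq_bigr => i _; rewrite mulrBl.
  by move=> h; move: mur; rewrite -h; lra.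
pose f th := bump_sum b A m [seq pt i | i <- th].
pose alpha := v false + c0 / 4.
pose D := A * brr * g / 2.
have D0 : 0 < D.
  by apply: divr_gt0 => //; apply: mulr_gt0 => //; exact: mulr_gt0.
have -> : (c1 * m%:R `^ (- s)) ^+ 2 = D ^+ 2 / 8.
  rewrite /c1 /D /A -[X in _ = _ / X](@sqr_sqrtr _ 8)//.
  by field; rewrite gt_eqF.
pose bad c := atypical (fun i => `|pt i| `^ r) (fun i => `|pt i| `^ p) m (v c) C1
  (c0 / 4).
have ball c th : size th = m -> bad c th < 1 -> besov_ball s p L (f th).
  move=> sth /(typical_averages (fun a => powR_ge0 `|pt a| p) C10 tau0)[_ avp].
  split.
    rewrite /L01/= inE/=; apply/andP; split; rewrite inE/=.
      apply/(measurable_restrictT _ (@measurable_unit_itv R)).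
      by apply: measurable_funTS; exact: measurable_bump_sum.
    rewrite /finite_norm -/(norm01 p (f th)).
    by rewrite (bump_sum_norm cb b0 _ (ltW A0) p0 bp0 hp m0) ltry.
  have k0 : (0 < k)%N by [].
  apply: le_trans (besov_bump_sum k0 C0 cb b0 bD p1 bp0 hp _ (ltW A0) m0 erefl s0) _.
  rewrite lee_fin -/Kb (sum_nth_map _ (fun x => `|x| `^ p) sth).
  rewrite AE.
  have -> : L = a0 * Kb * C3 by rewrite -mulrA /a0 divfK// gt_eqF// mulr_gt0.
  rewrite ler_pM2l ?(mulr_gt0 a00 Kb0)//.
  apply: ge0_ler_powR; rewrite ?nnegrE ?invr_ge0 ?(ltW p0) ?mulr_ge0 ?(ltW C10)//.
    by apply: sumr_ge0 => a _; exact: powR_ge0.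
  exact: ltW.
have normE th : size th = m ->
    fine (norm01 r (f th)) = A * brr * (m%:R^-1 * \sum_(a <- th) `|pt a| `^ r) `^ r^-1.
  move=> sth; rewrite (bump_sum_norm cb b0 _ (ltW A0) r0 br0 hr m0)/=.
  by rewrite (sum_nth_map _ (fun x => `|x| `^ r) sth).
have avg0 th : 0 <= m%:R^-1 * \sum_(a <- th) `|pt a| `^ r.
  by rewrite mulr_ge0 ?invr_ge0// sumr_ge0// => a _; exact: powR_ge0.
have pow_le (x y : R) : 0 <= x -> x <= y -> x `^ r^-1 <= y `^ r^-1.
  move=> x0 xy; apply: ge0_ler_powR; rewrite ?nnegrE ?invr_ge0 ?(ltW r0)//.
  exact: le_trans xy.
apply: (@two_prior_risk _ _ _ P B sigma n r _ I mu m f bad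
  (A * brr * alpha `^ r^-1) D (2 * expR (- N%:R))) => //.
- move=> c th _; apply: atypical_ge0 => // a; exact: powR_ge0.
- move=> c; apply: iid_mean_atypical => //.
  + under eq_bigr do rewrite -powR_mulrn ?powR_ge0// -powRrM.
    by apply: mean_le => //; lra.
  + exact: mean_le.
  + by move: m0m; rewrite ler_pdivrMr// exprn_gt0.
- move=> th sth bth; split; first exact: ball bth.
  have [+ _] := typical_averages (fun a => powR_ge0 `|pt a| p) C10 tau0 bth.
  rewrite normE// ltr_distl => /andP[_ av].
  by rewrite ler_pM2l ?(mulr_gt0 A0 brr0)//; apply: pow_le => //; exact: ltW.
- move=> th sth bth; split; first exact: ball bth.
  have [+ _] := typical_averages (fun a => powR_ge0 `|pt a| p) C10 tau0 bth.
  rewrite normE// ltr_distl => /andP[av _].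
  have -> : A * brr * alpha `^ r^-1 + 2 * D = A * brr * (alpha `^ r^-1 + g).
    by rewrite /D; field.
  rewrite ler_pM2l ?(mulr_gt0 A0 brr0)//; apply: gap.
    by have := vC false; have := v0 false; rewrite /alpha; lra.
  by rewrite /alpha; lra.
- move=> S cS th th' sm; apply: (swap_cell_le BB C0 cb b0 bC) => //.
    exact: ltW.
  have -> : (A * C * Num.sqrt n%:R / sigma) ^+ 2 / m%:R * N%:R ^+ 2 =
      (a0 * C / sigma) ^+ 2 * (n%:R * N%:R) * (N%:R / (u ^+ 2 * m%:R)).
    rewrite -[in RHS](@sqr_sqrtr _ n%:R)// /A uN; field.
    by rewrite !gt_eqF.
  have um : m%:R `^ (2 * s + 1) = u ^+ 2 * m%:R.
    rewrite powRD ?(gt_eqF m0R) ?implybT// powRr1// mulrC [2 * s]mulrC powRrM.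
    by rewrite powR_mulrn ?powR_ge0// mulrC.
  have um0 : 0 < u ^+ 2 * m%:R by rewrite mulr_gt0// exprn_gt0.
  rewrite 2!mulrA [_ * (_ * (_ * _)^-1)]mulrA ler_pdivrMr// -muln2 natrM.
  have := ler_wpM2r (ltW N0R) EnN; rewrite um => h.
  by apply: (le_trans h); rewrite [leLHS]mulrAC [2 * _]mulrC.
Qed.

End scale_lower_bound.

(** * Choice of the resolution *)
Section resolution.
Context {R : realType}.

(** The number of cells is of order [(n * ln n) `^ (2 * s + 1)^-1] and the
    number of matched moments of order [ln n]: the energy of a bump is then
    small enough for the matched moments to hide it, while the errors, of order
    [expR (- N)] on each cell, remain negligible when added over the cells. *)
Lemma resolution_exists (s kappa m0 : R) : 0 < s -> 1 <= kappa ->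
  exists X : R, forall n : nat, X <= n%:R -> exists m N : nat,
    [/\ (0 < n)%N, (0 < m)%N, (0 < N)%N, m0 <= m%:R &
    [/\ 1 <= ln (n%:R : R), N%:R <= 4 * ln (n%:R : R),
        kappa * (n%:R * ln n%:R) <= m%:R `^ (2 * s + 1),
        m%:R * (2 * expR (- N%:R)) <= 1 / 8 :> R &
        2 `^ (- s) * (kappa * (n%:R * ln n%:R)) `^ (- (s / (2 * s + 1)))
          <= m%:R `^ (- s)]].
Proof.
move=> s0 k1; pose w := 2 * s + 1; have w0 : 0 < w by rewrite /w; lra.
pose M : R := Num.max m0 1.
have M1 : 1 <= M by rewrite /M le_max lexx orbT.
have mM : m0 <= M by rewrite /M le_max lexx.
have le_pow (e u z : R) : 0 <= e -> 0 <= u -> u <= z -> u `^ e <= z `^ e.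
  move=> e0 u0 uz; apply: ge0_ler_powR; rewrite ?nnegrE//.
  exact: le_trans uz.
(* The summands ensure [1 <= ln n], the bound [4 * kappa / n <= 1 / 8] on the
   total error, and [m0 <= m]. *)
exists (expR 1 + 32 * kappa + M `^ w) => n Xn.
have Mw0 : 0 <= M `^ w by exact: powR_ge0.
have e10 : 0 < expR 1 :> R by exact: expR_gt0.
have n0R : 0 < n%:R :> R by lra.
have n0 : (0 < n)%N by rewrite -(ltr0n R).
have [ln1 lnn] : 1 <= ln (n%:R : R) /\ ln (n%:R : R) <= n%:R.
  split; first by rewrite -[leLHS]expRK ler_ln ?posrE//; lra.
  have : ln (1 + (n%:R - 1)) <= n%:R - 1 :> R by apply: le_ln1Dx; lra.
  rewrite addrC subrK; lra.
set l := ln (n%:R : R) in ln1 lnn *.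
pose x := kappa * (n%:R * l).
have n1 : 1 <= n%:R :> R by rewrite ler1n.
have nl : n%:R <= n%:R * l :> R by rewrite ler_peMr// ltW.
have nx : n%:R <= x.
  by apply: (le_trans nl); rewrite /x ler_peMl//; lra.
have x1 : 1 <= x by lra.
pose y := x `^ w^-1.
have winv : 0 <= w^-1 by rewrite invr_ge0 ltW.
have y1 : 1 <= y.
  by have := le_pow _ 1 x winv ler01 x1; rewrite powR1.
have yx : y <= x.
  rewrite -[leRHS]powRr1; last lra.
  by apply: ler_powR => //; rewrite invf_le1// /w; lra.
have yw : y `^ w = x by rewrite /y -powRrM mulVf ?gt_eqF// powRr1//; lra.
pose m := (Num.truncn y).+1; pose N := (Num.truncn (3 * l)).+1.
have [my ym] : y < m%:R /\ m%:R <= y + 1.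
  have /truncn_itv/andP[h1 h2] : 0 <= y by lra.
  by split => //; rewrite /m -natr1 lerD2r.
have [Nl lN] : 3 * l < N%:R /\ N%:R <= 3 * l + 1.
  have /truncn_itv/andP[h1 h2] : 0 <= 3 * l by lra.
  by split => //; rewrite /N -natr1 lerD2r.
exists m, N; split => //.
  apply: (le_trans mM); apply: le_trans (ltW my).
  have -> : M = (M `^ w) `^ w^-1.
    by rewrite -powRrM mulfV ?gt_eqF// powRr1//; lra.
  by apply: le_pow => //; lra.
split => //; first lra.
- by rewrite -/x -yw; apply: le_pow; rewrite ?(ltW w0) ?(ltW my)//; lra.
- have eN : expR (- N%:R) <= (n%:R ^+ 3)^-1 :> R.
    rewrite -[n%:R in leRHS]lnK ?posrE// -/l -expRM_natl -expRN ler_expR.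
    lra.
  apply: (@le_trans _ _ ((2 * (kappa * (n%:R * n%:R))) * (2 * (n%:R ^+ 3)^-1))).
    apply: ler_pM => //.
    - have : x <= kappa * (n%:R * n%:R).
        by rewrite /x ler_pM2l ?ler_pM2l//; lra.
      lra.
    - by rewrite ler_pM2l.
  have -> : 2 * (kappa * (n%:R * n%:R)) * (2 / n%:R ^+ 3) = 4 * kappa / n%:R :> R.
    by field; rewrite gt_eqF.
  by rewrite ler_pdivrMr//; lra.
- have we : - (s / w) = w^-1 * - s by ring.
  rewrite -/x -/w we powRrM -/y -powRM//; last lra.
  rewrite !powRN lef_pV2 ?posrE ?powR_gt0//; try lra.
  by apply: le_pow; [exact: ltW| lra|lra].
Qed.

End resolution.

Theorem theorem3p4 (R : realType) (r p s L sigma : R)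
    (hr : 1 < r) (hr_even : ~ exists k : int, r = 2 * k%:~R)
    (hrp : r <= p) (hs : 0 < s) (hL : 0 < L) (hsigma : 0 < sigma) :
  exists2 C' : R, 0 < C' &
    \forall n \near \oo,
      forall (d : measure_display) (Omega : measurableType d)
             (P : probability Omega R) (B : R -> {RV P >-> R}),
        brownian01 B ->
        ((C' * (n%:R * ln n%:R) `^ (- (s / (2 * s + 1))))%:E
          <= minimax_risk B sigma n r (besov_ball s p L) `^ 2^-1)%E.
Proof.
have rk (k : nat) : r != 2 * k%:R.
  by apply/eqP => rE; apply: hr_even; exists k%:Z.
have [E [c1 [m0 [E0 c10 lower]]]] := scale_lower_bound hr rk hrp hs hL hsigma.
pose kappa : R := 2 * E + 1.
have k1 : 1 <= kappa by rewrite /kappa; lra.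
have [X res] := resolution_exists m0 hs k1.
pose e := - (s / (2 * s + 1)).
exists (c1 * 2 `^ (- s) * kappa `^ e).
  by rewrite !mulr_gt0 ?powR_gt0//; lra.
near=> n; move=> d Omega P B BB.
have Xn : X <= n%:R by near: n; exact: nbhs_infty_ger.
have [m [N [n0 m1 N0 m0m [ln1 N4 xm mN rate]]]] := res n Xn.
have nln : 0 <= n%:R * ln (n%:R : R) by rewrite mulr_ge0//; lra.
have En : E * (n%:R * N%:R) <= 2 * m%:R `^ (2 * s + 1).
  apply: (@le_trans _ _ (E * (n%:R * (4 * ln n%:R)))).
    by rewrite ler_pM2l// ler_wpM2l.
  have : 2 * (kappa * (n%:R * ln n%:R)) <= 2 * m%:R `^ (2 * s + 1).
    by rewrite ler_pM2l.
  rewrite /kappa; lra.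
have low := lower n m N n0 m1 N0 m0m En mN d Omega P B BB.
set v := c1 * m%:R `^ (- s) in low.
have v0 : 0 <= v by rewrite mulr_ge0 ?powR_ge0// ltW.
apply: (@le_trans _ _ v%:E).
  rewrite lee_fin -!mulrA ler_pM2l// -powRM//; lra.
have -> : v%:E = ((v ^+ 2)%:E `^ 2^-1)%E.
  by rewrite poweR_EFin -powR_mulrn// -powRrM mulfV// powRr1.
have low0 := le_trans (_ : (0 <= (v ^+ 2)%:E)%E) low.
apply: gt0_ler_poweR low => //; rewrite in_itv/= leey andbT ?lee_fin ?sqr_ge0//.
by apply: low0; rewrite lee_fin sqr_ge0.
Unshelve. all: by end_near.
Qed.
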